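(* Suppose $K=K_1$ (the special but non-hyperspecial maximal compact open subgroup of $G$, up to conjugacy) and that the residue field of $F$ has cardinality $q=p$. Then for any weight $\sigma$ of $K$, the universal supersingular quotient $\mathrm{ind}^G_K\sigma/(T_\sigma)$ is not an irreducible representation of $G$.
   Context: Let $F$ be a non-archimedean local field of odd residue characteristic $p$, with residue field $k_F$ of cardinality $q$, and let $E/F$ be the unramified quadratic extension, with ring of integers $\mathfrak o_E$, maximal ideal $\mathfrak p_E$, non-trivial Galois conjugation $x\mapsto\bar x$, and a fixed uniformizer $\varpi_E$ of $E$ lying in $F$. Put $\beta=\begin{pmatrix}0&0&1\\0&1&0\\1&0&0\end{pmatrix}$, $\mathrm h(v_1,v_2)=v_1^{T}\beta\,\overline{v_2}$ on $E^3$, and $G=\{g\in \mathrm{GL}(3,E): \mathrm h(gv_1,gv_2)=\mathrm h(v_1,v_2)\ \forall v_1,v_2\in E^3\}$. Let $H$, $N$, $N'$ be the subgroups of $G$ of diagonal, upper unipotent and lower unipotent matrices, and $B=HN$. Up to conjugacy, $G$ has two maximal compact open subgroups $$K_0=\mathrm{GL}(3,\mathfrak o_E)\cap G,\qquad K_1=\begin{pmatrix}\mathfrak o_E&\mathfrak o_E&\mathfrak p_E^{-1}\\ \mathfrak p_E&\mathfrak o_E&\mathfrak o_E\\ \mathfrak p_E&\mathfrak p_E&\mathfrak o_E\end{pmatrix}\cap G;$$ $K_0$ is hyperspecial and $K_1$ is special but not hyperspecial. Let $K\in\{K_0,K_1\}$, let $K^1$ be its maximal normal pro-$p$ subgroup,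 and $\Gamma_K=K/K^1$. Let $\mathbb B,\mathbb U,\mathbb U'$ be the images in $\Gamma_K$ of $B\cap K$, $N\cap K$, $N'\cap K$; let $I_K$, $I_{1,K}$, $I'_{1,K}$ be the preimages in $K$ of $\mathbb B,\mathbb U,\mathbb U'$. Put $\alpha=\mathrm{diag}(\varpi_E^{-1},1,\varpi_E)\in G$, and let $\beta_K=\beta$ if $K=K_0$, $\beta_K=\beta\alpha^{-1}$ if $K=K_1$. Put $H_0=H\cap I_K$, $H_1=H\cap I_{1,K}$; characters of $I_K/I_{1,K}\cong H_0/H_1$ are identified. For such a character $\chi$, $\chi^s(h)=\chi(\beta_Kh\beta_K^{-1})$. All representations are smooth over $\overline{\mathbf F}_p$. A weight of $K$ is an irreducible smooth representation $\sigma$ of $K$ (equivalently an irreducible representation of $\Gamma_K$). It is known that $\sigma^{I_{1,K}}$ is one-dimensional and that the composite $\sigma^{I_{1,K}}\hookrightarrow\sigma\twoheadrightarrow\sigma_{I'_{1,K}}$ (coinvariants) is an isomorphism; $\chi_\sigma$ denotes the character by which $I_K$ acts on $\sigma^{I_{1,K}}$, and $j_\sigma\in\mathrm{End}(\sigma)$ is the composite of $\sigma\twoheadrightarrow\sigma_{I'_{1,K}}$, the inverse of that isomorphism, and the inclusion $\sigma^{I_{1,K}}\hookrightarrow\sigma$. $\mathrm{ind}^G_K\sigma$ is the compact induction: smooth compactly supported $f:G\to\sigma$ with $f(kg)=\sigma(k)f(g)$ for $k\in K$, with $G$ acting by right translation. Let $\varphi:G\to\mathrm{End}(\sigma)$ be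 the function supported on $K\alpha K$ with $\varphi(kgk')=\sigma(k)\varphi(g)\sigma(k')$ for $k,k'\in K$ and $\varphi(\alpha)=j_\sigma$, and let $T\in\mathrm{End}_G(\mathrm{ind}^G_K\sigma)$ be the operator $(Tf)(g)=\sum_{x\in G/K}\varphi(x)f(x^{-1}g)$. Define $T_\sigma=T$ if $\dim\sigma>1$; $T_\sigma=T$ if $\dim\sigma=1$, $\chi_\sigma=\chi_\sigma^s$ and $\chi_\sigma$ is not of the form $\chi\circ\det$; $T_\sigma=T+1$ if $\dim\sigma=1$ and $\chi_\sigma=\chi\circ\det$ on $H_0$ for some character $\chi$ of $\{x\in E^\times: x\bar x=1\}$. For an endomorphism $S$ of $\mathrm{ind}^G_K\sigma$, $(S)$ denotes its image, so $\mathrm{ind}^G_K\sigma/(T_\sigma)$ is the cokernel of $T_\sigma$. *)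

(* Defs.v *)
From HB Require Import structures.
From mathcomp Require Import all_boot all_order all_algebra all_field.
From mathcomp Require Import boolp classical_sets functions cardinality fsbigop.
From mathcomp Require Import topology_structure uniform_structure compact.
From mathcomp Require Import matrix_topology.

Set Implicit Arguments.
Unset Strict Implicit.
Unset Printing Implicit Defensive.

Import Order.TTheory GRing.Theory Num.Theory.

Local Open Scope classical_set_scope.
Local Open Scope ring_scope.

(* The value of a valuation at 0 carries no information (it stands for
   +oo); every use below goes through [pideal] or asks for x != 0. *)
Record dvaluation (F : fieldType) := DValuation {
  dval :> F -> int;
  dvalM : forall x y, x != 0 -> y != 0 -> dval (x * y) = dval x + dval y;
  dvalD : forall x y, x != 0 -> y != 0 -> x + y != 0 ->
    Num.min (dval x) (dval y) <= dval (x + y);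
  dval_surj : exists2 x, x != 0 & dval x = 1
}.

(* The fractional ideal p^n; the ring of integers is p^0. *)
Definition pideal (F : fieldType) (v : dvaluation F) (n : int) : set F :=
  [set x | x = 0 \/ n <= v x].

Definition uniformizer (F : fieldType) (v : dvaluation F) (x : F) : Prop :=
  x != 0 /\ v x = 1.

Section ValuationTopology.
Context (F : fieldType) (v : dvaluation F).

Lemma dval1 : v 1 = 0.
Proof.
by apply: (addIr (v 1)); rewrite -dvalM ?oner_neq0// mulr1 add0r.
Qed.

Lemma dvalN x : v (- x) = v x.
Proof.
have [->|x0] := eqVneq x 0; first by rewrite oppr0.
have N10 : (-1 : F) != 0 by rewrite oppr_eq0 oner_neq0.
have vN1 : v (-1) = 0.
  have : v (-1) + v (-1) = 0 by rewrite -dvalM// mulrNN mulr1 dval1.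
  by move/eqP; rewrite -mulr2n mulrn_eq0/= => /eqP.
by rewrite -mulN1r dvalM// vN1 add0r.
Qed.

Lemma pidealN n x : pideal v n x -> pideal v n (- x).
Proof. by case=> [->|vx]; [left; rewrite oppr0|right; rewrite dvalN]. Qed.

Lemma pidealD n x y : pideal v n x -> pideal v n y -> pideal v n (x + y).
Proof.
case=> [->|vx]; first by rewrite add0r.
case=> [->|vy]; first by rewrite addr0; right.
have [->|x0] := eqVneq x 0; first by rewrite add0r; right.
have [->|y0] := eqVneq y 0; first by rewrite addr0; right.
have [->|xy0] := eqVneq (x + y) 0; first by left.
by right; rewrite (le_trans _ (dvalD v x0 y0 xy0))// le_min vx vy.
Qed.

Lemma sub_pideal m n : m <= n -> pideal v n `<=` pideal v m.
Proof. by move=> mn x [->|vx]; [left|right; exact: le_trans mn vx]. Qed.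

End ValuationTopology.

(* The field F with the topology and uniform structure of the valuation v. *)
Definition vtop (F : fieldType) (v : dvaluation F) : Type := F.

Section ValuedUniform.
Local Open Scope relation_scope.
Context (F : fieldType) (v : dvaluation F).

HB.instance Definition _ := Choice.copy (vtop v) F.

Definition vent : set_system (vtop v * vtop v) :=
  filter_from setT (fun n : int =>
    [set xy | pideal v n ((xy.1 : F) - (xy.2 : F))]).

Lemma vent_filter : Filter vent.
Proof.
apply: filter_from_filter; first by exists 0.
move=> m n _ _; exists (Num.max m n) => // xy xyP; split;
  by apply: sub_pideal xyP; rewrite le_max lexx ?orbT.
Qed.

Lemma vent_diagonal A : vent A -> diagonal `<=` A.
Proof.
move=> [n _ nA] [x y]; rewrite /diagonal /= => ->.
by apply: nA; left; rewrite /= subrr.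
Qed.

Lemma vent_inv A : vent A -> vent A^-1.
Proof.
move=> [n _ nA]; exists n => // -[x y] /= xy; apply: nA => /=.
by rewrite -opprB; exact: pidealN.
Qed.

Lemma vent_split A : vent A -> exists2 B, vent B & B \; B `<=` A.
Proof.
move=> [n _ nA].
exists [set xy | pideal v n ((xy.1 : F) - (xy.2 : F))]; first by exists n.
move=> [x z] [y /= xy yz]; apply: nA => /=.
by rewrite -(subrKA y); exact: pidealD.
Qed.

HB.instance Definition _ := isUniform.Build (vtop v)
  vent_filter vent_diagonal vent_inv vent_split.

End ValuedUniform.

(* [red] is only meaningful on the ring of integers; it identifies the
   residue field with k. *)
Record residue_map (F : fieldType) (v : dvaluation F) (k : fieldType)
    (red : F -> k) : Prop := ResidueMap {
  red1 : red 1 = 1;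
  redD : forall x y, pideal v 0 x -> pideal v 0 y ->
    red (x + y) = red x + red y;
  redM : forall x y, pideal v 0 x -> pideal v 0 y ->
    red (x * y) = red x * red y;
  red_ker : forall x, pideal v 0 x -> red x = 0 <-> pideal v 1 x;
  red_surj : forall a, exists2 x, pideal v 0 x & red x = a
}.

(* Finiteness of the residue field is carried by the type of k. *)
Definition local_field (F : fieldType) (v : dvaluation F) (k : finFieldType)
    (red : F -> k) : Prop :=
  (forall S : set_system (vtop v), ProperFilter S -> cauchy S ->
     exists x : vtop v, S --> x)
  /\ residue_map v red.

(* Ramification index 1; the residue extension is automatically separable. *)
Definition unramified (F : fieldType) (E : fieldExtType F)
    (vF : dvaluation F) (vE : dvaluation E) : Prop :=
  forall a : F, a != 0 -> vE a%:A = vF a.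

Definition rel_open (T : topologicalType) (A B : set T) : Prop :=
  exists2 U, open U & B = A `&` U.

Section Matrices.
Context (E : fieldType).
Implicit Types (A B K P N : set 'M[E]_3).

Definition mx3 (T : Type) (x0 : T) (rows : seq (seq T)) : 'M[T]_3 :=
  \matrix_(i, j) nth x0 (nth [::] rows i) j.

Definition beta : 'M[E]_3 :=
  mx3 0 [:: [:: 0; 0; 1];
            [:: 0; 1; 0];
            [:: 1; 0; 0] ].

Definition alpha (w : E) : 'M[E]_3 :=
  mx3 0 [:: [:: w^-1; 0; 0];
            [:: 0;    1; 0];
            [:: 0;    0; w] ].

Definition betaK1 (w : E) : 'M[E]_3 := beta *m invmx (alpha w).

Definition herm (conj : E -> E) (v1 v2 : 'cV[E]_3) : E :=
  (v1^T *m beta *m map_mx conj v2) 0 0.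

Definition unitary (conj : E -> E) : set 'M[E]_3 :=
  [set g | g \in unitmx /\
    forall v1 v2, herm conj (g *m v1) (g *m v2) = herm conj v1 v2].

Definition diag_part A : set 'M[E]_3 := [set g | A g /\ is_diag_mx g].

Definition upper_unip A : set 'M[E]_3 :=
  [set g | [/\ A g, is_trig_mx g^T & forall i, g i i = 1]].

Definition lower_unip A : set 'M[E]_3 :=
  [set g | [/\ A g, is_trig_mx g & forall i, g i i = 1]].

Definition borel A : set 'M[E]_3 :=
  [set h *m u | h in diag_part A & u in upper_unip A].

Definition level_group (v : dvaluation E) A (lvl : 'M[int]_3) : set 'M[E]_3 :=
  [set g | A g /\ forall i j, pideal v (lvl i j) (g i j)].

Definition K1 (conj : E -> E) (v : dvaluation E) : set 'M[E]_3 :=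
  level_group v (unitary conj)
    (mx3 0 [:: [:: 0; 0; -1];
               [:: 1; 0; 0];
               [:: 1; 1; 0] ]).

Definition subgroup A : Prop :=
  [/\ A `<=` [set g | g \in unitmx], A 1%:M,
      forall g h, A g -> A h -> A (g *m h) &
      forall g, A g -> A (invmx g)].

Definition normal_subgroup N A : Prop :=
  [/\ subgroup N, N `<=` A &
      forall g n, A g -> N n -> N (g *m n *m invmx g)].

Definition lcoset (x : 'M[E]_3) A : set 'M[E]_3 := [set x *m a | a in A].

Definition lcosets A B : set (set 'M[E]_3) := [set lcoset x B | x in A].

Definition mx_compact (v : dvaluation E) A : Prop :=
  compact (A : set 'M[vtop v]_3).

Definition mx_rel_open (v : dvaluation E) A B : Prop :=
  @rel_open 'M[vtop v]_3 A B.

(* A subgroup of GL_3(E) is Hausdorff and totally disconnected, so it is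
   profinite as soon as it is compact. *)
Definition pro_p (v : dvaluation E) (p : nat) P : Prop :=
  [/\ subgroup P, mx_compact v P &
      forall N, normal_subgroup N P -> mx_rel_open v P N ->
        exists n, (lcosets P N #= `I_(p ^ n))%card].

(* The largest normal pro-p subgroup of K, as the union of all of them. *)
Definition pro_p_core (v : dvaluation E) (p : nat) K : set 'M[E]_3 :=
  [set g | exists P, [/\ normal_subgroup P K, pro_p v p P & P g]].

(* The preimage in K of the image of A `&` K in K / N. *)
Definition preim_image K N A : set 'M[E]_3 :=
  [set g | K g /\ exists2 a, (A `&` K) a & N (invmx a *m g)].

End Matrices.

Section Representations.
Context (E : fieldType) (v : dvaluation E).
Context (C : fieldType) (V : lmodType C).
Implicit Types (A : set 'M[E]_3) (r : 'M[E]_3 -> {linear V -> V}).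

(* Representations of a subgroup A of GL_3(E) are given by functions on all
   matrices, of which only the values on A matter. *)
Definition representation A r : Prop :=
  (forall x, r 1%:M x = x) /\
  (forall g h x, A g -> A h -> r (g *m h) x = r g (r h x)).

Definition irreducible_rep A r : Prop :=
  [/\ representation A r, exists x : V, x != 0 &
      forall W : {pred V}, submod_closed W ->
        (forall g x, A g -> x \in W -> r g x \in W) ->
        W =i pred1 0 \/ W =i predT].

Definition smooth_vector (X : Type) A (r : 'M[E]_3 -> X -> X) (x : X) :=
  mx_rel_open v A [set g | A g /\ r g x = x].

Definition smooth_rep A r : Prop := forall x, smooth_vector A r x.

Definition invariants A r : set V := [set x | forall g, A g -> r g x = x].

(* The kernel of the projection from V to the A-coinvariants. *)
Definition coinv_ker A r : set V :=
  [set x | forall W : {pred V}, submod_closed W ->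
    (forall g y, A g -> r g y - y \in W) -> x \in W].

Definition dim1 : Prop :=
  exists2 e : V, e != 0 & forall x : V, exists a : C, x = a *: e.

End Representations.

Section Supersingular.
Context (E : fieldType) (conj : E -> E) (v : dvaluation E) (w : E) (p : nat).
Context (K : set 'M[E]_3) (betaK : 'M[E]_3).
Context (C : fieldType) (V : lmodType C) (sigma : 'M[E]_3 -> {linear V -> V}).

Local Notation G := (unitary conj).

Definition Iw : set 'M[E]_3 := preim_image K (pro_p_core v p K) (borel G).
Definition Iw1 : set 'M[E]_3 :=
  preim_image K (pro_p_core v p K) (upper_unip G).
Definition Iw1' : set 'M[E]_3 :=
  preim_image K (pro_p_core v p K) (lower_unip G).
Definition H0 : set 'M[E]_3 := diag_part G `&` Iw.

(* Only the values of chi_sigma on Iw matter. *)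
Definition chi_sigma (g : 'M[E]_3) : C :=
  xget 0 [set c | forall x, invariants Iw1 sigma x -> sigma g x = c *: x].

(* The image of x is the unique Iw1-invariant vector with the same class as x
   in the Iw1'-coinvariants. *)
Definition j_sigma (x : V) : V :=
  xget 0 [set y | invariants Iw1 sigma y /\ coinv_ker Iw1' sigma (x - y)].

Definition double_coset (g : 'M[E]_3) : set 'M[E]_3 :=
  [set k *m g *m k' | k in K & k' in K].

Definition phi_spec (phi : 'M[E]_3 -> V -> V) : Prop :=
  [/\ forall g, ~ double_coset (alpha w) g -> phi g = (fun=> 0),
      forall k g k' x, K k -> G g -> K k' ->
        phi (k *m g *m k') x = sigma k (phi g (sigma k' x)) &
      phi (alpha w) = j_sigma].

(* There is exactly one function satisfying [phi_spec]. *)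
Definition phi : 'M[E]_3 -> V -> V := xget (fun _ _ => 0) [set f | phi_spec f].

Definition rtrans (T : Type) (g : 'M[E]_3) (f : 'M[E]_3 -> T) : 'M[E]_3 -> T :=
  fun x => f (x *m g).

(* The space of ind_K^G sigma; functions on G are extended by 0 to all
   matrices. *)
Definition cInd : set ('M[E]_3 -> V) :=
  [set f | [/\ forall g, ~ G g -> f g = 0,
               forall k g, K k -> G g -> f (k *m g) = sigma k (f g),
               smooth_vector v G (@rtrans V) f &
               exists2 S, S `<=` G /\ mx_compact v S &
                 forall g, ~ S g -> f g = 0]].

(* [xget 1%:M X] is a representative of the coset X; the summand does not
   depend on it, and the sum has finite support for f in cInd. *)
Definition hecke_T (f : 'M[E]_3 -> V) : 'M[E]_3 -> V := fun g =>
  \sum_(X \in lcosets G K)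
    (let x := xget 1%:M X in phi x (f (invmx x *m g))).

Definition chi_s_invariant : Prop :=
  forall h, H0 h -> chi_sigma (betaK *m h *m invmx betaK) = chi_sigma h.

Definition norm_one : set E := [set x | x * conj x = 1].

Definition norm_one_char (c : E -> C) : Prop :=
  [/\ c 1 = 1,
      forall x y, norm_one x -> norm_one y -> c (x * y) = c x * c y &
      @rel_open (vtop v) norm_one [set x | norm_one x /\ c x = 1]].

Definition chi_factors_det : Prop :=
  exists2 c, norm_one_char c & forall h, H0 h -> chi_sigma h = c (\det h).

(* If dim sigma = 1 then chi_sigma is the restriction of a character of K, and
   it is equal to chi_sigma^s because betaK lies in K; so the last branch is
   the case dim sigma = 1, chi_sigma = chi o det. *)
Definition T_sigma (f : 'M[E]_3 -> V) : 'M[E]_3 -> V :=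
  if ~~ `[< dim1 V >] then hecke_T f
  else if `[< chi_s_invariant /\ ~ chi_factors_det >] then hecke_T f
  else hecke_T f + f.

(* (Q, rho) is a model, via the projection pr, of the quotient
   representation ind_K^G sigma / (T_sigma). Only the values of pr on cInd
   matter. *)
Definition is_coker (Q : lmodType C) (rho : 'M[E]_3 -> {linear Q -> Q})
    (pr : ('M[E]_3 -> V) -> Q) : Prop :=
  [/\ forall a f f', cInd f -> cInd f' -> pr (a *: f + f') = a *: pr f + pr f',
      forall q, exists2 f, cInd f & pr f = q,
      forall f, cInd f ->
        (pr f = 0 <-> exists2 f', cInd f' & f = T_sigma f') &
      forall g f, G g -> cInd f -> pr (rtrans g f) = rho g (pr f)].

End Supersingular.

(* Main.v *)
(* K0 and K1 fix the ends of an edge of the Bruhat-Tits tree, and J, their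
   intersection, is an Iwahori subgroup with pro-p radical J1.  As q = p, J1 acts
   on the weight through a cyclic group of order p, so the weight is uniserial
   for J1: the J1-fixed line is spanned by an eigenvector [w0] of J, and the
   operator phi(alpha) is given by a linear form [lam] on the weight.

   Let [e0] be the function supported on K1 with value [w0] at 1, and [e1] the
   sum of its translates by u beta, u running through the p^3 cosets of
   J / (J `&` beta J beta).  Then T maps any function supported on K1 into the
   G-submodule M generated by [e1].  Since p divides the number of cosets, [e0]
   is not in the K0-span of [e1]; hence no element of that span lives on a single
   edge at K0, and looking at a vertex farthest from the origin of the tree shows
   that M contains no nonzero function supported on K1.  On the other hand [e1] is
   not in the image of T: every nonzero vector of the weight has translates with
   nonzero [lam] along two distinct edges at K1, so T moves supports outwards.
   So M is a proper nonzero submodule of the cokernel.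

   When T_sigma = T + 1 the weight is a character which is equal to c o det on J,
   and the same argument works with e0 + sigma(s) e1, on which K0 acts by
   c o det, in place of [e1]. *)

Require Import Defs.
From mathcomp Require Import all_boot all_order all_algebra all_field.
From mathcomp Require Import boolp classical_sets functions cardinality fsbigop.
From mathcomp Require Import filter topology_structure uniform_structure compact.
From mathcomp Require Import matrix_topology zify ring.

Set Implicit Arguments.
Unset Strict Implicit.
Unset Printing Implicit Defensive.

Import Order.TTheory GRing.Theory Num.Theory.

Local Open Scope classical_set_scope.
Local Open Scope ring_scope.

(** * Groups with a rank-one Bruhat decomposition *)

(** Everything about the weight is extracted from irreducibility, smoothness and the rank-one Bruhat
    decomposition. One abstract statement serves at both vertices: when the number of big-cell
    cosets vanishes in C, a vector is not in the span of the translates of its big-cell sum. At K1,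
    with q cosets, irreducibility turns it into the cyclicity of the weight under J1; at K0, with
    q^3 cosets, it bounds the submodule generated by the sum. The condition q = p enters through the
    unipotent quotient at K1, the group of trace-zero residues: it is then generated by one element,
    so a single nilpotent operator describes the action of J1, and its kernel and cokernel are
    lines. Distances in the tree are read off the valuations of matrix entries, and cancellation at
    an extremal vertex is excluded by taking expressions with as few terms as possible. In the case
    T + 1 the constant 1 is the number p + 1 of edges at a K1-vertex, read in C. *)

Section Groups.
Context (E : fieldType).
Implicit Types (A : set 'M[E]_3) (g h : 'M[E]_3).

Lemma subgroup_unit A g : subgroup A -> A g -> g \in unitmx.
Proof. by case=> AU _ _ _ /AU. Qed.

Lemma subgroup1 A : subgroup A -> A 1%:M.
Proof. by case. Qed.

Lemma subgroupM A g h : subgroup A -> A g -> A h -> A (g *m h).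
Proof. by case=> _ _ AM _; apply: AM. Qed.

Lemma subgroupV A g : subgroup A -> A g -> A (invmx g).
Proof. by case=> _ _ _; apply. Qed.

Lemma invmxM g h : g \in unitmx -> h \in unitmx ->
  invmx (g *m h) = invmx h *m invmx g.
Proof.
move=> gU hU; have ghU : g *m h \in unitmx by rewrite unitmx_mul gU.
apply: (can_inj (mulKmx ghU)); rewrite mulmxV// -mulmxA.
by rewrite [h *m _]mulmxA mulmxV// mul1mx mulmxV.
Qed.

Lemma invmx_eq g h : g *m h = 1%:M -> invmx g = h.
Proof.
move=> gh; have [gU _] := mulmx1_unit gh.
by rewrite -[invmx g]mulmx1 -gh mulKmx.
Qed.

End Groups.

(* A group K with a "rank one" decomposition: I plays the role of a Borel
   subgroup, s of the simple reflection and the u r are representatives of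
   I / (I `&` s I s). *)
Record rank_one (E : fieldType) (K I N : set 'M[E]_3) (s : 'M[E]_3)
    (R : finType) (r0 : R) (u : R -> 'M[E]_3) : Prop := RankOne {
  ro_K : subgroup K;
  ro_I : subgroup I;
  ro_N : normal_subgroup N K;
  ro_NI : N `<=` I;
  ro_IK : I `<=` K;
  ro_s : K s;
  ro_ss : s *m s = 1%:M;
  ro_u : forall r, I (u r);
  ro_u0 : u r0 = 1%:M;
  ro_bruhat : forall k, K k -> ~ I k ->
    exists r i, I i /\ k = u r *m s *m i;
  ro_coset : forall i, I i -> exists r, I (s *m (invmx (u r) *m i) *m s);
  ro_inj : forall q r, I (s *m (invmx (u q) *m u r) *m s) -> q = r;
  ro_mul : forall q r, exists t, N (invmx (u t) *m (u q *m u r));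
  ro_diag : forall i r r' q q', I i ->
    I (s *m (invmx (u r') *m (i *m u r)) *m s) ->
    I (s *m (invmx (u q') *m (i *m u q)) *m s) ->
    N (invmx (invmx (u r') *m (i *m u r)) *m (invmx (u q') *m (i *m u q)))
}.

Section RankOneModule.
Context (E C : fieldType) (X : lmodType C) (rho : 'M[E]_3 -> X -> X).
Context (K I N : set 'M[E]_3) (s : 'M[E]_3).
Context (R : finType) (r0 : R) (u : R -> 'M[E]_3).
Hypothesis ro : rank_one K I N s r0 u.
Hypothesis rho_lin : forall g a x y, rho g (a *: x + y) = a *: rho g x + rho g y.
Hypothesis rhoM : forall g h x, K g -> K h -> rho (g *m h) x = rho g (rho h x).
Hypothesis cardR : #|R|%:R = 0 :> C.

Context (y : X) (Z : {pred X}).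
Hypothesis rho1 : rho 1%:M y = y.
Hypothesis yI : forall i, I i -> exists c, rho i y = c *: y.
Hypothesis yN : forall i, N i -> rho i y = y.
Hypothesis yu : forall r, rho (u r) y = y.
Hypothesis Zsub : submod_closed Z.
Hypothesis yZ : y \notin Z.
Hypothesis uZ : forall r, rho (u r *m s) y \in Z.

Let uK r : K (u r). Proof. exact: (ro_IK ro (ro_u ro r)). Qed.
Let uU r : u r \in unitmx. Proof. exact: (subgroup_unit (ro_K ro) (uK r)). Qed.
Let IK i : I i -> K i. Proof. exact: (ro_IK ro). Qed.
Let sK : K s. Proof. exact: (ro_s ro). Qed.
Let KM g h : K g -> K h -> K (g *m h).
Proof. exact: subgroupM (ro_K ro). Qed.
Let NK i : N i -> K i. Proof. by move=> /(ro_NI ro)/IK. Qed.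
Let Nconj g n : K g -> N n -> N (g *m n *m invmx g).
Proof. by case: (ro_N ro) => _ _ h; apply: h. Qed.
Let Kinv g : K g -> K (invmx g). Proof. exact: subgroupV (ro_K ro). Qed.
Let sV : invmx s = s. Proof. exact: invmx_eq (ro_ss ro). Qed.
Let Ns n : N n -> N (s *m n *m s).
Proof. by move=> /(Nconj sK); rewrite sV. Qed.
Let KU g : K g -> g \in unitmx. Proof. exact: subgroup_unit (ro_K ro). Qed.

Let rhoD g x z : rho g (x + z) = rho g x + rho g z.
Proof. by rewrite -[x]scale1r rho_lin !scale1r. Qed.
Let rho0 g : rho g 0 = 0.
Proof.
have : rho g 0 + rho g 0 = rho g 0 + 0 by rewrite -rhoD !addr0.
by move/addrI.
Qed.
Let rhoZ g a x : rho g (a *: x) = a *: rho g x.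
Proof. by rewrite -[a *: x]addr0 rho_lin rho0 addr0. Qed.
Let rho_sum (J : Type) (l : seq J) (F : J -> X) g :
  rho g (\sum_(j <- l) F j) = \sum_(j <- l) rho g (F j).
Proof.
elim: l => [|a l IH]; first by rewrite !big_nil rho0.
by rewrite !big_cons rhoD IH.
Qed.

Let us_swap g h : K g -> N h -> rho (g *m h *m s) y = rho (g *m s) y.
Proof.
move=> Kg Nh.
have -> : g *m h *m s = (g *m s) *m (s *m h *m s).
  by rewrite -!mulmxA [s *m (s *m _)]mulmxA (ro_ss ro) mul1mx.
have Nh' := Ns Nh; by rewrite (rhoM _ (KM Kg sK) (NK Nh')) (yN Nh').
Qed.

(** The operator of the double coset of [s] applied to [y]. It is used for [y = w0] in the weight
    and for [y = e0] in the induced representation, where it becomes [e1]. *)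
Definition ro_e : X := \sum_r rho (u r *m s) y.
Local Notation e := ro_e.

Let Ninj q r : N (invmx (u q) *m u r) -> q = r.
Proof. by move=> Nqr; apply: (ro_inj ro); apply: (ro_NI ro); apply: Ns. Qed.

Lemma ro_e_u q : rho (u q) e = e.
Proof.
have /choice [t Ht] := ro_mul ro q.
have tinj : injective t.
  move=> r r' trr; apply: Ninj.
  have N2 := Ht r'; have N1 := Ht r; rewrite -trr in N2.
  have SN : subgroup N by case: (ro_N ro).
  have := subgroupM SN (subgroupV SN N1) N2.
  rewrite !invmxM ?invmxK ?unitmx_mul ?unitmx_inv ?uU//.
  by rewrite -!mulmxA mulKVmx// mulKmx.
rewrite /e rho_sum [RHS](reindex_inj tinj)/=; apply: eq_bigr => r _.
rewrite -rhoM//; last exact: KM.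
have -> : u q *m (u r *m s) = u (t r) *m (invmx (u (t r)) *m (u q *m u r)) *m s.
  by rewrite mulKVmx// mulmxA.
by rewrite us_swap.
Qed.

Lemma ro_e_N n : N n -> rho n e = e.
Proof.
move=> Nn; rewrite /e rho_sum; apply: eq_bigr => r _.
rewrite -rhoM//; [|exact: NK|exact: KM].
have -> : n *m (u r *m s) = u r *m (invmx (u r) *m n *m invmx (invmx (u r))) *m s.
  by rewrite invmxK !mulmxA mulmxV// mul1mx.
by rewrite us_swap//; apply: Nconj => //; exact: Kinv.
Qed.

(** Left multiplication by [i] permutes the cosets of the [u r]. By [ro_diag] the cofactors left
    over from two cosets differ by an element of [N], which fixes [y] even after conjugation by [s];
    hence one scalar [c], computed on the coset of [r], serves for all terms. *)
Lemma ro_e_eigen i l r r' c : I i -> I l -> i *m u r = u r' *m l ->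
  I (s *m l *m s) -> rho (s *m l *m s) y = c *: y -> rho i e = c *: e.
Proof.
move=> Ii Il irl Il' cE.
have lE : l = invmx (u r') *m (i *m u r) by rewrite irl mulKmx.
have /choice [t Ht] : forall q, exists t, I (s *m (invmx (u t) *m (i *m u q)) *m s).
  by move=> q; apply: (ro_coset ro); apply: (subgroupM (ro_I ro)) => //; exact: (ro_u ro).
have tinj : injective t.
  move=> q q' tqq; apply: (ro_inj ro).
  have N2 := Ht q'; have N1 := Ht q; rewrite -tqq in N2.
  have iU := KU (IK Ii).
  have := subgroupM (ro_I ro) (subgroupV (ro_I ro) N1) N2.
  have sU := KU sK.
  rewrite !invmxM ?invmxK ?unitmx_mul ?unitmx_inv ?uU ?iU ?sU ?sV//.
  rewrite -!mulmxA [s *m (s *m _)]mulmxA (ro_ss ro) mul1mx mulKVmx//.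
  by rewrite mulKmx.
rewrite /e rho_sum scaler_sumr [RHS](reindex_inj tinj)/=.
apply: eq_bigr => q _; rewrite -rhoM//; [|exact: IK|exact: KM].
set m := invmx (u (t q)) *m (i *m u q).
have Nlm : N (invmx l *m m) by rewrite lE; apply: (ro_diag ro Ii _ (Ht q)); rewrite -lE.
have lU := KU (IK Il).
have -> : i *m (u q *m s) = (u (t q) *m s) *m ((s *m l *m s) *m (s *m (invmx l *m m) *m s)).
  rewrite -!mulmxA [s *m (s *m _)]mulmxA (ro_ss ro) mul1mx.
  rewrite [s *m (s *m _)]mulmxA (ro_ss ro) mul1mx mulKVmx// /m.
  by rewrite !mulmxA mulmxV// mul1mx.
have KN := NK (Ns Nlm); have Kl := IK Il'.
have Kus : K (u (t q) *m s) by apply: KM.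
by rewrite (rhoM _ Kus (KM Kl KN)) (rhoM _ Kl KN) (yN (Ns Nlm)) cE rhoZ.
Qed.

Lemma ro_e_I i : I i -> exists c, rho i e = c *: e.
Proof.
move=> Ii; have [r' Hr'] := ro_coset ro Ii.
have [c cE] := yI Hr'; exists c.
apply: (ro_e_eigen (r := r0) (r' := r') (l := invmx (u r') *m i)) => //.
- apply: (subgroupM (ro_I ro)) => //; apply: (subgroupV (ro_I ro)); exact: (ro_u ro).
- by rewrite (ro_u0 ro) mulmx1 mulKVmx.
Qed.

(** The trace over the unipotent representatives. It kills every vector fixed by all [u r], since
    [#|R|] vanishes in [C], and it turns [rho s y] into [e]. *)
Let A (x : X) : X := \sum_r rho (u r) x.

Let A_lin a x z : A (a *: x + z) = a *: A x + A z.
Proof.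
by rewrite /A scaler_sumr -big_split; apply: eq_bigr => r _; rewrite rho_lin.
Qed.
Let AZ a x : A (a *: x) = a *: A x.
Proof. by rewrite /A scaler_sumr; apply: eq_bigr => r _; rewrite rhoZ. Qed.

Let A_fix x : (forall r, rho (u r) x = x) -> A x = 0.
Proof.
move=> xu; rewrite /A (eq_bigr (fun=> x)); last by move=> r _; exact: xu.
by rewrite sumr_const -scaler_nat cardR scale0r.
Qed.

Let A_u q x : (forall n, N n -> rho n x = x) -> A (rho (u q) x) = A x.
Proof.
move=> xN.
have /choice [t Ht] : forall r, exists t, N (invmx (u t) *m (u r *m u q)).
  by move=> r; exact: (ro_mul ro).
have SN : subgroup N by case: (ro_N ro).
have tinj : injective t.
  move=> r r' trr; apply: Ninj.
  have N2 := Ht r'; have N1 := Ht r; rewrite -trr in N2.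
  have := Nconj (uK q) (subgroupM SN (subgroupV SN N1) N2).
  rewrite !invmxM ?invmxK ?unitmx_mul ?unitmx_inv ?uU//.
  by rewrite -!mulmxA mulKVmx// mulKVmx// mulmxV// mulmx1.
rewrite /A [RHS](reindex_inj tinj)/=; apply: eq_bigr => r _.
rewrite -rhoM//.
by rewrite -[u r *m u q](mulKVmx (uU (t r))) (rhoM _ (uK _) (NK (Ht r))) xN.
Qed.

Let Z0 : 0 \in Z. Proof. by case: Zsub. Qed.
Let Zlin a x z : x \in Z -> z \in Z -> a *: x + z \in Z.
Proof. by case: Zsub => _; apply. Qed.
Let ZD x z : x \in Z -> z \in Z -> x + z \in Z.
Proof. by move=> xZ zZ; rewrite -[x]scale1r Zlin. Qed.
Let ZZ a x : x \in Z -> a *: x \in Z.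
Proof. by move=> xZ; rewrite -[a *: x]addr0 Zlin. Qed.
Let Zsum (F : R -> X) (P : pred R) : (forall r, P r -> F r \in Z) -> \sum_(r | P r) F r \in Z.
Proof. by move=> FZ; elim/big_rec: _ => // r z Pr zZ; apply: ZD => //; apply: FZ. Qed.

Let eZ : e \in Z. Proof. by apply: Zsum => r _; exact: uZ. Qed.

Let bigcell k : K k -> ~ I k -> exists c q, rho k y = c *: rho (u q *m s) y.
Proof.
move=> Kk nIk; have [q [i [Ii ->]]] := ro_bruhat ro Kk nIk.
have [c cE] := yI Ii; exists c, q.
rewrite rhoM ?cE ?rhoZ//; [exact: KM|exact: IK].
Qed.

(** The term of [r0] gives back [y], as [s] is an involution. In the other terms s u s lies outside
    [I] by [ro_inj], so the Bruhat decomposition returns them to the big cell, whose vectors are in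
    [Z]. *)
Let s_e : exists2 z, rho s e = y + z & forall q, rho (u q) z \in Z.
Proof.
rewrite /e rho_sum (bigD1 r0)//= -(rhoM _ sK (KM (uK r0) sK)).
rewrite (ro_u0 ro) mul1mx (ro_ss ro) rho1.
eexists; first by [].
move=> q; rewrite big_mkcond/= rho_sum.
apply: Zsum => r _; case: ifP => [rr0|]; last by rewrite rho0.
have [c [t ->]] : exists c t, rho s (rho (u r *m s) y) = c *: rho (u t *m s) y.
  rewrite -(rhoM _ sK (KM (uK r) sK)).
  apply: bigcell; first exact: KM sK (KM (uK r) sK).
  move=> Isus; move/eqP: rr0; apply; apply/esym/(ro_inj ro).
  by rewrite (ro_u0 ro) invmx1 mul1mx -mulmxA.
rewrite rhoZ -(rhoM _ (uK q) (KM (uK t) sK)).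
apply: ZZ; have [v Hv] := ro_mul ro q t.
have -> : u q *m (u t *m s) = u v *m (invmx (u v) *m (u q *m u t)) *m s.
  by rewrite mulKVmx// mulmxA.
by rewrite us_swap.
Qed.

Lemma ro_e_neq0 : e != 0.
Proof.
have [z se zZ] := s_e; apply: contraNneq yZ => e0.
move: se (zZ r0); rewrite e0 rho0 => /eqP; rewrite eq_sym addrC addr_eq0 => /eqP ->.
by rewrite -scaleN1r rhoZ yu => /(ZZ (-1)); rewrite scalerA mulrNN mulr1 scale1r.
Qed.

(** A single scalar records two things about [rho k e]: its trace, as a multiple of that of
    [rho s e], and its component along [y] modulo [Z]. Both vanish on [I], where [e] is an
    eigenvector fixed by the unipotents; on the big cell both are given by the eigenvalue of [i] on
    [e]. *)
Lemma ro_orbit_e k : K k -> exists2 c, A (rho k e) = c *: A (rho s e) &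
  rho k e - c *: y \in Z.
Proof.
move=> Kk; have [Ik|nIk] := pselect (I k).
  have [c cE] := ro_e_I Ik; exists 0; last by rewrite scale0r subr0 cE ZZ.
  by rewrite cE AZ A_fix ?scaler0 ?scale0r// => r; exact: ro_e_u.
have [q [i [Ii kE]]] := ro_bruhat ro Kk nIk.
have [c cE] := ro_e_I Ii; exists c.
  rewrite kE (rhoM _ (KM (uK q) sK) (IK Ii)) (rhoM _ (uK q) sK).
  rewrite cE !rhoZ AZ A_u// => n Nn.
  rewrite -(rhoM _ (NK Nn) sK).
  rewrite -[n *m s]mul1mx -(ro_ss ro) -!mulmxA [s *m (n *m s)]mulmxA.
  by rewrite (rhoM _ sK (NK (Ns Nn))) (ro_e_N (Ns Nn)).
rewrite kE (rhoM _ (KM (uK q) sK) (IK Ii)) (rhoM _ (uK q) sK).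
rewrite cE !rhoZ -scalerBr; apply: ZZ.
have [z -> zZ] := s_e.
by rewrite rhoD yu addrAC subrr add0r.
Qed.

(** Suppose [y] is in the span. Its component along [y] modulo [Z] is nonzero while its trace is
    zero, so by [ro_orbit_e] the trace of [rho s e] vanishes, and with it that of the whole span.
    The span also contains [rho s y], whose trace is [e]; so [e = 0], and then [y = 0], which lies
    in [Z]. *)
Theorem ro_notin_span (l : seq (C * 'M[E]_3)) :
  (forall ck, ck \in l -> K ck.2) -> y <> \sum_(ck <- l) ck.1 *: rho ck.2 e.
Proof.
move=> lK yE.
have lin (l' : seq (C * 'M[E]_3)) : (forall ck, ck \in l' -> K ck.2) ->
    exists2 c, A (\sum_(ck <- l') ck.1 *: rho ck.2 e) = c *: A (rho s e) &
      \sum_(ck <- l') ck.1 *: rho ck.2 e - c *: y \in Z.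
  elim: l' => [|[a k] l' IH] l'K.
    exists 0; rewrite big_nil ?scale0r ?subrr//.
    by have := AZ 0 0; rewrite !scale0r.
  have [|c Ac cZ] := IH; first by move=> ck ckl; apply: l'K; rewrite inE ckl orbT.
  have [|b Ab bZ] := @ro_orbit_e k; first by apply: (l'K (a, k)); exact: mem_head.
  exists (a * b + c); rewrite big_cons/=.
    by rewrite A_lin Ab Ac scalerA scalerDl.
  rewrite scalerDl opprD addrACA -scalerA -scalerBr.
  exact: Zlin.
have [c] := lin _ lK; rewrite -yE A_fix// => cA cZ.
have c0 : c != 0 by apply: contraNneq yZ => c0; move: cZ; rewrite c0 scale0r subr0.
have f0 : A (rho s e) = 0.
  by apply/eqP; move/esym/eqP: cA; rewrite scaler_eq0 (negPf c0).
have [|d] := lin [seq (ck.1, s *m ck.2) | ck <- l].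
  by move=> _ /mapP[ck ckl ->]/=; apply: KM => //; exact: lK.
rewrite f0 scaler0 big_map/= => Asy _.
have : A (rho s y) = 0.
  rewrite yE rho_sum -[RHS]Asy; congr A; rewrite [LHS]big_seq [RHS]big_seq.
  by apply: eq_bigr => ck ckl; rewrite rhoZ (rhoM _ sK (lK _ ckl)).
rewrite /A (eq_bigr (fun r => rho (u r *m s) y)); last first.
  by move=> r _; rewrite (rhoM _ (uK r) sK).
rewrite -/ro_e => e0; move: yZ; rewrite yE e0.
by rewrite big1 ?Z0// => ck _; rewrite rho0 scaler0.
Qed.

End RankOneModule.

(** * Commuting and unipotent operators *)

Section Operators.
Context (C : fieldType) (X : lmodType C) (f : {linear X -> X}).

(** This is the passage from a polynomial identity, such as (X - 1)^p = X^p - 1 or the splitting of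
    X^N - 1, to an identity between iterates of [f]. *)
Lemma sum_coef_prod_XsubC (zs : seq C) (x : X) :
  \sum_(i < (size zs).+1) (\prod_(z <- zs) ('X - z%:P))`_i *: iter i f x =
  foldr (fun z y => f y - z *: y) x zs.
Proof.
elim: zs => [|z zs IH]/=.
  by rewrite big_nil big_ord_recl big_ord0 coefC/= scale1r addr0.
rewrite -IH linear_sum/= scaler_sumr.
under eq_bigr do rewrite big_cons mulrBl coefB coefXM coefCM scalerBl.
rewrite sumrB; congr (_ - _).
  rewrite big_ord_recl/= scale0r add0r; apply: eq_bigr => i _.
  by rewrite linearZ.
rewrite big_ord_recr/= nth_default ?mulr0 ?scale0r ?addr0; last first.
  by rewrite size_prod_XsubC.
by apply: eq_bigr => i _; rewrite scalerA.
Qed.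

Lemma iter_sub1_pchar (p : nat) (x : X) : p \in [pchar C] ->
  iter p f x = x -> iter p (fun y => f y - y) x = 0.
Proof.
move=> pC fp.
have := sum_coef_prod_XsubC (nseq p 1) x.
rewrite big_nseq -Monoid.iteropE/= size_nseq.
have -> : iterop p *%R ('X - 1%:P) 1 = ('X - 1%:P) ^+ p :> {poly C} by [].
have pP : p \in [pchar {poly C}] := rmorph_pchar polyC pC.
have p0 : (0 < p)%N by apply: prime_gt0; exact: (pcharf_prime pC).
rewrite -(pFrobenius_autE pP) pFrobenius_autB_comm; last exact: commr1.
rewrite !pFrobenius_autE expr1n.
under eq_bigr do rewrite coefB coefXn coefC scalerBl.
rewrite sumrB big_ord_recr/= eqxx scale1r fp big1 ?add0r; last first.
  by move=> i _; rewrite (negPf (_ : _ != p)) ?scale0r// neq_ltn ltn_ord.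
rewrite big_ord_recl/= scale1r big1 ?addr0; last first.
  by move=> i _; rewrite scale0r.
rewrite subrr => ->.
elim: (p) => //= n <-; by rewrite scale1r.
Qed.

(** X^N - 1 splits and kills [x] when evaluated at [f], so the factors [f - z] applied in turn end
    at zero; the last nonzero vector on the way is an eigenvector. This produces eigenvectors in a
    space whose dimension is not controlled. *)
Lemma eigenvector_finite_order (Y : set X) (N : nat) :
  (exists zs : seq C, 'X^N - 1 = \prod_(z <- zs) ('X - z%:P)) -> (0 < N)%N ->
  (forall x a, Y x -> Y (f x - a *: x)) ->
  (forall x, Y x -> iter N f x = x) -> forall x, Y x -> x != 0 ->
  exists y c, [/\ Y y, y != 0 & f y = c *: y].
Proof.
move=> [zs zsE] N0 Yf YN x Yx x0.
have szs : size zs = N.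
  have := congr1 (size : {poly C} -> nat) zsE.
  by rewrite size_prod_XsubC size_XnsubC// => -[].
have : foldr (fun z y => f y - z *: y) x zs = 0.
  rewrite -sum_coef_prod_XsubC szs -zsE.
  under eq_bigr do rewrite coefB coefXn coefC scalerBl.
  rewrite sumrB big_ord_recr/= eqxx scale1r YN// big1 ?add0r; last first.
    by move=> i _; rewrite (negPf (_ : _ != N)) ?scale0r// neq_ltn ltn_ord.
  rewrite big_ord_recl/= scale1r big1 ?addr0 ?subrr// => i _.
  by rewrite scale0r.
elim: zs {zsE szs} => [/= xe0|z zs IH/=]; first by rewrite xe0 eqxx in x0.
have [/IH//|y0] := eqVneq (foldr (fun z y => f y - z *: y) x zs) 0.
move=> /eqP; rewrite subr_eq0 => /eqP fy.
exists (foldr (fun z y => f y - z *: y) x zs), z; split => //.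
by elim: (zs) => //= ? ? ?; exact: Yf.
Qed.

End Operators.

(** The set [Y] is narrowed to one eigenspace after the other; commutation keeps each of them stable
    under the remaining operators. *)
Lemma commuting_eigenvector (C : closedFieldType) (X : lmodType C) (Y : set X)
    (I : finType) (f : I -> {linear X -> X}) :
  (forall a x y, Y x -> Y y -> Y (a *: x + y)) ->
  (forall i x, Y x -> Y (f i x)) ->
  (forall i j x, Y x -> f i (f j x) = f j (f i x)) ->
  (forall i, exists2 N, (0 < N)%N & forall x, Y x -> iter N (f i) x = x) ->
  forall x, Y x -> x != 0 ->
  exists y, [/\ Y y, y != 0 & forall i, exists c, f i y = c *: y].
Proof.
move=> Ylin Yst Ycom Yfin x Yx x0.
suff H (l : seq I) : exists2 y, Y y &
    y != 0 /\ forall i, i \in l -> exists c, f i y = c *: y.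
  have [y Yy [y0 yl]] := H (enum I); exists y; split => // i.
  by apply: yl; rewrite mem_enum.
elim: l Y Ylin Yst Ycom Yfin x Yx x0 => [|b l IH] Y Ylin Yst Ycom Yfin x Yx x0.
  by exists x.
have [N N0 fN] := Yfin b.
have [||y [c [Yy y0 fy]]] := eigenvector_finite_order (f := f b) (Y := Y) _ N0 _ fN Yx x0.
- have [zs zsE] := closed_field_poly_normal ('X^N - 1 : {poly C}).
  exists zs; rewrite {1}zsE -['X^N - 1]/('X^N - 1%:P) lead_coefXnsubC//.
  by rewrite scale1r.
- move=> z a Yz; rewrite -scaleNr addrC; apply: Ylin => //; exact: Yst.
have [| | | | |z [Yz fz] [z0 zl]] := IH [set y | Y y /\ f b y = c *: y] _ _ _ _ y _ y0.
- move=> a u v [Yu fu] [Yv fv]; split; first exact: Ylin.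
  by rewrite linearP fu fv scalerDr !scalerA mulrC.
- move=> i u [Yu fu]; split; first exact: Yst.
  by rewrite Ycom// fu linearZ.
- by move=> i j u [Yu _]; exact: Ycom.
- by move=> i; have [M M0 iM] := Yfin i; exists M => // u [Yu _]; exact: iM.
- by split.
exists z => //; split => // i; rewrite inE => /predU1P[->|il]; first by exists c.
exact: zl.
Qed.

Section Nilpotent.
Context (C : fieldType) (X : lmodType C) (D : {linear X -> X}) (n : nat).
Hypothesis Dn : forall x, iter n D x = 0.
Context (y : X).
Hypothesis gen : forall x, exists a z, x = a *: y + D z.

Let iterD_lin m a u v : iter m D (a *: u + v) = a *: iter m D u + iter m D v.
Proof. by elim: m => //= m ->; rewrite linearP. Qed.

Let iterDS m u : iter m D (D u) = D (iter m D u).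
Proof. by rewrite -iterSr. Qed.

(** If the generator falls one step too deep, the images of D^j and D^(j+1) coincide, hence those of
    all higher powers, and nilpotency makes them zero. *)
Let stuck j : (exists z, iter j D y = iter j.+1 D z) ->
  forall x, iter j D x = 0.
Proof.
move=> [z yz].
have step x : exists x', iter j D x = iter j D (D x').
  have [a [t ->]] := gen x; exists (a *: z + t).
  by rewrite iterD_lin [RHS]iterDS iterD_lin linearP yz iterDS.
have steps m x : exists x', iter j D x = iter j D (iter m D x').
  elim: m x => [|m IH] x; first by exists x.
  have [x1 ->] := step x; have [x2 E] := IH x1; exists x2.
  by rewrite iterDS E iterDS.
move=> x; have [x' ->] := steps n x.
by rewrite Dn; elim: (j) => //= ? ->; rewrite linear0.
Qed.

Lemma nilpotent_cyclic_gen : y != 0 -> forall z, y <> D z.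
Proof.
move=> y0 z yz; move: y0.
have -> : y = 0 by apply: (stuck (j := 0)); exists z.
by rewrite eqxx.
Qed.

(** With [j] the last level such that [x] lies in the image of D^j, the coefficient [a] of D^j y is
    nonzero. Applying [D] to [x] puts D^(j+1) y in the image of D^(j+2), so [stuck] gives D^(j+1) =
    0 and the remainder vanishes. *)
Let kerE x : D x = 0 -> x != 0 -> exists j a,
  [/\ x = a *: iter j D y, a != 0 & forall z, iter j.+1 D z = 0].
Proof.
move=> Dx x0.
have exj : exists j, `[< ~ exists z, x = iter j.+1 D z >].
  exists n; apply/asboolP => -[z]; rewrite iterSr Dn.
  by move/eqP; rewrite (negPf x0).
have [j /asboolP jP jmin] := ex_minnP exj.
have [z xz] : exists z, x = iter j D z.
  case: j jP jmin => [|j] _ jmin; first by exists x.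
  apply: contrapT => nz.
  by have := jmin j; rewrite asboolT// ltnn => /(_ isT).
have [a [t zE]] := gen z.
have xE : x = a *: iter j D y + iter j.+1 D t.
  by rewrite xz zE iterD_lin iterDS.
have a0 : a != 0.
  apply/eqP => a0; apply: jP; exists t.
  by rewrite xE a0 scale0r add0r.
have Dj : forall z, iter j.+1 D z = 0.
  apply: stuck; exists (- a^-1 *: t).
  move: Dx; rewrite xE linearP/= => /eqP; rewrite addr_eq0 => /eqP DE.
  have -> : D (iter j D y) = a^-1 *: (a *: D (iter j D y)).
    by rewrite scalerA mulVf// scale1r.
  rewrite DE scalerN; have := iterD_lin j.+2 (- a^-1) t 0.
  have it0 m : iter m D 0 = 0 by elim: m => //= m ->; rewrite linear0.
  by rewrite !addr0 it0 addr0 /= => ->; rewrite scaleNr.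
by exists j, a; split => //; rewrite xE Dj addr0.
Qed.

Lemma nilpotent_cyclic_ker x x' : D x = 0 -> D x' = 0 -> x != 0 ->
  exists a, x' = a *: x.
Proof.
move=> Dx Dx' x0; have [->|x'0] := eqVneq x' 0; first by exists 0; rewrite scale0r.
have [j [a [xE a0 Dj]]] := kerE Dx x0.
have [j' [a' [xE' a0' Dj']]] := kerE Dx' x'0.
have jj : j = j'.
  have aux i i' u b : u != 0 -> u = b *: iter i' D y ->
      (forall z, iter i.+1 D z = 0) -> (i' <= i)%N.
    move=> u0 uE Di; rewrite leqNgt; apply/negP => ii'.
    move: u0; rewrite uE -(subnKC ii') addnC iterD Di.
    have it0 m : iter m D 0 = 0 by elim: m => //= m ->; rewrite linear0.
    by rewrite it0 scaler0 eqxx.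
  by apply/eqP; rewrite eqn_leq (aux j' j x a)// (aux j j' x' a').
exists (a' / a); rewrite xE' xE -jj scalerA divfK//.
Qed.

End Nilpotent.

(** Among all expressions of the sum one with the fewest terms is taken: a zero term could be
    dropped and two equivalent terms merged. It separates the cosets of K1 in a function and the
    vertices K0 g in an element of the submodule, so that an extremal term is not cancelled by
    another one at the same place. *)
Lemma reduced_sum (A : Type) (X Y : zmodType) (F : A -> X -> Y)
    (P : A -> X -> Prop) (same : A -> A -> Prop) :
  (forall a x x', F a (x + x') = F a x + F a x') ->
  (forall a x x', P a x -> P a x' -> P a (x + x')) ->
  (forall a b x, same a b -> P a x -> exists2 x', P b x' & F a x = F b x') ->
  forall (n0 : nat) (a0 : 'I_n0 -> A) (x0 : 'I_n0 -> X),
  (forall i, P (a0 i) (x0 i)) ->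
  exists n (a : 'I_n -> A) (x : 'I_n -> X),
    [/\ forall i, P (a i) (x i), forall i, x i != 0,
        forall i j, same (a i) (a j) -> i = j &
        \sum_(i < n0) F (a0 i) (x0 i) = \sum_(i < n) F (a i) (x i)].
Proof.
move=> FD PD merge n0 a0 x0 P0; set y := \sum_(i < n0) _.
have F0 a : F a 0 = 0.
  have : F a 0 + F a 0 = F a 0 + 0 by rewrite -FD !addr0.
  by move/addrI.
pose Q n := exists (a : 'I_n -> A) (x : 'I_n -> X),
  (forall i, P (a i) (x i)) /\ y = \sum_(i < n) F (a i) (x i).
have exQ : exists n, `[< Q n >] by exists n0; apply/asboolP; exists a0, x0.
have [n /asboolP[a [x [Pax yE]]] nmin] := ex_minnP exQ.
exists n, a, x; split => // [i|i j sij].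
  apply/eqP => xi0; case: n a x Pax yE nmin i xi0 => [|n] a x Pax yE nmin.
    by case.
  move=> i xi0; suff : Q n by move/asboolP/nmin; rewrite ltnn.
  exists (a \o lift i), (x \o lift i); split=> [k|].
    exact: Pax.
  by rewrite yE (bigD1_ord i)//= xi0 F0 add0r.
apply: contrapT => /eqP ij.
case: n a x Pax yE nmin i j sij ij => [|n] a x Pax yE nmin; first by case.
move=> i j sij ij; suff : Q n by move/asboolP/nmin; rewrite ltnn.
have [x' Px' Fx'] := merge _ _ _ sij (Pax i).
have [k jk] : exists k, j = lift i k.
  by case/unlift_some: ij => k ? _; exists k.
exists (a \o lift i).
exists (fun t => if t == k then x (lift i t) + x' else x (lift i t)); split=> [t|].
  case: eqP => [->|_] /=; last exact: Pax.
  by apply: PD; [exact: Pax|rewrite -jk].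
rewrite yE (bigD1_ord i)//= (bigD1 k)//= [in RHS](bigD1 k)//= eqxx FD -jk Fx'.
rewrite addrCA addrA; congr (_ + _).
by apply: eq_bigr => t /negPf ->.
Qed.

(** * Valuations and unramified quadratic extensions *)

Section Valuations.
Context (F : fieldType) (v : dvaluation F).
Implicit Types (x y : F) (m n : int).

Lemma dvalV x : x != 0 -> v x^-1 = - v x.
Proof.
move=> x0; apply/eqP; rewrite -addr_eq0 -dvalM ?invr_eq0//.
by rewrite mulVf// dval1.
Qed.

Lemma pideal0 n : pideal v n 0.
Proof. by left. Qed.

Lemma pideal1 : pideal v 0 1.
Proof. by right; rewrite dval1. Qed.

Lemma pideal_lt1 n : 0 < n -> ~ pideal v n 1.
Proof.
move=> n0 [/eqP|]; first by rewrite oner_eq0.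
by rewrite dval1 leNgt n0.
Qed.

Lemma pidealB n x y : pideal v n x -> pideal v n y -> pideal v n (x - y).
Proof. by move=> xn yn; apply: pidealD => //; exact: pidealN. Qed.

Lemma pidealM m n N x y : pideal v m x -> pideal v n y -> N <= m + n ->
  pideal v N (x * y).
Proof.
move=> [->|xm]; first by rewrite mul0r; left.
move=> [->|yn] N_le; first by rewrite mulr0; left.
have [->|x0] := eqVneq x 0; first by rewrite mul0r; left.
have [->|y0] := eqVneq y 0; first by rewrite mulr0; left.
by right; rewrite dvalM// (le_trans N_le)// lerD.
Qed.

Lemma pideal_unitM n u x : u != 0 -> v u = 0 -> pideal v n (u * x) <-> pideal v n x.
Proof.
move=> u0 vu; split=> [ux|xn].
  have -> : x = u^-1 * (u * x) by rewrite mulKf.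
  by apply: (pidealM (m := 0) (n := n)) => //; [right; rewrite dvalV// vu|rewrite add0r].
apply: (pidealM (m := 0) (n := n)) => //; first by right; rewrite vu.
by rewrite add0r.
Qed.

Lemma pideal_dval n x : x != 0 -> pideal v n x -> n <= v x.
Proof. by move=> x0 [xE|//]; rewrite xE eqxx in x0. Qed.

Lemma pideal_all x : (forall n : nat, pideal v n%:Z x) -> x = 0.
Proof.
move=> xn; apply/eqP/negP => /negP x0.
by have := pideal_dval x0 (xn `|v x|.+1); lia.
Qed.

Lemma dval_eq0 x : x != 0 -> pideal v 0 x -> ~ pideal v 1 x -> v x = 0.
Proof.
move=> x0 xo x1; have x_ge := pideal_dval x0 xo.
apply/eqP; rewrite eq_le x_ge andbT leNgt; apply/negP => x_gt.
by apply: x1; right; lia.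
Qed.

Lemma dval_add_lt x y : x != 0 -> y != 0 -> v x < v y ->
  x + y != 0 /\ v (x + y) = v x.
Proof.
move=> x0 y0 xy.
have xy0 : x + y != 0.
  apply/negP; rewrite addr_eq0 => /eqP xE.
  by move: xy; rewrite xE dvalN ltxx.
split=> //; apply/eqP; rewrite eq_le; apply/andP; split; last first.
  by have := dvalD v x0 y0 xy0; rewrite min_l// ltW.
rewrite leNgt; apply/negP => xy1.
have yN0 : - y != 0 by rewrite oppr_eq0.
have := dvalD v xy0 yN0; rewrite addrK => /(_ x0).
by rewrite dvalN; lia.
Qed.

Lemma pideal_nat (n : nat) : pideal v 0 n%:R.
Proof.
elim: n => [|n IH]; first exact: pideal0.
by rewrite -addn1 natrD; apply: pidealD => //; exact: pideal1.
Qed.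

Lemma vtop_nbhsP (x : vtop v) (A : set (vtop v)) :
  nbhs x A <-> exists n, forall y : vtop v, pideal v n ((x : F) - (y : F)) -> A y.
Proof.
rewrite -nbhs_entourageE; split.
  move=> [B [n _ nB] BA]; exists n => y xy.
  by apply: BA; apply/xsectionP; apply: nB.
move=> [n nA]; exists [set xy | pideal v n ((xy.1 : F) - (xy.2 : F))].
  by exists n.
by move=> y /xsectionP; exact: nA.
Qed.

(** Cauchy filters are replaced by sequences with an explicit rate, the form in which completeness
    is used for square roots and for compactness. *)
Lemma vtop_complete_seq :
  (forall S : set_system (vtop v), ProperFilter S -> cauchy S ->
     exists x : vtop v, S --> x) ->
  forall r : nat -> F, (forall n : nat, pideal v n%:Z (r n.+1 - r n)) ->
  exists l, forall n : nat, pideal v n%:Z (l - r n).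
Proof.
move=> complete r rS.
have rn (n m : nat) : (n <= m)%N -> pideal v n%:Z (r m - r n).
  move=> /subnKC <-; elim: (m - n)%N => [|i IH].
    by rewrite addn0 subrr; left.
  rewrite addnS -(subrKA (r (n + i)%N)); apply: pidealD => //.
  by apply: sub_pideal (rS (n + i)%N); lia.
pose S : set_system (vtop v) := [set A | exists n : nat, forall m : nat, (n <= m)%N -> A (r m)].
have SP : ProperFilter S.
  apply: Build_ProperFilter_ex.
    by move=> A [n nA]; exists (r n); apply: nA.
  split; first by exists 0%N.
    move=> A B [n nA] [m mB]; exists (maxn n m) => i.
    by rewrite geq_max => /andP[ni mi]; split; [exact: nA|exact: mB].
  by move=> A B AB [n nA]; exists n => m nm; exact/AB/nA.
have Sc : cauchy S.
  move=> A [n _ nA].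
  pose N := `|n|%N.
  exists ([set x | pideal v n ((x : F) - r N)], [set x | pideal v n ((x : F) - r N)]).
    by split; exists N => m Nm /=; apply: sub_pideal (rn _ _ Nm); rewrite /N; lia.
  move=> [x y] [/= xn yn]; apply: nA => /=.
  by have := pidealB xn yn; rewrite opprB addrA subrK.
have [l Sl] := complete S SP Sc.
exists l => n.
have [m Hm] : S [set y | pideal v n%:Z ((l : F) - (y : F))].
  by apply: Sl; apply/vtop_nbhsP; exists n%:Z.
rewrite -(subrKA (r (maxn n m))); apply: pidealD.
  by apply: Hm; exact: leq_maxr.
by apply: rn; exact: leq_maxl.
Qed.

End Valuations.

(* The arithmetic of an unramified quadratic extension with residue field k of
   the base: [rE] and [lE] are the reduction modulo the maximal ideal and a
   section of it, the residue field of E being identified with k * k as an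
   additive group; [tz] is a section for the elements of trace zero. *)
Record unram_pair (E : fieldType) (conj : {rmorphism E -> E})
    (v : dvaluation E) (w : E) (k : finFieldType)
    (rE : E -> k * k) (lE : k * k -> E) (tz : k -> E) : Prop := UnramPair {
  up_conjK : forall x, conj (conj x) = x;
  up_vconj : forall x, v (conj x) = v x;
  up_w0 : w != 0;
  up_vw : v w = 1;
  up_conjw : conj w = w;
  up_2 : (2%:R : E) != 0;
  up_v2 : v 2%:R = 0;
  up_char : forall p : nat, p \in [pchar k] -> pideal v 1 p%:R;
  up_rE : forall x y, pideal v 0 x -> pideal v 0 y ->
    rE x = rE y <-> pideal v 1 (x - y);
  up_lEo : forall c, pideal v 0 (lE c);
  up_lEK : forall c, rE (lE c) = c;
  up_lE0 : lE 0 = 0;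
  up_tzo : forall a, pideal v 0 (tz a);
  up_conj_tz : forall a, conj (tz a) = - tz a;
  up_tz0 : tz 0 = 0;
  up_tzD : forall a b, pideal v 1 (tz (a + b) - (tz a + tz b));
  up_tz_inj : forall a b, pideal v 1 (tz a - tz b) -> a = b;
  up_tz_surj : forall x, pideal v 0 x -> pideal v 1 (x + conj x) ->
    exists a, pideal v 1 (x - tz a);
  up_complete : forall r : nat -> E, (forall n : nat, pideal v n%:Z (r n.+1 - r n)) ->
    exists l, forall n : nat, pideal v n%:Z (l - r n)
}.

Section LocalField.
Context (p : nat) (k : finFieldType) (p_char : p \in [pchar k]) (p_odd : odd p).
Context (F : fieldType) (vF : dvaluation F) (red : F -> k).
Hypothesis locF : local_field vF red.

Lemma red0 : red 0 = 0.
Proof. by case: locF => _ rm; apply/(red_ker rm (pideal0 vF 0)); left. Qed.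

Lemma redN x : pideal vF 0 x -> red (- x) = - red x.
Proof.
case: locF => _ rm xo; apply/eqP; rewrite -addr_eq0 -(redD rm) ?addNr ?red0//.
exact: pidealN.
Qed.

Lemma red_eq x y : pideal vF 0 x -> pideal vF 0 y ->
  red x = red y <-> pideal vF 1 (x - y).
Proof.
case: (locF) => _ rm xo yo.
have xyo := pidealB xo yo.
rewrite -(red_ker rm xyo) (redD rm)//; last exact: pidealN.
by rewrite redN//; split=> [->|/eqP]; rewrite ?subrr// subr_eq0 => /eqP.
Qed.

Lemma red_nat n : red n%:R = n%:R.
Proof.
case: (locF) => _ rm; elim: n => [|n IH]; first exact: red0.
rewrite -addn1 !natrD (redD rm) ?IH ?(red1 rm)//; last exact: pideal1.
exact: pideal_nat.
Qed.

Lemma pideal_pchar : pideal vF 1 p%:R.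
Proof.
case: (locF) => _ rm; apply/(red_ker rm); first exact: pideal_nat.
by rewrite red_nat (pcharf0 p_char).
Qed.

Let two_red : (2%:R : k) != 0.
Proof.
apply/negP => /eqP k2; have p_pr := pcharf_prime p_char.
have : (p %| 2)%N by rewrite (dvdn_pcharf p_char) k2.
rewrite dvdn_prime2// => /eqP p2.
by move: p_odd; rewrite p2.
Qed.

Lemma dval2 : (2%:R : F) != 0 /\ vF 2%:R = 0.
Proof.
case: (locF) => _ rm.
have n1 : ~ pideal vF 1 2%:R.
  move/(red_ker rm (pideal_nat vF 2)); rewrite red_nat => /eqP.
  by rewrite (negPf two_red).
have n0 : (2%:R : F) != 0 by apply/eqP => E; apply: n1; rewrite E; left.
by split=> //; apply: dval_eq0 => //; exact: pideal_nat.
Qed.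

Lemma sqrt_1pideal (t : F) : pideal vF 1 t -> exists r, r * r = 1 + t.
Proof.
move=> t1; have [n2 v2] := dval2.
set c := 1 + t.
(* Newton's iteration with the derivative 2r frozen at 2, which is a unit; as every [r n] is 1
   modulo the maximal ideal, each step gains one power. *)
pose fix r (n : nat) := if n is m.+1 then r m - (r m * r m - c) / 2%:R else 1.
have v2V : pideal vF 0 2%:R^-1 by right; rewrite dvalV// v2.
have rP (n : nat) : pideal vF 1 (r n - 1) /\ pideal vF n.+1%:Z (r n * r n - c).
  elim: n => [|n [r1 rc]] /=.
    by split; [rewrite subrr; left|rewrite mulr1 opprD addNKr; exact: pidealN].
  have d1 : pideal vF 1 ((r n * r n - c) / 2%:R).
    by apply: (pidealM rc v2V); lia.
  split.
    by have := pidealB r1 d1; rewrite addrAC.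
  have -> : (r n - (r n * r n - c) / 2%:R) * (r n - (r n * r n - c) / 2%:R) - c =
    (r n * r n - c) * (((r n * r n - c) / 2%:R) / 2%:R - (r n - 1)) by field.
  apply: (pidealM rc (n := 1)); last by lia.
  by apply: pidealB => //; apply: (pidealM d1 v2V).
have [|l lr] := vtop_complete_seq (proj1 locF) (r := r).
  move=> n /=; rewrite addrAC subrr add0r; apply: pidealN.
  by apply: (pidealM (proj2 (rP n)) v2V); lia.
exists l; apply/eqP; rewrite -subr_eq0; apply/eqP; apply: pideal_all => n.
have -> : l * l - c = (l - r n) * (l - r n + 2%:R * (r n - 1) + 2%:R) + (r n * r n - c).
  by ring.
apply: pidealD; last by apply: sub_pideal (proj2 (rP n)); lia.
apply: (pidealM (lr n) (n := 0)); last by lia.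
apply: pidealD; last exact: (pideal_nat vF 2).
apply: pidealD; first by apply: sub_pideal (lr n); lia.
by apply: (pidealM (pideal_nat vF 2) (proj1 (rP n))).
Qed.

Context (E : fieldExtType F) (vE : dvaluation E) (dimE : \dim {:E} = 2%N).
Hypothesis unrE : unramified vF vE.
Context (conj : {lrmorphism E -> E}) (conj_nontriv : exists x, conj x != x).
Context (w : E) (w_unif : uniformizer vE w) (w_in_F : w \in 1%VS).

Let cF (a : F) : conj a%:A = a%:A. Proof. exact: rmorph_alg. Qed.

Let basisE x : conj x != x -> forall y, exists a b, y = a%:A + b *: x.
Proof.
move=> cx y.
have bX : basis_of {:E} [tuple x; 1].
  rewrite basisEfree subvf dimE/= andbT free_cons seq1_free oner_eq0 andbT.
  apply/negP; rewrite span_seq1 => /vlineP[a xE].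
  by move: cx; rewrite xE cF eqxx.
have := coord_basis bX (memvf y).
rewrite big_ord_recl big_ord_recl big_ord0/= addr0 addrC => ->.
by eexists; eexists.
Qed.

Let fixedE y : conj y = y -> exists a : F, y = a%:A.
Proof.
move=> cy; have [x cx] := conj_nontriv.
have [a [b yE]] := basisE cx y; exists a.
have : b *: (conj x - x) = 0.
  by move: cy; rewrite yE rmorphD/= cF linearZ/= => /addrI/eqP; rewrite -subr_eq0 -scalerBr => /eqP.
move/eqP; rewrite scaler_eq0 subr_eq0 (negPf cx) orbF => /eqP b0.
by rewrite yE b0 scale0r addr0.
Qed.

(** Subtracting the conjugate of the quadratic equation of [x0] from the equation shows that
    [x0 + conj x0] lies in F, so conjugating twice returns [x0]. *)
Let conjK' x : conj (conj x) = x.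
Proof.
have [x0 cx] := conj_nontriv.
have [a [b xE]] := basisE cx (x0 * x0).
have tr : x0 + conj x0 = b%:A.
  have d0 : x0 - conj x0 != 0 by rewrite subr_eq0 eq_sym.
  apply: (mulfI d0); rewrite -[RHS]/(_ * (b *: 1)) -scalerAr mulr1 scalerBr.
  have -> : (x0 - conj x0) * (x0 + conj x0) = x0 * x0 - conj (x0 * x0).
    by rewrite rmorphM/=; ring.
  by rewrite xE rmorphD/= cF linearZ/= opprD addrACA subrr add0r.
have cx0 : conj x0 = b%:A - x0 by rewrite -tr addrAC subrr add0r.
have ccx0 : conj (conj x0) = x0 by rewrite cx0 rmorphB/= cF cx0 opprB addrC subrK.
have [c [d ->]] := basisE cx x.
by rewrite !rmorphD/= !cF !linearZ/= ccx0.
Qed.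

Let two0 : (2%:R : E) != 0.
Proof. by have [n2 _] := dval2; rewrite -scaler_nat scaler_eq0 negb_or n2 oner_eq0. Qed.

Let v2' : vE 2%:R = 0.
Proof. by have [n2 v2] := dval2; rewrite -scaler_nat unrE. Qed.

Let v2V : pideal vE 0 2%:R^-1.
Proof. by right; rewrite dvalV// v2'. Qed.

Let pidealA n (a : F) : pideal vE n a%:A <-> pideal vF n a.
Proof.
split=> [[/eqP|]|[->|]].
- by rewrite scaler_eq0 oner_eq0 orbF => /eqP ->; left.
- have [->|a0] := eqVneq a 0; first by left.
  by rewrite unrE//; right.
- by rewrite scale0r; left.
- have [->|a0] := eqVneq a 0; first by rewrite scale0r; left.
  by move=> va; right; rewrite unrE.
Qed.

(** Invariance of the valuation has to be proved. If [conj x] had smaller valuation than [x], the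
    trace-zero element [d] and the trace [a] would satisfy d / a = 1 modulo the maximal ideal; the
    square of d / a, which lies in F, would then have a square root in F, so d / a itself would lie
    in F, although [conj] changes its sign. *)
Let vconj_le x : x != 0 -> vE x <= vE (conj x).
Proof.
move=> x0; rewrite leNgt; apply/negP => xlt.
have cx0 : conj x != 0 by rewrite fmorph_eq0.
have [a0 va] := dval_add_lt cx0 x0 xlt.
have mx0 : - x != 0 by rewrite oppr_eq0.
have [d0 vd] : conj x - x != 0 /\ vE (conj x - x) = vE (conj x).
  by apply: dval_add_lt => //; rewrite dvalN.
set a := conj x + x in a0 va; set d := conj x - x in d0 vd.
have ca : conj a = a by rewrite /a rmorphD/= conjK' addrC.
have cd : conj d = - d by rewrite /d rmorphB/= conjK' opprB.
have [e eE] : exists e : F, (d / a) * (d / a) = e%:A.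
  by apply: fixedE; rewrite !rmorphM fmorphV/= cd ca; ring.
have uE : 1 - d / a = 2%:R * x / a by rewrite -{1}(divff a0) -mulrBl; congr (_ / _); rewrite /a /d; ring.
have e1 : pideal vF 1 (e - 1).
  apply/pidealA; rewrite scalerBl -eE scale1r.
  have -> : d / a * (d / a) - 1 = (1 - d / a) * (- (1 + d / a)) by ring.
  have du : pideal vE 0 (d / a).
    by right; rewrite dvalM ?invr_eq0// dvalV// va vd subrr.
  apply: (pidealM (m := 1) (n := 0)) => //; last first.
    by apply: pidealN; apply: pidealD => //; exact: pideal1.
  right; rewrite uE dvalM ?invr_eq0 ?mulf_neq0// dvalM// v2' dvalV// va.
  by lia.
have [r rE] := sqrt_1pideal e1.
move: rE; rewrite addrCA subrr addr0 => rE.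
have : (d / a - r%:A) * (d / a + r%:A) = 0.
  have -> : (d / a - r%:A) * (d / a + r%:A) = d / a * (d / a) - r%:A * r%:A by ring.
  by rewrite eE -rE -scalerAl mul1r scalerA subrr.
have c1 : conj (d / a) = - (d / a) by rewrite rmorphM fmorphV/= cd ca mulNr.
have nfix b : d / a <> b%:A.
  move=> E1; move: c1; rewrite E1 cF -E1 => /eqP.
  rewrite -addr_eq0 -mulr2n -mulr_natl mulf_eq0 (negPf two0)/=.
  by rewrite mulf_eq0 invr_eq0 (negPf d0) (negPf a0).
move/eqP; rewrite mulf_eq0 subr_eq0 addr_eq0 => /orP[|] /eqP; first exact: nfix.
by rewrite -scaleNr; exact: nfix.
Qed.

Let vconj x : vE (conj x) = vE x.
Proof.
have [->|x0] := eqVneq x 0; first by rewrite rmorph0.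
have cx0 : conj x != 0 by rewrite fmorph_eq0.
apply/eqP; rewrite eq_le vconj_le// andbT.
by have := vconj_le cx0; rewrite conjK'.
Qed.

Let pideal_conj n x : pideal vE n x -> pideal vE n (conj x).
Proof. by move=> [->|]; [left; rewrite rmorph0|right; rewrite vconj]. Qed.

Let w0 : w != 0. Proof. by case: w_unif. Qed.
Let cw : conj w = w.
Proof. by move: w_in_F => /vlineP[a ->]; exact: cF. Qed.

(** A trace-zero element is made a unit by a power of [w], which [conj] fixes because [w] lies in
    F. *)
Let exdelta : exists d : E, [/\ conj d = - d, d != 0 & vE d = 0].
Proof.
have [x cx] := conj_nontriv.
have d0 : x - conj x != 0 by rewrite subr_eq0 eq_sym.
have cd : conj (x - conj x) = - (x - conj x) by rewrite rmorphB/= conjK' opprB.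
have vwn (n : nat) : vE (w ^+ n) = n%:Z.
  elim: n => [|n IH]; first by rewrite expr0 dval1.
  by rewrite exprS dvalM ?expf_neq0// IH; case: w_unif => _ ->; lia.
case vE0 : (vE (x - conj x)) => [n|n].
  exists ((x - conj x) / w ^+ n); split.
  - by rewrite rmorphM fmorphV rmorphXn/= cw cd mulNr.
  - by rewrite mulf_neq0 ?invr_eq0 ?expf_neq0.
  - by rewrite dvalM ?invr_eq0 ?expf_neq0// dvalV ?expf_neq0// vwn vE0 subrr.
exists ((x - conj x) * w ^+ n.+1); split.
- by rewrite rmorphM rmorphXn/= cw cd mulNr.
- by rewrite mulf_neq0 ?expf_neq0.
- by rewrite dvalM ?expf_neq0// vwn vE0; lia.
Qed.

(** As 2 and [d] are units, the coordinates [re] and [im] in the basis (1, d) identify each ideal of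
    E with two copies of the ideal of F of the same exponent; residues, lifts and limits are then
    taken coordinate by coordinate. *)
Theorem unram_pair_exists : exists rE lE tz,
  unram_pair (conj : {rmorphism E -> E}) vE w (k := k) rE lE tz.
Proof.
have [d [cd d0 vd]] := exdelta.
have [complete rm] := locF.
have /choice [lift0 lift0P] : forall a : k, exists x, pideal vF 0 x /\ red x = a.
  by move=> a; have [x xo xa] := red_surj rm a; exists x.
(* Zero has to lift to zero exactly: the representative of the trivial coset must be the identity
   matrix. *)
pose lift a := if a == 0 then 0 else lift0 a.
have lifto a : pideal vF 0 (lift a).
  by rewrite /lift; case: eqP => _; [left|case: (lift0P a)].
have liftK a : red (lift a) = a.
  by rewrite /lift; case: eqP => [->|_]; [rewrite red0|case: (lift0P a)].
have /choice [toF toFP] : forall y, exists a : F, conj y = y -> y = a%:A.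
  move=> y; have [/fixedE[a yE]|ny] := pselect (conj y = y); first by exists a.
  by exists 0 => /ny.
pose re x := (x + conj x) / 2%:R; pose im x := (x - conj x) / (2%:R * d).
have reE x : re x = (toF (re x))%:A.
  by apply: toFP; rewrite /re rmorphM fmorphV rmorphD/= conjK' rmorph_nat addrC.
have imE x : im x = (toF (im x))%:A.
  apply: toFP; rewrite /im rmorphM fmorphV rmorphM/= rmorph_nat rmorphB/= conjK' cd.
  by field; rewrite ?oppr_eq0 ?d0 ?two0.
have dec x : x = re x + d * im x by rewrite /re /im; field; rewrite ?oppr_eq0 ?d0 ?two0.
have v2d : 2%:R * d != 0 by rewrite mulf_neq0.
have vV2d : vE (2%:R * d)^-1 = 0 by rewrite dvalV// dvalM// v2' vd.
have re_pid n x : pideal vE n x -> pideal vE n (re x).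
  move=> xn; rewrite /re mulrC; apply/pideal_unitM; rewrite ?invr_eq0//.
    by rewrite dvalV// v2'.
  by apply: pidealD => //; exact: pideal_conj.
have im_pid n x : pideal vE n x -> pideal vE n (im x).
  move=> xn; rewrite /im mulrC; apply/pideal_unitM; rewrite ?invr_eq0//.
  by apply: pidealB => //; exact: pideal_conj.
have toF_inj (a : F) : toF a%:A = a.
  have /eqP := toFP a%:A (cF a).
  by rewrite -subr_eq0 -scalerBl scaler_eq0 oner_eq0 orbF subr_eq0 => /eqP.
have reB x y : re (x - y) = re x - re y by rewrite /re rmorphB/=; ring.
have imB x y : im (x - y) = im x - im y by rewrite /im rmorphB/=; ring.
exists (fun x => (red (toF (re x)), red (toF (im x)))).
exists (fun c => (lift c.1)%:A + d * (lift c.2)%:A).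
exists (fun a => d * (lift a)%:A).
have reL a b : re (a%:A + d * b%:A) = a%:A.
  by rewrite /re rmorphD/= rmorphM/= !cF cd; field.
have imL a b : im (a%:A + d * b%:A) = b%:A.
  by rewrite /im rmorphD/= rmorphM/= !cF cd; field; rewrite ?oppr_eq0 ?d0 ?two0.
have co x : pideal vE 0 x -> pideal vF 0 (toF (re x)) /\ pideal vF 0 (toF (im x)).
  by move=> xo; split; apply/pidealA; rewrite -?reE -?imE; [apply: re_pid|apply: im_pid].
split => //.
- by case: w_unif.
- move=> q q_char.
  have -> : q = p by move: q_char; rewrite (pcharf_eq p_char) inE => /eqP.
  by rewrite -scaler_nat; apply/pidealA; exact: pideal_pchar.
- move=> x y xo yo; have [rx ix] := co x xo; have [ry iy] := co y yo.
  have aux : (red (toF (re x)), red (toF (im x))) = (red (toF (re y)), red (toF (im y)))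
    <-> pideal vE 1 (re x - re y) /\ pideal vE 1 (im x - im y).
    rewrite [re x]reE [re y]reE [im x]imE [im y]imE !toF_inj -!scalerBl.
    split=> [[/(red_eq rx ry) r1 /(red_eq ix iy) i1]|[/pidealA r1 /pidealA i1]].
      by split; apply/pidealA.
    by congr (_, _); apply/red_eq.
  rewrite aux -reB -imB; split=> [[r1 i1]|xy]; last by split; [apply: re_pid|apply: im_pid].
  rewrite (dec (x - y)); apply: pidealD => //.
  by apply/pideal_unitM.
- move=> c; apply: pidealD; first exact/pidealA.
  by apply/pideal_unitM => //; exact/pidealA.
- by move=> [a b]/=; rewrite reL imL !toF_inj !liftK.
- by rewrite /lift/= eqxx scale0r mulr0 addr0.
- by move=> a; apply/pideal_unitM => //; exact/pidealA.
- by move=> a; rewrite rmorphM/= cd cF mulNr.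
- by rewrite /lift eqxx scale0r mulr0.
- move=> a b; rewrite -mulrDr -mulrBr; apply/pideal_unitM => //.
  rewrite -scalerDl -scalerBl; apply/pidealA.
  have ab : pideal vF 0 (lift a + lift b) by exact: pidealD.
  by apply/red_eq => //; rewrite (redD rm)// !liftK.
- move=> a b; rewrite -mulrBr => /pideal_unitM => /(_ d0 vd).
  rewrite -scalerBl => /pidealA ab.
  by rewrite -(liftK a) -(liftK b); apply/red_eq.
- move=> x xo trx; exists (red (toF (im x))).
  have [rx ix] := co x xo.
  rewrite {1}(dec x) -addrA; apply: pidealD.
    rewrite /re mulrC; apply/pideal_unitM; rewrite ?invr_eq0//.
    by rewrite dvalV// v2'.
  rewrite -mulrBr; apply/pideal_unitM => //.
  rewrite {1}[im x]imE -scalerBl; apply/pidealA.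
  by apply/red_eq => //; rewrite liftK.
- move=> r rS.
  have [|l1 l1P] := vtop_complete_seq complete (r := fun n => toF (re (r n))).
    by move=> n; apply/pidealA; rewrite scalerBl -!reE -reB; exact: re_pid.
  have [|l2 l2P] := vtop_complete_seq complete (r := fun n => toF (im (r n))).
    by move=> n; apply/pidealA; rewrite scalerBl -!imE -imB; exact: im_pid.
  exists (l1%:A + d * l2%:A) => n; rewrite (dec (r n)).
  rewrite opprD addrACA -mulrBr reE imE -!scalerBl; apply: pidealD.
    exact/pidealA.
  by apply/pideal_unitM => //; exact/pidealA.
Qed.

End LocalField.

Definition i0 : 'I_3 := @Ordinal 3 0 isT.
Definition i1 : 'I_3 := @Ordinal 3 1 isT.
Definition i2 : 'I_3 := @Ordinal 3 2 isT.

Lemma ord3P (P : 'I_3 -> Prop) : P i0 -> P i1 -> P i2 -> forall i, P i.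
Proof.
move=> P0 P1 P2 [[|[|[|//]]] ilt].
- by have -> : Ordinal ilt = i0 by exact: val_inj.
- by have -> : Ordinal ilt = i1 by exact: val_inj.
- by have -> : Ordinal ilt = i2 by exact: val_inj.
Qed.

Lemma sum3 (V : nmodType) (f : 'I_3 -> V) : \sum_i f i = f i0 + f i1 + f i2.
Proof.
rewrite !big_ord_recl big_ord0 addr0 addrA.
by congr (_ + _ + _); congr f; exact: val_inj.
Qed.

Lemma rev_i0 : rev_ord i0 = i2. Proof. exact: val_inj. Qed.
Lemma rev_i1 : rev_ord i1 = i1. Proof. exact: val_inj. Qed.
Lemma rev_i2 : rev_ord i2 = i0. Proof. exact: val_inj. Qed.
Definition rev3 := (rev_i0, rev_i1, rev_i2).

(** * The unitary group *)

Section Matrices3.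
Context (E : fieldType).
Implicit Types M : 'M[E]_3.

Lemma mx3P M M' : (forall i j, M i j = M' i j) -> M = M'.
Proof. by move=> MM; apply/matrixP. Qed.

Lemma mulmx3 M M' i j :
  (M *m M') i j = M i i0 * M' i0 j + M i i1 * M' i1 j + M i i2 * M' i2 j.
Proof. by rewrite mxE sum3. Qed.

Lemma betaE i j : beta E i j = (j == rev_ord i)%:R.
Proof. by rewrite mxE; move: i j; do 2!apply: ord3P. Qed.

Lemma mulbeta M i j : (beta E *m M) i j = M (rev_ord i) j.
Proof.
rewrite mulmx3 !betaE; move: i; apply: ord3P;
by rewrite ?rev3 /= !(mul0r, mul1r, addr0, add0r).
Qed.

Lemma mulmxbeta M i j : (M *m beta E) i j = M i (rev_ord j).
Proof.
rewrite mulmx3 !betaE !rev3; move: j; apply: ord3P;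
by rewrite ?rev3 /= !(mulr0, mulr1, addr0, add0r).
Qed.

Lemma beta_beta : beta E *m beta E = 1%:M.
Proof.
apply/mx3P => i j; rewrite mulbeta betaE mxE rev_ordK eq_sym.
by case: (i == j).
Qed.

Lemma betaT : (beta E)^T = beta E.
Proof.
apply/mx3P => i j; rewrite mxE !betaE; congr (_ %:R).
by congr nat_of_bool; rewrite -(inj_eq rev_ord_inj) rev_ordK eq_sym.
Qed.

Lemma map_beta (f : {rmorphism E -> E}) : map_mx f (beta E) = beta E.
Proof. by apply/mx3P => i j; rewrite mxE betaE rmorph_nat. Qed.

End Matrices3.

Section Unitary.
Context (E : fieldType) (conj : {rmorphism E -> E}).
Hypothesis conjK : forall x, conj (conj x) = x.
Implicit Types g h : 'M[E]_3.
Local Notation G := (unitary conj).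

Lemma unitaryE g : G g <-> g^T *m beta E *m map_mx conj g = beta E.
Proof.
split=> [[_ gG]|gE].
  apply/mx3P => i j; have := gG (delta_mx i 0) (delta_mx j 0); rewrite /herm.
  rewrite map_mxM !trmx_mul !map_delta_mx !trmx_delta => gij.
  have aux (M : 'M[E]_3) : (delta_mx 0 i *m M *m delta_mx j 0 : 'M_1) 0 0 = M i j.
    by rewrite -rowE -colE !mxE.
  by rewrite -[LHS]aux -[RHS]aux -gij -!mulmxA.
split; last first.
  by move=> v1 v2; rewrite /herm trmx_mul map_mxM -[in RHS]gE !mulmxA.
have : \det (g^T *m beta E *m map_mx conj g) = \det (beta E) by rewrite gE.
have := congr1 determinant (beta_beta E); rewrite det_mulmx det1 => bb.
rewrite !det_mulmx det_tr det_map_mx unitmxE unitfE => gE'.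
apply/eqP => g0; move: gE'; rewrite g0 !mul0r => b0.
by move: bb; rewrite -b0 mul0r => /eqP; rewrite eq_sym oner_eq0.
Qed.

Lemma unitary_mul g h : G g -> G h -> G (g *m h).
Proof.
move=> /unitaryE gE /unitaryE hE; apply/unitaryE.
rewrite trmx_mul map_mxM -[RHS]hE -[in RHS]gE.
by rewrite !mulmxA.
Qed.

Lemma unitary_mulV g : G g -> beta E *m (map_mx conj g)^T *m beta E *m g = 1%:M.
Proof.
move=> /unitaryE /(congr1 trmx); rewrite !trmx_mul trmxK betaT => gE.
by rewrite -!mulmxA gE beta_beta.
Qed.

Lemma unitary_inv g i j : G g -> invmx g i j = conj (g (rev_ord j) (rev_ord i)).
Proof.
move=> gG; have gV := mulmx1C (unitary_mulV gG).
by rewrite (invmx_eq gV) mulmxbeta mulbeta !mxE.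
Qed.

Lemma unitary_row_mx g : G g -> g *m beta E *m (map_mx conj g)^T = beta E.
Proof.
move=> gG; have gV := mulmx1C (unitary_mulV gG).
have := congr1 (mulmx^~ (beta E)) gV.
by rewrite -!mulmxA beta_beta mulmx1 mul1mx.
Qed.

Lemma unitary_1 : G 1%:M.
Proof. by apply/unitaryE; rewrite trmx1 mul1mx map_mx1 mulmx1. Qed.

Lemma unitary_invmx g : G g -> G (invmx g).
Proof.
move=> gG; apply/unitaryE.
have -> : invmx g = beta E *m (map_mx conj g)^T *m beta E.
  by apply: invmx_eq; exact: mulmx1C (unitary_mulV gG).
have gcc : map_mx conj (map_mx conj g) = g by apply/mx3P => i j; rewrite !mxE conjK.
rewrite !trmx_mul trmxK !map_mxM !map_beta -map_trmx gcc betaT.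
have := congr1 (map_mx conj) (unitary_row_mx gG).
rewrite !map_mxM map_beta -map_trmx gcc => E1.
rewrite -!mulmxA [beta E *m (beta E *m _)]mulmxA beta_beta mul1mx.
by rewrite [map_mx _ _ *m _]mulmxA [map_mx _ _ *m beta E *m _]mulmxA E1 !mulmxA beta_beta mul1mx.
Qed.

Lemma unitary_subgroup : subgroup G.
Proof.
split; [by move=> g []|exact: unitary_1|exact: unitary_mul|exact: unitary_invmx].
Qed.

Lemma unitary_col g i j : G g ->
  g i0 i * conj (g i2 j) + g i1 i * conj (g i1 j) + g i2 i * conj (g i0 j) =
  (j == rev_ord i)%:R.
Proof.
move=> /unitaryE /matrixP /(_ i j); rewrite betaE => <-.
by rewrite mulmx3 !mulmxbeta !rev3 !mxE; ring.
Qed.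

Lemma unitary_row g i j : G g ->
  g i i0 * conj (g j i2) + g i i1 * conj (g j i1) + g i i2 * conj (g j i0) =
  (j == rev_ord i)%:R.
Proof.
move=> /unitary_row_mx /matrixP /(_ i j); rewrite betaE => <-.
rewrite mulmx3 !mulmxbeta !rev3 !mxE; ring.
Qed.

End Unitary.

Lemma pideal_le (F : fieldType) (v : dvaluation F) m n x :
  pideal v n x -> m <= n -> pideal v m x.
Proof. by move=> xn mn; exact: sub_pideal mn _ xn. Qed.

(* Twice the valuation, so that half-integral Moy-Prasad depths are integral. *)
Definition pi2 (F : fieldType) (v : dvaluation F) (n : int) (x : F) : Prop :=
  x = 0 \/ n <= 2%:Z * v x.

Section Pi2.
Context (F : fieldType) (v : dvaluation F).
Implicit Types (x y : F) (m n : int).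

Lemma pi2_pideal m n x : 2%:Z * m - 1 <= n -> n <= 2%:Z * m ->
  pi2 v n x <-> pideal v m x.
Proof. by move=> nm mn; split=> -[->|xn]; [left|right; lia|left|right; lia]. Qed.

Lemma pideal_pi2 m n x : pideal v m x -> n <= 2%:Z * m -> pi2 v n x.
Proof. by move=> [->|xm]; [left|right; lia]. Qed.

Lemma pi2_to_pideal m n x : pi2 v n x -> 2%:Z * m - 1 <= n -> pideal v m x.
Proof. by move=> [->|xm]; [left|right; lia]. Qed.

Lemma pi2_le m n x : pi2 v n x -> m <= n -> pi2 v m x.
Proof. by move=> [->|xn] mn; [left|right; lia]. Qed.

Lemma pi2D n x y : pi2 v n x -> pi2 v n y -> pi2 v n (x + y).
Proof.
have E z : pi2 v n z <-> pideal v ((n + 1) %/ 2)%Z z by apply: pi2_pideal; lia.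
by rewrite !E; exact: pidealD.
Qed.

Lemma pi2N n x : pi2 v n x -> pi2 v n (- x).
Proof. by move=> [->|xn]; [left; rewrite oppr0|right; rewrite dvalN]. Qed.

Lemma pi2M m n x y : pi2 v m x -> pi2 v n y -> pi2 v (m + n) (x * y).
Proof.
move=> [->|xm]; first by rewrite mul0r; left.
move=> [->|yn]; first by rewrite mulr0; left.
have [->|x0] := eqVneq x 0; first by rewrite mul0r; left.
have [->|y0] := eqVneq y 0; first by rewrite mulr0; left.
by right; rewrite dvalM//; lia.
Qed.

End Pi2.

(** * Lattice filtrations and congruence subgroups *)

Section Graded.
Context (E : fieldType) (conj : {rmorphism E -> E}) (v : dvaluation E).
Hypothesis conjK : forall x, conj (conj x) = x.
Hypothesis vconj : forall x, v (conj x) = v x.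
Implicit Types (c : 'I_3 -> int) (M : 'M[E]_3) (g h : 'M[E]_3).
Local Notation G := (unitary conj).

Lemma pideal_conj n x : pideal v n x <-> pideal v n (conj x).
Proof.
split=> [[->|xn]|[/eqP|xn]]; [left; exact: rmorph0|right; by rewrite vconj| |].
  by rewrite fmorph_eq0 => /eqP ->; left.
by right; rewrite -vconj.
Qed.

Lemma pi2_conj n x : pi2 v n x -> pi2 v n (conj x).
Proof. by move=> [->|xn]; [left; rewrite rmorph0|right; rewrite vconj]. Qed.

(** The filtration of matrices at a point of the apartment, in doubled units: [gr_id] is the vertex
    of K1 and [gr_0] that of K0. Levels add under products, which gives commutator and power
    estimates for all entries at once. *)
Definition gr c (m : int) M : Prop := forall i j, pi2 v (m + c i - c j) (M i j).

Lemma gr_le c m n M : gr c n M -> m <= n -> gr c m M.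
Proof. by move=> Mn mn i j; apply: pi2_le (Mn i j) _; lia. Qed.

Lemma grD c m M M' : gr c m M -> gr c m M' -> gr c m (M + M').
Proof. by move=> H H' i j; rewrite mxE; exact: pi2D. Qed.

Lemma grN c m M : gr c m M -> gr c m (- M).
Proof. by move=> H i j; rewrite mxE; exact: pi2N. Qed.

Lemma grB c m M M' : gr c m M -> gr c m M' -> gr c m (M - M').
Proof. by move=> H H'; apply: grD => //; exact: grN. Qed.

Lemma grM c m n M M' : gr c m M -> gr c n M' -> gr c (m + n) (M *m M').
Proof.
move=> H H' i j; rewrite mulmx3.
have aux l : pi2 v (m + n + c i - c j) (M i l * M' l j).
  by apply: pi2_le (pi2M (H i l) (H' l j)) _; lia.
by do !apply: pi2D.
Qed.

Lemma gr1 c : gr c 0 1%:M.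
Proof.
move=> i j; rewrite mxE; case: eqVneq => [->|_]; last by left.
by right; rewrite dval1; lia.
Qed.

Definition par c : set 'M[E]_3 := [set g | G g /\ gr c 0 g].
(** Because the units are doubled, the kernel of reduction to the reductive quotient is level 1 for
    [gr_id] and level 2 for [gr_0]. *)
Definition cong c (m : nat) : set 'M[E]_3 := [set g | G g /\ gr c m (g - 1%:M)].

(** The inverse in G is the conjugate of the reflection in the antidiagonal; this symmetry of [c]
    makes the filtration stable under it. *)
Definition symmetric_grading c := exists a, forall i, c (rev_ord i) = a - c i.

Lemma gr_inv c g : symmetric_grading c -> G g -> gr c 0 g -> gr c 0 (invmx g).
Proof.
move=> [a ca] gG gg i j; rewrite (unitary_inv _ _ gG); apply: pi2_conj.
by apply: pi2_le (gg _ _) _; rewrite !ca; lia.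
Qed.

Lemma par_subgroup c : symmetric_grading c -> subgroup (par c).
Proof.
move=> cs; split; first by move=> g [[]].
- by split; [exact: unitary_1|exact: gr1].
- move=> g h [gG gg] [hG hg]; split; first exact: unitary_mul.
  exact: (grM (m := 0) (n := 0)).
- by move=> g [gG gg]; split; [exact: unitary_invmx|exact: gr_inv].
Qed.

Lemma cong_par c m : cong c m `<=` par c.
Proof.
move=> g [gG gm]; split => //.
have -> : g = (g - 1%:M) + 1%:M by rewrite subrK.
by apply: grD (gr1 c); apply: gr_le gm _.
Qed.

Lemma cong_le c m n : (m <= n)%N -> cong c n `<=` cong c m.
Proof. by move=> mn g [gG gn]; split => //; apply: gr_le gn _; lia. Qed.

Lemma cong_normal c m : symmetric_grading c -> normal_subgroup (cong c m) (par c).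
Proof.
move=> cs.
have invg g : cong c m g -> cong c m (invmx g).
  move=> gc; have [gG gm] := gc; split; first exact: unitary_invmx.
  have gU : g \in unitmx by case: gG.
  have -> : invmx g - 1%:M = - (invmx g *m (g - 1%:M)).
    by rewrite mulmxBr mulVmx// mulmx1 opprB.
  apply: grN; rewrite -[m%:Z]add0r; apply: grM => //.
  by apply: gr_inv => //; case: (cong_par gc).
split; last 2 first.
- exact: cong_par.
- move=> g n [gG gg] [nG nm]; split.
    apply: unitary_mul => //; first exact: unitary_mul.
    exact: unitary_invmx.
  have gU : g \in unitmx by case: gG.
  have -> : g *m n *m invmx g - 1%:M = g *m (n - 1%:M) *m invmx g.
    by rewrite mulmxBr mulmxBl mulmx1 mulmxV.
  rewrite -[m%:Z]addr0; apply: grM; last exact: gr_inv.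
  by rewrite -[m%:Z]add0r; exact: grM.
split=> //.
- by move=> g [[]].
- by split; [exact: unitary_1|rewrite subrr => i j; rewrite mxE; left].
- move=> g h [gG gm] hc; have [hG hm] := hc; split; first exact: unitary_mul.
  have -> : g *m h - 1%:M = (g - 1%:M) *m h + (h - 1%:M).
    by rewrite mulmxBl mul1mx addrA subrK.
  apply: grD => //; rewrite -[m%:Z]addr0; apply: grM => //.
  by case: (cong_par hc).
Qed.

Definition gr_id (i : 'I_3) : int := i%:Z.
Definition gr_0 (i : 'I_3) : int := 0.

Lemma gr_id_sym : symmetric_grading gr_id.
Proof. by exists 2; apply: ord3P. Qed.
Lemma gr_0_sym : symmetric_grading gr_0.
Proof. by exists 0; apply: ord3P. Qed.

Definition K0 : set 'M[E]_3 := par gr_0.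

Lemma K1_par : K1 conj v = par gr_id.
Proof.
rewrite predeqE => g; rewrite /K1 /level_group /par /gr /=.
split=> -[gG gL]; split => //.
- move=> i j; move: (gL i j); rewrite mxE.
  by move: i j; apply: ord3P; apply: ord3P => /=; rewrite /gr_id /= => H;
    apply: (pideal_pi2 H).
- move=> i j; move: (gL i j); rewrite mxE.
  by move: i j; apply: ord3P; apply: ord3P => /=; rewrite /gr_id /= => H;
    apply: (pi2_to_pideal H).
Qed.

Lemma K0E g : K0 g <-> G g /\ forall i j, pideal v 0 (g i j).
Proof.
rewrite /K0 /par /gr /gr_0 /=; split=> -[gG H]; split => // i j.
  by apply: (pi2_to_pideal (H i j)).
by apply: (pideal_pi2 (H i j)).
Qed.

End Graded.

Definition simp01 (R : pzRingType) := (@mul0r R, @mulr0 R, @mul1r R, @mulr1 R,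
  @addr0 R, @add0r R, @oppr0 R, @subr0 R, @sub0r R).

Lemma up_pconj (E : fieldType) (conj : {rmorphism E -> E}) (v : dvaluation E)
    (w : E) (k : finFieldType) (rE : E -> k * k) (lE : k * k -> E) (tz : k -> E)
    n x :
  unram_pair conj v w rE lE tz -> pideal v n x -> pideal v n (conj x).
Proof. by move=> up H; exact: (proj1 (pideal_conj (up_vconj up) _ _) H). Qed.

Ltac pidm :=
  lazymatch goal with
  | |- pideal _ _ (_ * _) => eapply pidealM; [pidm|pidm|apply: lexx]
  | |- pideal _ _ (- _) => apply: pidealN; pidm
  | |- pideal _ _ (GRing.RMorphism.sort _ _) => first [eassumption|eapply up_pconj; [eassumption|pidm]]
  | |- pideal _ _ 1 => apply: pideal1
  | |- _ => first [eassumption]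
  end.
Ltac pid :=
  first [solve [eapply pideal_le; [eassumption|lia]] |
  lazymatch goal with
  | |- pideal _ _ (_ + _) => apply: pidealD; pid
  | |- pideal _ _ (- _) => apply: pidealN; pid
  | |- pideal _ _ _ => eapply pideal_le; [pidm|try lia]
  end].

Ltac entries H := have := (H i0 i0, H i0 i1, H i0 i2, H i1 i0, H i1 i1, H i1 i2,
  H i2 i0, H i2 i1, H i2 i2) => /= -[[[[[[[[]]]]]]]].

Lemma pchar_expr_eq1 (C : fieldType) (p : nat) (c : C) :
  p \in [pchar C] -> c ^+ p = 1 -> c = 1.
Proof.
move=> pC cp; have : (c - 1) ^+ p = 0.
  rewrite -(pFrobenius_autE pC) pFrobenius_autB_comm; last exact: commr1.
  by rewrite !pFrobenius_autE cp expr1n subrr.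
by move/eqP; rewrite expf_eq0 subr_eq0 => /andP[_ /eqP].
Qed.

Lemma pchar_fixed (C : fieldType) (p : nat) (V : lmodType C) (f : {linear V -> V}) x c :
  p \in [pchar C] -> iter p f x = x -> x != 0 -> f x = c *: x -> f x = x.
Proof.
move=> pC fx x0 xc; suff c1 : c = 1 by rewrite xc c1 scale1r.
apply: (pchar_expr_eq1 pC); apply/eqP; rewrite -subr_eq0; apply: contraNT x0.
suff : (c ^+ p - 1) *: x == 0 by rewrite scaler_eq0 => /orP[->|].
rewrite scalerBl scale1r subr_eq0; apply/eqP; rewrite -[RHS]fx {fx}.
by elim: p {pC} => [|n IH]; rewrite ?expr0 ?scale1r// iterS -IH exprSr -scalerA -xc linearZ.
Qed.

Lemma irreducible_all (E C : fieldType) (A : set 'M[E]_3) (V : lmodType C)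
    (r : 'M[E]_3 -> {linear V -> V}) (Y : set V) : irreducible_rep A r ->
  (forall a x y, Y x -> Y y -> Y (a *: x + y)) ->
  (forall g x, A g -> Y x -> Y (r g x)) ->
  forall x, Y x -> x != 0 -> forall y, Y y.
Proof.
move=> [_ _ irr] Ylin Yst x Yx x0 y.
have Y0 : Y 0 by have := Ylin (-1) x x Yx Yx; rewrite scaleN1r addNr.
have [||H|H] := irr [pred z | `[< Y z >]].
- split; first exact/asboolP.
  by move=> a u z /asboolP Yu /asboolP Yz; apply/asboolP; exact: Ylin.
- by move=> g z Ag /asboolP Yz; apply/asboolP; exact: Yst.
- by have := H x; rewrite !inE (negPf x0) => /asboolP.
- by have := H y; rewrite !inE => /asboolP.
Qed.

(** The form in which q = p is used: J1 acts on the weight through the powers of a single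
    element. *)
Lemma natr_surj (p : nat) (k : finFieldType) : p \in [pchar k] -> #|k| = p ->
  forall a : k, exists n : nat, a = n%:R.
Proof.
move=> pk ck; pose f (i : 'I_p) : k := i%:R.
have finj : injective f.
  have aux (i j : 'I_p) : (i <= j)%N -> f i = f j -> i = j.
    move=> ij fij; apply/val_inj/eqP; rewrite /= eqn_leq ij/=.
    have : (p %| j - i)%N.
      by rewrite (dvdn_pcharf pk) natrB//; move: fij; rewrite /f => ->; rewrite subrr.
    rewrite leqNgt; case: (ltnP i j) => // lt dv.
    have := dvdn_leq _ dv; rewrite subn_gt0 => /(_ lt).
    by have := ltn_ord j; lia.
  by move=> i j fij; have [/aux|/ltnW/aux H] := leqP i j; [exact|apply/esym/H/esym].
move=> a; have /codomP[i ->] : a \in codom f.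
  by apply: inj_card_onto => //; rewrite card_ord ck.
by exists i.
Qed.

(** * Spans of right translates *)

Section Translates.
Context (E : fieldType) (C : fieldType) (V : lmodType C).
Local Notation rt := (@rtrans E V).
Implicit Types (A : set 'M[E]_3) (f : 'M[E]_3 -> V).

Definition tspan A f : set ('M[E]_3 -> V) :=
  [set f' | exists2 l : seq (C * 'M[E]_3), forall ck, ck \in l -> A ck.2 &
    f' = \sum_(ck <- l) ck.1 *: rt ck.2 f].

Lemma tspan_mem A f : A 1%:M -> tspan A f f.
Proof.
move=> A1; exists [:: (1, 1%:M)]; first by move=> ck; rewrite inE => /eqP ->.
by rewrite big_seq1 scale1r; apply: funext => x; rewrite /rtrans mulmx1.
Qed.

Lemma tspan_lin A f c f1 f2 : tspan A f f1 -> tspan A f f2 ->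
  tspan A f (c *: f1 + f2).
Proof.
move=> [l1 A1 ->] [l2 A2 ->]; exists ([seq (c * ck.1, ck.2) | ck <- l1] ++ l2).
  by move=> ck; rewrite mem_cat => /orP[/mapP[ck' /A1 ? ->]|/A2].
rewrite big_cat big_map scaler_sumr; congr (_ + _).
by apply: eq_bigr => ck _; rewrite scalerA.
Qed.

Lemma tspan0 A f : tspan A f 0.
Proof. by exists [::]; rewrite ?big_nil. Qed.

Lemma tspanD A f f1 f2 : tspan A f f1 -> tspan A f f2 -> tspan A f (f1 + f2).
Proof. by rewrite -{2}[f1]scale1r; exact: tspan_lin. Qed.

Lemma tspanZ A f c f1 : tspan A f f1 -> tspan A f (c *: f1).
Proof. by move=> H; rewrite -[c *: f1]addr0; apply: tspan_lin H (tspan0 _ _). Qed.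

Lemma tspan_sum A f (I : Type) (r : seq I) (F : I -> 'M[E]_3 -> V) :
  (forall i, tspan A f (F i)) -> tspan A f (\sum_(i <- r) F i).
Proof.
move=> H; elim/big_rec: _ => [|i f' _]; first exact: tspan0.
exact: tspanD.
Qed.

Lemma tspan_rtrans A f g f1 : (forall h, A h -> A (g *m h)) -> tspan A f f1 ->
  tspan A f (rt g f1).
Proof.
move=> Ag [l lA ->]; exists [seq (ck.1, g *m ck.2) | ck <- l].
  by move=> _ /mapP[ck ckl ->]; apply: Ag; exact: lA.
rewrite big_map; apply: funext => x; rewrite /rtrans !fct_sumE.
by apply: eq_bigr => ck _; rewrite -[RHS]/(ck.1 *: f (x *m (g *m ck.2))) mulmxA.
Qed.

Lemma tspan_val A f f1 (P : 'M[E]_3 -> Prop) g : tspan A f f1 ->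
  (forall h, A h -> f (g *m h) != 0 -> P g) -> f1 g != 0 -> P g.
Proof.
move=> [l lA ->] fP; rewrite fct_sumE => g0; apply: contrapT => nP.
case/eqP: g0; rewrite big_seq; apply: big1 => ck /lA ckA.
have [E1|/(fP _ ckA)//] := eqVneq (f (g *m ck.2)) 0.
by rewrite -[LHS]/(ck.1 *: f (g *m ck.2)) E1 scaler0.
Qed.

End Translates.

Section UnramifiedU3.
Context (E : fieldType) (conj : {rmorphism E -> E}) (v : dvaluation E).
Context (w : E) (k : finFieldType) (rE : E -> k * k) (lE : k * k -> E) (tz : k -> E).
Hypothesis up : unram_pair conj v w rE lE tz.
Implicit Types (M g h : 'M[E]_3).
Local Notation G := (unitary conj).
Local Notation Kp := (par conj v gr_id).
Local Notation K0 := (K0 conj v).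
Local Notation s := (betaK1 w).
Local Notation bt := (beta E).

Let conjK := up_conjK up.
Let vconj := up_vconj up.
Let Kg := par_subgroup conjK vconj gr_id_sym.
Let K0g := par_subgroup conjK vconj gr_0_sym.
Let Gg := unitary_subgroup conjK.

(** * The Iwahori subgroup and its pro-p radical *)

Section Iwahori.

Definition J : set 'M[E]_3 := [set g | Kp g /\ K0 g].

Lemma J_subgroup : subgroup J.
Proof.
have [K1 K2 K3 K4] := par_subgroup conjK vconj gr_id_sym.
have [L1 L2 L3 L4] := par_subgroup conjK vconj gr_0_sym.
split.
- by move=> g [[[gU _] _] _].
- by split.
- by move=> g h [? ?] [? ?]; split; [exact: K3|exact: L3].
- by move=> g [? ?]; split; [exact: K4|exact: L4].
Qed.

Lemma JE g : J g <-> G g /\ forall i j : 'I_3, pideal v (j < i)%N%:Z (g i j).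
Proof.
split=> [[[gG gK] [_ g0]]|[gG H]].
  split => // i j; have := g0 i j; have := gK i j; rewrite /gr_id /gr_0.
  move: i j; apply: ord3P; apply: ord3P => /= H H';
  by first [by apply: (pi2_to_pideal H)|by apply: (pi2_to_pideal H')].
split; split => // i j; have := H i j; rewrite /gr_id /gr_0;
  by move: i j; apply: ord3P; apply: ord3P => /= H'; apply: (pideal_pi2 H').
Qed.

Lemma KpE g : Kp g -> G g /\ forall i j : 'I_3, pideal v ((j < i)%N%:Z - ((i == i0) && (j == i2))%:Z) (g i j).
Proof.
move=> [gG gK]; split => // i j; have := gK i j; rewrite /gr_id.
by move: i j; apply: ord3P; apply: ord3P => /= H; apply: (pi2_to_pideal H).
Qed.

Lemma norm_pideal m n y : pideal v m (y * conj y) -> 2%:Z * n - 1 <= m -> pideal v n y.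
Proof.
have [->|y0] := eqVneq y 0; first by left.
move=> /(pideal_dval _) H nm; right.
have := H _; rewrite mulf_neq0 ?fmorph_eq0// dvalM ?fmorph_eq0// vconj => /(_ isT).
by lia.
Qed.

(** For an isotropic vector the norm of the middle coordinate is minus a trace. As v(y conj y) = 2
    v(y), the coordinate [y] gets half the valuation of x conj z, rounded up: hence the bound 2n -
    1. *)
Lemma isotropic_pideal m n x y z : x * conj z + y * conj y + z * conj x = 0 ->
  pideal v m (x * conj z) -> 2%:Z * n - 1 <= m -> pideal v n y.
Proof.
move=> iso xz; apply: norm_pideal.
have -> : y * conj y = - (x * conj z + conj (x * conj z)).
  by rewrite rmorphM/= conjK; apply/eqP; rewrite -addr_eq0 -iso; apply/eqP; ring.
by apply: pidealN; apply: pidealD => //; exact: (up_pconj up).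
Qed.

(** A single corner entry suffices: the first column and the last row are isotropic, which forces
    the other two entries below the diagonal into the maximal ideal. *)
Lemma J_K0 g : K0 g -> pideal v 1 (g i2 i0) -> J g.
Proof.
move=> gK; have [gG go] := (proj1 (K0E _ _ _) gK) => g20'; apply/JE; split => //.
have c0 := unitary_col i0 i0 gG; have r2 := unitary_row i2 i2 gG.
rewrite /= in c0 r2.
entries go => g00 g01 g02 g10 g11 g12 g20 g21 g22.
have g10' : pideal v 1 (g i1 i0).
  by apply: (isotropic_pideal c0 (m := 1)) => //; apply: pidealM g00 (up_pconj up g20') _.
have g21' : pideal v 1 (g i2 i1).
  by apply: (isotropic_pideal r2 (m := 1)) => //; apply: pidealM g20' (up_pconj up g22) _.
by apply: ord3P; apply: ord3P => /=.
Qed.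

Lemma J_Kp g : Kp g -> pideal v 0 (g i0 i2) -> J g.
Proof.
move=> gK g02; apply/JE; have [gG go] := KpE gK; split => // i j.
by have := go i j; move: i j; apply: ord3P; apply: ord3P => /=.
Qed.

Lemma pideal_mul_unit x y : pideal v 0 x -> pideal v 0 y -> pideal v 1 (x * y - 1) ->
  v x = 0 /\ x != 0.
Proof.
move=> xo yo xy1.
have nx : ~ pideal v 1 x.
  move=> x1; apply: (@pideal_lt1 E v 1) => //.
  have -> : 1 = x * y - (x * y - 1) by rewrite opprB addrC subrK.
  by apply: pidealB => //; apply: pidealM x1 yo _.
have x0 : x != 0 by apply/eqP => E1; apply: nx; rewrite E1; left.
by split => //; exact: dval_eq0.
Qed.

Lemma J_unit g : J g -> (v (g i0 i0) = 0 /\ g i0 i0 != 0) /\ (v (g i2 i2) = 0 /\ g i2 i2 != 0).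
Proof.
move=> /JE [gG go].
have c02 : g i0 i0 * conj (g i2 i2) + g i1 i0 * conj (g i1 i2) +
  g i2 i0 * conj (g i0 i2) = 1 := unitary_col i0 i2 gG.
entries go => g00 g01 g02 g10 g11 g12 g20 g21 g22.
have H : pideal v 1 (g i0 i0 * conj (g i2 i2) - 1).
  rewrite -c02; have -> : g i0 i0 * conj (g i2 i2) -
   (g i0 i0 * conj (g i2 i2) + g i1 i0 * conj (g i1 i2) + g i2 i0 * conj (g i0 i2)) =
   - (g i1 i0 * conj (g i1 i2)) - (g i2 i0 * conj (g i0 i2)) by ring.
  by pid.
split; first exact: pideal_mul_unit g00 (up_pconj up g22) H.
apply: (pideal_mul_unit g22 (up_pconj up g00)).
have -> : g i2 i2 * conj (g i0 i0) - 1 = conj (g i0 i0 * conj (g i2 i2) - 1).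
  by rewrite rmorphB rmorphM/= conjK rmorph1 mulrC.
exact: (up_pconj up).
Qed.

Lemma J_diagM g h i : J g -> J h -> pideal v 1 ((g *m h) i i - g i i * h i i).
Proof.
move=> /JE [gG go] /JE [hG ho].
entries go => g00 g01 g02 g10 g11 g12 g20 g21 g22.
entries ho => h00 h01 h02 h10 h11 h12 h20 h21 h22.
rewrite mulmx3; move: i; apply: ord3P.
- have -> : g i0 i0 * h i0 i0 + g i0 i1 * h i1 i0 + g i0 i2 * h i2 i0 - g i0 i0 * h i0 i0
    = g i0 i1 * h i1 i0 + g i0 i2 * h i2 i0 by ring.
  by pid.
- have -> : g i1 i0 * h i0 i1 + g i1 i1 * h i1 i1 + g i1 i2 * h i2 i1 - g i1 i1 * h i1 i1
    = g i1 i0 * h i0 i1 + g i1 i2 * h i2 i1 by ring.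
  by pid.
- have -> : g i2 i0 * h i0 i2 + g i2 i1 * h i1 i2 + g i2 i2 * h i2 i2 - g i2 i2 * h i2 i2
    = g i2 i0 * h i0 i2 + g i2 i1 * h i1 i2 by ring.
  by pid.
Qed.

(* The pro-p radical of J. *)
Definition J1 : set 'M[E]_3 := [set g | J g /\ forall i, pideal v 1 (g i i - 1)].

Lemma J_oii g i : J g -> pideal v 0 (g i i).
Proof. by move=> /JE[_ /(_ i i)]; rewrite ltnn. Qed.

Lemma J1_quot g h : J g -> J h -> (forall i, pideal v 1 (g i i - h i i)) ->
  J1 (invmx g *m h).
Proof.
move=> Jg Jh gh; have Jg' := subgroupV J_subgroup Jg.
have gU := subgroup_unit J_subgroup Jg.
split; first exact: subgroupM J_subgroup Jg' Jh.
move=> i; have e1 := J_diagM i Jg' Jh; have e2 := J_diagM i Jg' Jg.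
have e3 := gh i; have o := J_oii i Jg'.
rewrite mulVmx// mxE eqxx in e2.
have -> : (invmx g *m h) i i - 1 = ((invmx g *m h) i i - invmx g i i * h i i)
  - invmx g i i * (g i i - h i i) - (1 - invmx g i i * g i i) by ring.
by pid.
Qed.

Lemma J1_subgroup : subgroup J1.
Proof.
have inv g : J1 g -> J1 (invmx g).
  move=> [Jg g1]; have -> : invmx g = invmx g *m 1%:M by rewrite mulmx1.
  apply: J1_quot => //; first exact: subgroup1 J_subgroup.
  by move=> i; rewrite [X in _ - X]mxE eqxx.
split.
- by move=> g [Jg _]; exact: subgroup_unit J_subgroup Jg.
- split; first exact: subgroup1 J_subgroup.
  by move=> i; rewrite mxE eqxx subrr; left.
- move=> g h Jg [Jh h1]; have [Jg' g1] := inv _ Jg.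
  have gU := subgroup_unit J_subgroup Jg'.
  rewrite -[g]invmxK; apply: J1_quot => // i.
  by rewrite -(subrKA 1); apply: pidealD => //; rewrite -opprB; exact: pidealN.
- exact: inv.
Qed.

Lemma J1_normal : normal_subgroup J1 J.
Proof.
split; [exact: J1_subgroup|by move=> g []|].
move=> g n Jg [Jn n1]; split.
  apply: (subgroupM J_subgroup); first exact: (subgroupM J_subgroup).
  exact: (subgroupV J_subgroup).
have Jg' := subgroupV J_subgroup Jg.
have gU := subgroup_unit J_subgroup Jg.
move=> i; have e1 := J_diagM i (subgroupM J_subgroup Jg Jn) Jg'.
have e2 := J_diagM i Jg Jn; have e3 := J_diagM i Jg Jg'.
rewrite mulmxV// mxE eqxx in e3.
have o1 := J_oii i Jg; have o2 := J_oii i Jg'; have e4 := n1 i.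
have -> : (g *m n *m invmx g) i i - 1 =
  ((g *m n *m invmx g) i i - (g *m n) i i * invmx g i i)
  + ((g *m n) i i - g i i * n i i) * invmx g i i
  + g i i * (n i i - 1) * invmx g i i - (1 - g i i * invmx g i i) by ring.
by pid.
Qed.

Lemma congK_J1 : cong conj v gr_id 1 `<=` J1.
Proof.
move=> g gc; have [gG g1] := gc; have gK := cong_par gc.
have g02 : pideal v 0 (g i0 i2).
  have := g1 i0 i2; have -> : (g - 1%:M) i0 i2 = g i0 i2 by rewrite !mxE subr0.
  by move=> H; apply: (pi2_to_pideal H).
split; first exact: J_Kp.
move=> i; have := g1 i i; rewrite !mxE eqxx => H.
by apply: (pi2_to_pideal H); lia.
Qed.

Lemma congK0_J1 : cong conj v gr_0 2 `<=` J1.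
Proof.
move=> g gc; have [gG g1] := gc; have gK := cong_par gc.
split; last first.
  move=> i; have := g1 i i; rewrite !mxE eqxx => H.
  by apply: (pi2_to_pideal H); rewrite /gr_0; lia.
apply: J_K0 => //.
have := g1 i2 i0; have -> : (g - 1%:M) i2 i0 = g i2 i0 by rewrite !mxE subr0.
by move=> H; apply: (pi2_to_pideal H).
Qed.

Lemma J1_congK g : J1 g -> pideal v 2 (g i2 i0) -> cong conj v gr_id 1 g.
Proof.
move=> [/JE[gG go] g1] g20'; split => //.
entries go => g00 g01 g02 g10 g11 g12 g20 g21 g22.
move=> i j; rewrite !mxE /gr_id; move: i j.
apply: ord3P; apply: ord3P; rewrite /= ?(subr0 (g _ _)).
- exact: (pideal_pi2 (g1 i0)).
- exact: (pideal_pi2 g01).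
- exact: (pideal_pi2 g02).
- exact: (pideal_pi2 g10).
- exact: (pideal_pi2 (g1 i1)).
- exact: (pideal_pi2 g12).
- exact: (pideal_pi2 g20').
- exact: (pideal_pi2 g21).
- exact: (pideal_pi2 (g1 i2)).
Qed.

Lemma J1_congK0 g : J1 g -> pideal v 1 (g i0 i2) -> cong conj v gr_0 2 g.
Proof.
move=> [/JE[gG go] g1] g02'; split => //.
entries go => g00 g01 g02 g10 g11 g12 g20 g21 g22.
have r0 := unitary_row i0 i0 gG; have c2 := unitary_col i2 i2 gG.
rewrite /= in r0 c2; clear g02.
have g01' : pideal v 1 (g i0 i1).
  by apply: (isotropic_pideal r0 (m := 1)) => //; pid.
have g12' : pideal v 1 (g i1 i2).
  by apply: (isotropic_pideal c2 (m := 1)) => //; pid.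
move=> i j; rewrite !mxE /gr_0; move: i j.
apply: ord3P; apply: ord3P; rewrite /= ?(subr0 (g _ _)).
- exact: (pideal_pi2 (g1 i0)).
- exact: (pideal_pi2 g01').
- exact: (pideal_pi2 g02').
- exact: (pideal_pi2 g10).
- exact: (pideal_pi2 (g1 i1)).
- exact: (pideal_pi2 g12').
- exact: (pideal_pi2 g20).
- exact: (pideal_pi2 g21).
- exact: (pideal_pi2 (g1 i2)).
Qed.

End Iwahori.

Let Jg := J_subgroup.

(** * Root subgroups and reflections *)

Section Representatives.

Let w0 := up_w0 up.
Let cw := up_conjw up.

(** The reductive quotient at K1 is U(1,1) x U(1), so only the long root group [low] is needed
    there. At K0 it is U(2,1), whose unipotent radical consists of the [upp b c] with
    [c + conj c + b * conj b = 0]: a Heisenberg group with q^3 elements over the residue field. *)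
Definition low (c : E) : 'M[E]_3 :=
  mx3 0 [:: [:: 1; 0; 0]; [:: 0; 1; 0]; [:: c; 0; 1]].
Definition upp (b c : E) : 'M[E]_3 :=
  mx3 0 [:: [:: 1; b; c]; [:: 0; 1; - conj b]; [:: 0; 0; 1]].

Lemma low_unitary c : c + conj c = 0 -> G (low c).
Proof.
move=> cc; apply/unitaryE; apply/mx3P => i j.
rewrite mulmx3 !mulmxbeta !rev3 betaE !mxE; move: i j.
by apply: ord3P; apply: ord3P; rewrite /= ?(rmorph0, rmorph1) ?simp01// addrC.
Qed.

Lemma upp_unitary b c : c + conj c + b * conj b = 0 -> G (upp b c).
Proof.
move=> cc; apply/unitaryE; apply/mx3P => i j.
rewrite mulmx3 !mulmxbeta !rev3 betaE !mxE; move: i j.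
apply: ord3P; apply: ord3P; rewrite /= ?(rmorph0, rmorph1, rmorphN) /= ?conjK ?simp01 ?subrr ?addNr//.
by rewrite -cc; ring.
Qed.

Lemma low_mul c d : low c *m low d = low (c + d).
Proof.
apply/mx3P => i j; rewrite mulmx3 !mxE; move: i j.
by apply: ord3P; apply: ord3P; rewrite /= ?simp01.
Qed.

Lemma low0 : low 0 = 1%:M.
Proof.
by apply/mx3P => i j; rewrite !mxE; move: i j; apply: ord3P; apply: ord3P.
Qed.

Lemma low_inv c : invmx (low c) = low (- c).
Proof. by apply: invmx_eq; rewrite low_mul subrr low0. Qed.

Lemma upp_mul b c b' c' : upp b c *m upp b' c' = upp (b + b') (c + c' - b * conj b').
Proof.
apply/mx3P => i j; rewrite mulmx3 !mxE; move: i j.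
apply: ord3P; apply: ord3P; rewrite /= ?rmorphD /= ?simp01//; first by rewrite addrC.
  by ring.
by rewrite opprD addrC.
Qed.

Lemma upp0 : upp 0 0 = 1%:M.
Proof.
apply/mx3P => i j; rewrite !mxE; move: i j; apply: ord3P; apply: ord3P => //=.
by rewrite rmorph0 oppr0.
Qed.

Lemma upp_inv b c : c + conj c + b * conj b = 0 -> invmx (upp b c) = upp (- b) (conj c).
Proof.
move=> cc; apply: invmx_eq; rewrite upp_mul subrr rmorphN mulrN opprK cc.
exact: upp0.
Qed.

Lemma betaK1E i j : s i j =
  mx3 0 [:: [:: 0; 0; w^-1]; [:: 0; 1; 0]; [:: w; 0; 0]] i j.
Proof.
rewrite /betaK1.
have -> : invmx (alpha w) = mx3 0 [:: [:: w; 0; 0]; [:: 0; 1; 0]; [:: 0; 0; w^-1]].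
  apply: invmx_eq; apply/mx3P => a b; rewrite mulmx3 !mxE; move: a b.
  by apply: ord3P; apply: ord3P; rewrite /= ?simp01 ?mulVf ?mulfV.
rewrite mulbeta !mxE; move: i j.
by apply: ord3P; apply: ord3P.
Qed.

Lemma mul_s M i j : (s *m M) i j =
  mx3 0 [:: [:: w^-1 * M i2 i0; w^-1 * M i2 i1; w^-1 * M i2 i2];
            [:: M i1 i0; M i1 i1; M i1 i2];
            [:: w * M i0 i0; w * M i0 i1; w * M i0 i2]] i j.
Proof.
rewrite mulmx3 !betaK1E !mxE; move: i j.
by apply: ord3P; apply: ord3P; rewrite /= ?simp01.
Qed.

Lemma mul_s_s M i j : (s *m M *m s) i j =
  mx3 0 [:: [:: M i2 i2; w^-1 * M i2 i1; w^-1 * (w^-1 * M i2 i0)];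
            [:: w * M i1 i2; M i1 i1; w^-1 * M i1 i0];
            [:: w * (w * M i0 i2); w * M i0 i1; M i0 i0]] i j.
Proof.
rewrite mulmx3 !betaK1E !mul_s !mxE; move: i j.
apply: ord3P; apply: ord3P; rewrite /= ?simp01//.
- by rewrite mulrAC mulVf ?mul1r.
- by rewrite [LHS]mulrC.
- by rewrite [LHS]mulrC.
- by rewrite [LHS]mulrC.
- by rewrite [LHS]mulrC.
- by rewrite mulrAC mulfV ?mul1r.
Qed.

Lemma s_s : s *m s = 1%:M.
Proof.
apply/mx3P => i j; rewrite mul_s !betaK1E !mxE; move: i j.
by apply: ord3P; apply: ord3P; rewrite /= ?simp01 ?mulVf ?mulfV.
Qed.

Lemma s_alpha : beta E = s *m alpha w.
Proof.
rewrite /betaK1 -mulmxA mulVmx ?mulmx1//.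
have : alpha w *m mx3 0 [:: [:: w; 0; 0]; [:: 0; 1; 0]; [:: 0; 0; w^-1]] = 1%:M.
  apply/mx3P => a b; rewrite mulmx3 !mxE; move: a b.
  by apply: ord3P; apply: ord3P; rewrite /= ?simp01 ?mulVf ?mulfV.
by case/mulmx1_unit.
Qed.

Lemma s_unitary : G s.
Proof.
apply/unitaryE; apply/mx3P => i j.
rewrite mulmx3 !mulmxbeta !rev3 betaE ![map_mx _ _ _ _]mxE ![_^T _ _]mxE !betaK1E !mxE; move: i j.
by apply: ord3P; apply: ord3P; rewrite /= ?(rmorph0, rmorph1, fmorphV) ?cw ?simp01 ?mulVf ?mulfV.
Qed.

Lemma wo n : n <= 1 -> pideal v n w.
Proof. by move=> n1; right; rewrite (up_vw up). Qed.

Lemma wVo n : n <= -1 -> pideal v n w^-1.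
Proof. by move=> n1; right; rewrite dvalV// (up_vw up). Qed.

Lemma s_Kp : Kp s.
Proof.
split; first exact: s_unitary.
move=> i j; rewrite betaK1E mxE /gr_id; move: i j.
apply: ord3P; apply: ord3P => /=; rewrite /pi2 ?(up_vw up) ?dvalV// ?(up_vw up)// ?dval1; by [left|right].
Qed.

Lemma beta_unitary : G (beta E).
Proof.
by apply/unitaryE; rewrite betaT map_beta beta_beta mul1mx.
Qed.

Lemma beta_K0 : K0 (beta E).
Proof.
apply/K0E; split; first exact: beta_unitary.
by move=> i j; rewrite betaE; case: eqP => _; [exact: pideal1|left].
Qed.

Lemma beta_conj M i j : (beta E *m M *m beta E) i j = M (rev_ord i) (rev_ord j).
Proof. by rewrite mulmxbeta mulbeta. Qed.

Lemma J_sJs g : J g -> J (s *m g *m s) <-> pideal v 2 (g i2 i0).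
Proof.
move=> gJ; split=> [/JE[_ go]|g20'].
  have := go i0 i2; rewrite mul_s_s mxE /= => H.
  have -> : g i2 i0 = w * (w * (w^-1 * (w^-1 * g i2 i0))) by rewrite !mulVKf ?mulfK// mulVKf.
  by apply: pidealM (wo (lexx _)) (pidealM (wo (lexx _)) H (lexx _)) _.
apply: J_Kp.
  have KM := fun g h => @subgroupM E _ g h (par_subgroup conjK vconj gr_id_sym).
  by apply: (KM _ _ (KM _ _ s_Kp _) s_Kp); case: gJ.
rewrite mul_s_s mxE /=.
by apply: pidealM (wVo (lexx _)) (pidealM (wVo (lexx _)) g20' (lexx _)) _.
Qed.

Lemma J_bJb g : J g -> J (beta E *m g *m beta E) <-> pideal v 1 (g i0 i2).
Proof.
move=> gJ; split=> [/JE[_ go]|g02'].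
  by have := go i2 i0; rewrite beta_conj !rev3.
apply: J_K0.
  have KM := fun g h => @subgroupM E _ g h (par_subgroup conjK vconj gr_0_sym).
  by apply: (KM _ _ (KM _ _ beta_K0 _) beta_K0); case: gJ.
by rewrite beta_conj !rev3.
Qed.

End Representatives.

(** * Rank-one decompositions at the two vertices *)

Section RankOneInstances.

Let w0 := up_w0 up.
Let cw := up_conjw up.
Let n2 := up_2 up.

Definition uK (a : k) : 'M[E]_3 := low (w * tz a).
(** The solutions c of [c + conj c = - b * conj b]: the particular one -b conj b / 2, available
    because p is odd, plus an element of trace zero. *)
Definition cN (r : k * k * k) : E := - (lE r.1 * conj (lE r.1)) / 2%:R + tz r.2.
Definition uN (r : k * k * k) : 'M[E]_3 := upp (lE r.1) (cN r).

Let v2V : pideal v 0 2%:R^-1.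
Proof. by right; rewrite dvalV// (up_v2 up). Qed.

Let trw a : w * tz a + conj (w * tz a) = 0.
Proof. by rewrite rmorphM/= cw (up_conj_tz up); ring. Qed.

Let ww : pideal v 1 w. Proof. exact: (wo (lexx _)). Qed.
Let tzo a : pideal v 0 (tz a). Proof. exact: up_tzo up a. Qed.
Let lEo a : pideal v 0 (lE a). Proof. exact: up_lEo up a. Qed.

Lemma uK_J1 a : J1 (uK a).
Proof.
split; last by apply: ord3P; rewrite mxE /= subrr; left.
apply/JE; split; first by apply: low_unitary; exact: trw.
move=> i j; rewrite mxE; move: i j; apply: ord3P; apply: ord3P => /=;
  try exact: pideal1; try by left.
by apply: pidealM ww (tzo a) _.
Qed.

Lemma cN_rel r : cN r + conj (cN r) + lE r.1 * conj (lE r.1) = 0.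
Proof.
rewrite /cN rmorphD rmorphM rmorphN rmorphM fmorphV rmorph_nat /= conjK.
by rewrite (up_conj_tz up); field.
Qed.

Lemma cNo r : pideal v 0 (cN r).
Proof.
have Ho : pideal v 0 (- (lE r.1 * conj (lE r.1))).
  by apply: pidealN; apply: pidealM (lEo _) (up_pconj up (lEo _)) _.
by apply: pidealD => //; apply: pidealM Ho v2V _.
Qed.

Lemma uN_unitary r : G (uN r).
Proof. exact: (upp_unitary (cN_rel r)). Qed.

Lemma uN_J1 r : J1 (uN r).
Proof.
split; last by apply: ord3P; rewrite mxE /= subrr; left.
apply/JE; split; first exact: uN_unitary.
move=> i j; rewrite mxE; move: i j; apply: ord3P; apply: ord3P => /=;
  try exact: pideal1; try by left.
- exact: lEo.
- exact: cNo.
- by apply: pidealN; exact: (up_pconj up (lEo _)).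
Qed.

Lemma lowV_mul c M i j : (invmx (low c) *m M) i j =
  M i j - (if i == i2 then c * M i0 j else 0).
Proof.
rewrite low_inv mulmx3 !mxE; move: i; apply: ord3P; rewrite /= ?simp01//.
by rewrite mulNr addrC.
Qed.

Lemma uppV_mul b c M j : c + conj c + b * conj b = 0 ->
  [/\ (invmx (upp b c) *m M) i0 j = M i0 j - b * M i1 j + conj c * M i2 j,
      (invmx (upp b c) *m M) i1 j = M i1 j + conj b * M i2 j &
      (invmx (upp b c) *m M) i2 j = M i2 j].
Proof.
move=> cc; rewrite (upp_inv cc); split; rewrite mulmx3 !mxE /= ?simp01//.
  by rewrite mulNr.
by rewrite rmorphN opprK.
Qed.

(** Isotropy makes z / (w x) of trace zero modulo the maximal ideal, so it is congruent to some
    [tz a]. The shift [m] is -1 for the last column of an element of K1 outside J and 0 for the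
    first column of an element of J. *)
Lemma low_rep m x y z : x * conj z + y * conj y + z * conj x = 0 ->
  x != 0 -> v x = m -> pideal v (m + 1) y -> pideal v (m + 1) z ->
  exists a, pideal v (m + 2) (z - w * tz a * x).
Proof.
move=> iso x0 vx ym zm; have cx0 : conj x != 0 by rewrite fmorph_eq0.
have xm : pideal v m x by right; rewrite vx.
have wx0 : w * x != 0 by rewrite mulf_neq0.
have wxV : pideal v (- m - 1) (w * x)^-1.
  by right; rewrite dvalV// dvalM// (up_vw up) vx; lia.
have to : pideal v 0 (z / (w * x)) by apply: pidealM zm wxV _; lia.
have cxV : pideal v (- m) (conj x)^-1 by right; rewrite dvalV// vconj vx.
have [|a Ha] := up_tz_surj up to.
  have -> : z / (w * x) + conj (z / (w * x)) = - (y * conj y) / (w * x) / conj x.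
    have -> : - (y * conj y) = x * conj z + z * conj x.
      by apply/esym/eqP; rewrite -addr_eq0 -iso; apply/eqP; ring.
    rewrite rmorphM fmorphV rmorphM/= cw; field.
    by rewrite cx0 x0 w0.
  have Hy := pidealN (pidealM ym (up_pconj up ym) (lexx _)).
  by apply: pidealM (pidealM Hy wxV (lexx _)) cxV _; lia.
exists a; have -> : z - w * tz a * x = w * x * (z / (w * x) - tz a).
  by field; rewrite x0 w0.
by apply: pidealM (pidealM ww xm (lexx _)) Ha _; lia.
Qed.

Lemma uN_rep b c : pideal v 0 b -> pideal v 0 c -> c + conj c + b * conj b = 0 ->
  exists r, pideal v 1 (lE r.1 - b) /\ pideal v 1 (cN r - c).
Proof.
move=> bo co cc.
have bb : pideal v 1 (lE (rE b) - b).
  by apply/(up_rE up) => //; rewrite (up_lEK up).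
set d := lE (rE b) in bb.
have d_o : pideal v 0 d by exact: lEo.
have yo : pideal v 0 (c + d * conj d / 2%:R).
  apply: pidealD => //; apply: pidealM (pidealM d_o (up_pconj up d_o) (lexx _)) v2V _.
  by [].
have [|a Ha] := up_tz_surj up yo.
  have -> : c + d * conj d / 2%:R + conj (c + d * conj d / 2%:R) =
    (d - b) * conj d + b * conj (d - b) + (c + conj c + b * conj b).
    rewrite rmorphD rmorphM rmorphM fmorphV rmorph_nat rmorphB /= conjK.
    by field.
  have bb' := up_pconj up bb; have do' := up_pconj up d_o.
  by rewrite cc addr0; pid.
exists (rE b, a); split => //=; rewrite /cN /= -/d.
have -> : - (d * conj d) / 2%:R + tz a - c = - (c + d * conj d / 2%:R - tz a) by ring.
exact: pidealN.
Qed.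

Lemma upp_rep x y z : x * conj z + y * conj y + z * conj x = 0 ->
  z != 0 -> v z = 0 -> pideal v 0 x -> pideal v 0 y ->
  exists r, pideal v 1 (x - lE r.1 * y + conj (cN r) * z).
Proof.
move=> iso z0 vz xo yo; have cz0 : conj z != 0 by rewrite fmorph_eq0.
have zV : pideal v 0 z^-1 by right; rewrite dvalV// vz.
have zo : pideal v 0 z by right; rewrite vz.
(* The column (x, y, z) divided by [z] is the last column of [upp b c]; the isotropy relation
   becomes the equation of the Heisenberg group. *)
set b := - conj (y / z); set c := x / z.
have bo : pideal v 0 b by apply: pidealN; apply: (up_pconj up); apply: pidealM yo zV _.
have co : pideal v 0 c by apply: pidealM xo zV _.
have cc : c + conj c + b * conj b = 0.
  have -> : c + conj c + b * conj b =
    (x * conj z + y * conj y + z * conj x) / (z * conj z).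
    rewrite /b /c rmorphN /= conjK !rmorphM /= !fmorphV; field.
    by rewrite z0 cz0.
  by rewrite iso mul0r.
have [r [br cr]] := uN_rep bo co cc; exists r.
have -> : x - lE r.1 * y + conj (cN r) * z =
  conj (cN r - c) * z - (lE r.1 - b) * y + (x * conj z + y * conj y + z * conj x) / conj z.
  rewrite rmorphB /= /b /c !rmorphM /= !fmorphV; field.
  exact: cz0.
by rewrite iso mul0r addr0; have cr' := up_pconj up cr; pid.
Qed.

Lemma Kp_notJ g : Kp g -> ~ J g -> v (g i0 i2) = -1 /\ g i0 i2 != 0.
Proof.
move=> gK nJ; have [gG go] := KpE gK.
have g02 : pideal v (-1) (g i0 i2) := go i0 i2.
have n0 : g i0 i2 != 0 by apply/eqP => E0; apply: nJ; apply: J_Kp => //; rewrite E0; left.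
split => //; apply/eqP; rewrite eq_le (pideal_dval n0 g02) andbT leNgt.
apply/negP => gt; apply: nJ; apply: J_Kp => //; right; lia.
Qed.

Lemma K0_notJ g : K0 g -> ~ J g -> v (g i2 i0) = 0 /\ g i2 i0 != 0.
Proof.
move=> gK nJ; have [gG go] := proj1 (K0E _ _ _) gK.
have n1 : ~ pideal v 1 (g i2 i0) by move=> H; apply: nJ; exact: J_K0.
have n0 : g i2 i0 != 0 by apply/eqP => E0; apply: n1; rewrite E0; left.
by split => //; apply: dval_eq0.
Qed.

Let J1J g : J1 g -> J g. Proof. by case. Qed.

Lemma J1_diag_eq q r i : J1 q -> J i -> J r -> J1 r -> forall j,
  pideal v 1 ((invmx q *m (i *m r)) j j - i j j).
Proof.
move=> Jq Ji Jr [_ r1] j.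
have [Jq' q1] := subgroupV J1_subgroup Jq.
have e1 := J_diagM j Jq' (subgroupM Jg Ji Jr); have e2 := J_diagM j Ji Jr.
have o1 := J_oii j Ji; have o2 := J_oii j Jr; have o3 := J_oii j Jq'.
have e3 := q1 j; have e4 := r1 j.
have -> : (invmx q *m (i *m r)) j j - i j j =
  ((invmx q *m (i *m r)) j j - invmx q j j * (i *m r) j j)
  + invmx q j j * ((i *m r) j j - i j j * r j j)
  + invmx q j j * i j j * (r j j - 1) + (invmx q j j - 1) * i j j by ring.
by pid.
Qed.

Lemma J1_diag q r q' r' i : J1 q -> J1 r -> J1 q' -> J1 r' -> J i ->
  J1 (invmx (invmx q *m (i *m r)) *m (invmx q' *m (i *m r'))).
Proof.
move=> Hq Hr Hq' Hr' Ji.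
apply: J1_quot.
- exact: subgroupM Jg (subgroupV Jg (J1J Hq)) (subgroupM Jg Ji (J1J Hr)).
- exact: subgroupM Jg (subgroupV Jg (J1J Hq')) (subgroupM Jg Ji (J1J Hr')).
move=> j; have e := J1_diag_eq Hq Ji (J1J Hr) Hr j.
have e' := J1_diag_eq Hq' Ji (J1J Hr') Hr' j.
by rewrite -(subrKA (i j j)) -[i j j - _]opprB; apply: pidealD => //; exact: pidealN.
Qed.

Lemma involution_conj_quot (t l l' : 'M[E]_3) : t *m t = 1%:M -> l \in unitmx ->
  t *m (invmx l *m l') *m t = invmx (t *m l *m t) *m (t *m l' *m t).
Proof.
move=> tt lU; have -> : invmx (t *m l *m t) = t *m invmx l *m t.
  apply: invmx_eq.
  by rewrite -!mulmxA [t *m (t *m _)]mulmxA tt mul1mx mulKVmx.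
by rewrite -!mulmxA [t *m (t *m _)]mulmxA tt mul1mx.
Qed.

(** The coset of an element is read off one of its columns: the representative is chosen so that its
    inverse reduces the corner entry that [J_Kp] and [J_sJs] test. *)
Theorem rank_one_K : rank_one (R := k) Kp J (cong conj v gr_id 1) s 0 uK.
Proof.
have uJ a := J1J (uK_J1 a).
have sV : invmx s = s := invmx_eq s_s.
have sK := s_Kp.
have JsJ g : J g -> pideal v 2 (g i2 i0) -> J (s *m g *m s).
  by move=> ? ?; apply/J_sJs.
split => //.
- apply: cong_normal => //; exact: gr_id_sym.
- by move=> g /congK_J1/J1J.
- by move=> g [].
- exact: s_s.
- by rewrite /uK (up_tz0 up) mulr0 low0.
- move=> g gK nJ; have [v02 n02] := Kp_notJ gK nJ.
  have [gG go] := KpE gK.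
  have c2 := unitary_col i2 i2 gG; rewrite /= in c2.
  have [|a Ha] := low_rep c2 n02 v02 (go i1 i2); first exact: (go i2 i2).
  exists a, (s *m (invmx (uK a) *m g)); split; last first.
    rewrite -mulmxA [s *m (s *m _)]mulmxA s_s mul1mx mulKVmx//.
    exact: subgroup_unit Jg (uJ a).
  apply: J_Kp.
    apply: (subgroupM Kg) => //; apply: (subgroupM Kg) => //.
    by apply: (subgroupV Kg); case: (uJ a).
  rewrite mul_s mxE /= lowV_mul /=.
  by apply: pidealM (wVo (lexx _)) Ha _.
- move=> i Ji; have [[v00 n00] _] := J_unit Ji.
  have [iG io] := proj1 (JE _) Ji.
  have c0 := unitary_col i0 i0 iG; rewrite /= in c0.
  have [|a Ha] := low_rep c0 n00 v00 (io i1 i0); first exact: (io i2 i0).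
  exists a; apply: JsJ.
    by apply: (subgroupM Jg) => //; apply: (subgroupV Jg).
  by rewrite lowV_mul.
- move=> q r /J_sJs H; apply: (up_tz_inj up).
  have := H (subgroupM Jg (subgroupV Jg (uJ q)) (uJ r)).
  rewrite lowV_mul !mxE /= mulr1 -mulrBr => H2.
  have -> : tz q - tz r = - (w^-1 * (w * (tz r - tz q))) by rewrite mulKf// opprB.
  by apply: pidealN; apply: pidealM (wVo (lexx _)) H2 _.
- move=> q r; exists ((q : k) + (r : k)); apply: J1_congK.
    apply: (subgroupM (J1_subgroup)); first exact: (subgroupV (J1_subgroup)) (uK_J1 _).
    exact: (subgroupM J1_subgroup (uK_J1 _) (uK_J1 _)).
  rewrite lowV_mul /uK low_mul !mxE /= mulr1 -mulrDr -mulrBr.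
  apply: (pidealM ww (n := 1)) => //.
  by rewrite -opprB; apply: pidealN; exact: (up_tzD up q r).
- move=> i r r' q q' Ji.
  have Jl a b : J (invmx (uK a) *m (i *m uK b)).
    by apply: (subgroupM Jg); [exact: subgroupV Jg (uJ _)|exact: subgroupM Jg Ji (uJ _)].
  move=> /(J_sJs (Jl _ _)) H1 /(J_sJs (Jl _ _)) H2.
  apply: J1_congK; first exact: J1_diag (uK_J1 _) (uK_J1 _) (uK_J1 _) (uK_J1 _) Ji.
  have Jm := subgroupM Jg (subgroupV Jg (Jl r' r)) (Jl q' q).
  apply/(J_sJs Jm).
  set l := invmx (uK r') *m (i *m uK r); set l' := invmx (uK q') *m (i *m uK q).
  have lU := subgroup_unit Jg (Jl r' r); have sU := subgroup_unit Kg sK.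
  rewrite (involution_conj_quot l' s_s lU).
  exact: subgroupM Jg (subgroupV Jg (JsJ _ (Jl _ _) H1)) (JsJ _ (Jl _ _) H2).
Qed.

Theorem rank_one_K0 : rank_one (R := (k * k * k)%type) K0 J (cong conj v gr_0 2) (beta E) (0, 0, 0) uN.
Proof.
have uJ a := J1J (uN_J1 a).
have bV : invmx (beta E) = beta E := invmx_eq (beta_beta E).
have bK := beta_K0.
have JbJ g : J g -> pideal v 1 (g i0 i2) -> J (beta E *m g *m beta E).
  by move=> ? ?; apply/J_bJb.
have uV_mul r M j := uppV_mul M j (cN_rel r).
split => //.
- apply: cong_normal => //; exact: gr_0_sym.
- by move=> g /congK0_J1/J1J.
- by move=> g [].
- exact: beta_beta.
- rewrite /uN /cN /= (up_lE0 up) (up_tz0 up) mul0r oppr0 mul0r addr0.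
  exact: upp0.
- move=> g gK nJ; have [v20 n20] := K0_notJ gK nJ.
  have [gG go] := proj1 (K0E _ _ _) gK.
  have c0 := unitary_col i0 i0 gG; rewrite /= in c0.
  have [r Hr] := upp_rep c0 n20 v20 (go _ _) (go _ _).
  exists r, (beta E *m (invmx (uN r) *m g)); split; last first.
    rewrite -mulmxA [beta E *m (beta E *m _)]mulmxA beta_beta mul1mx mulKVmx//.
    exact: subgroup_unit Jg (uJ r).
  apply: J_K0.
    apply: (subgroupM K0g) => //; apply: (subgroupM K0g) => //.
    by apply: (subgroupV K0g); case: (uJ r).
  by rewrite mulbeta rev3; have [-> _ _] := uV_mul r g i0.
- move=> i Ji; have [_ [v22 n22]] := J_unit Ji.
  have [iG io] := proj1 (JE _) Ji.
  have c2 := unitary_col i2 i2 iG; rewrite /= in c2.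
  have [r Hr] := upp_rep c2 n22 v22 (io i0 i2) (io i1 i2).
  exists r; apply: JbJ.
    by apply: (subgroupM Jg) => //; apply: (subgroupV Jg).
  by have [-> _ _] := uV_mul r i i2.
- move=> q r /J_bJb H.
  have Jqr := subgroupM Jg (subgroupV Jg (uJ q)) (uJ r).
  have [_ e1] : J1 (invmx (uN q) *m uN r).
    exact: subgroupM J1_subgroup (subgroupV J1_subgroup (uN_J1 q)) (uN_J1 r).
  have Jqr1 := subgroupM J1_subgroup (subgroupV J1_subgroup (uN_J1 q)) (uN_J1 r).
  have [_ H01] := J1_congK0 Jqr1 (H Jqr).
  have h01 : pideal v 1 ((invmx (uN q) *m uN r) i0 i1).
    have := H01 i0 i1; have -> : (invmx (uN q) *m uN r - 1%:M) i0 i1 =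
      (invmx (uN q) *m uN r) i0 i1 by rewrite !mxE subr0.
    by move=> H'; apply: (pi2_to_pideal H').
  have h02 := H Jqr.
  have [E1 _ _] := uV_mul q (uN r) i1; have [E2 _ _] := uV_mul q (uN r) i2.
  move: h01 h02; rewrite {}E1 {}E2 !mxE /= !simp01 => h01 h02.
  have qr1 : q.1 = r.1.
    rewrite -(up_lEK up q.1) -(up_lEK up r.1).
    apply/(up_rE up); [exact: lEo|exact: lEo|].
    by rewrite -opprB; exact: pidealN.
  have qr2 : q.2 = r.2.
    apply: (up_tz_inj up); move: h02; rewrite /cN qr1 => h02.
    have -> : tz q.2 - tz r.2 = - conj (conj (tz q.2 - tz r.2)) + 2%:R * (tz q.2 - tz r.2).
      by rewrite conjK; ring.
    have -> : - conj (conj (tz q.2 - tz r.2)) + 2%:R * (tz q.2 - tz r.2) =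
      - (- (lE r.1 * conj (lE r.1)) / 2%:R + tz r.2 - lE r.1 * - conj (lE r.1) +
      conj (- (lE r.1 * conj (lE r.1)) / 2%:R + tz q.2)).
      rewrite conjK rmorphD !rmorphM rmorphN rmorphM fmorphV rmorph_nat /= conjK.
      by rewrite (up_conj_tz up); field.
    exact: pidealN.
  by case: q r qr1 qr2 {H Jqr e1 Jqr1 H01 h01 h02} => [q1 q2] [r1 r2] /= -> ->.
- move=> q r.
  have [|||t [bt ct]] := uN_rep (b := lE q.1 + lE r.1)
    (c := cN q + cN r - lE q.1 * conj (lE r.1)).
  + exact: pidealD.
  + apply: pidealB; first by apply: pidealD; exact: cNo.
    by apply: pidealM (lEo _) (up_pconj up (lEo _)) _.
  + have := cN_rel q; have := cN_rel r => Er Eq.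
    move: (cN q) (cN r) (lE q.1) (lE r.1) Er Eq => cq cr lq lr Er Eq.
    rewrite !(rmorphD, rmorphN, rmorphM) /= conjK.
    transitivity ((cq + conj cq + lq * conj lq) + (cr + conj cr + lr * conj lr)).
      by ring.
    by rewrite Er Eq addr0.
  exists t.
  have J1t : J1 (invmx (uN t) *m (uN q *m uN r)).
    apply: (subgroupM (J1_subgroup)); first exact: (subgroupV (J1_subgroup)) (uN_J1 _).
    exact: (subgroupM J1_subgroup (uN_J1 _) (uN_J1 _)).
  apply: J1_congK0 => //.
  have [-> _ _] := uV_mul t (uN q *m uN r) i2.
  rewrite /uN upp_mul !mxE /= mulr1.
  set b := lE q.1 + lE r.1 in bt *; set c := cN q + cN r - _ in ct *.
  have bt' := up_pconj up bt; have ct' := up_pconj up ct.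
  have lo := lEo t.1; have lo' := up_pconj up lo; have tr := cN_rel t.
  have -> : c - lE t.1 * - conj b + conj (cN t) =
    - (cN t - c) - lE t.1 * conj (lE t.1 - b)
    + (cN t + conj (cN t) + lE t.1 * conj (lE t.1)).
    by rewrite rmorphB /=; ring.
  by rewrite tr addr0; pid.
- move=> i r r' q q' Ji.
  have Jl a b : J (invmx (uN a) *m (i *m uN b)).
    by apply: (subgroupM Jg); [exact: subgroupV Jg (uJ _)|exact: subgroupM Jg Ji (uJ _)].
  move=> /(J_bJb (Jl _ _)) H1 /(J_bJb (Jl _ _)) H2.
  apply: J1_congK0; first exact: J1_diag (uN_J1 _) (uN_J1 _) (uN_J1 _) (uN_J1 _) Ji.
  have Jm := subgroupM Jg (subgroupV Jg (Jl r' r)) (Jl q' q).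
  apply/(J_bJb Jm).
  set l := invmx (uN r') *m (i *m uN r); set l' := invmx (uN q') *m (i *m uN q).
  have lU := subgroup_unit Jg (Jl r' r).
  rewrite (involution_conj_quot l' (beta_beta E) lU).
  exact: subgroupM Jg (subgroupV Jg (JbJ _ (Jl _ _) H1)) (JbJ _ (Jl _ _) H2).
Qed.

End RankOneInstances.

(** * The tree *)

Section Tree.
Implicit Types m n : int.

(* The Bruhat-Tits tree: the vertices are the cosets K1 g and K0 g, the edges
   the cosets J g.  [inX m g] says that the vertex K1 g is at distance at most
   2m from the vertex K1, and [inZ m g] that K0 g is at distance at most
   2m - 1 from it. *)
Definition inX m g : Prop :=
  forall i j, pideal v ((j == i0)%:Z - m - (i == i0)%:Z) (g i j).
Definition inZ m g : Prop := forall i j, pideal v ((j == i0)%:Z - m) (g i j).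

Lemma inX_le m n g : inX m g -> m <= n -> inX n g.
Proof. by move=> H mn i j; apply: pideal_le (H i j) _; lia. Qed.

Lemma inXZ m g : inX m g -> inZ (m + 1) g.
Proof. by move=> H i j; apply: pideal_le (H i j) _; case: (i == i0); lia. Qed.

Lemma inZX m g : inZ m g -> inX m g.
Proof. by move=> H i j; apply: pideal_le (H i j) _; case: (i == i0); lia. Qed.

Lemma inX_mul m k0 g : Kp k0 -> inX m g -> inX m (k0 *m g).
Proof.
move=> /KpE[_ ko] H i j; rewrite mulmx3.
have aux l : pideal v ((j == i0)%:Z - m - (i == i0)%:Z) (k0 i l * g l j).
  apply: pidealM (ko i l) (H l j) _; move: l i; apply: ord3P; apply: ord3P => /=; lia.
by do !apply: pidealD.
Qed.

Lemma inZ_mul m k0 g : K0 k0 -> inZ m g -> inZ m (k0 *m g).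
Proof.
move=> /K0E[_ ko] H i j; rewrite mulmx3.
have aux l : pideal v ((j == i0)%:Z - m) (k0 i l * g l j).
  by apply: pidealM (ko i l) (H l j) _; lia.
by do !apply: pidealD.
Qed.

Lemma inX_Kp k0 : Kp k0 -> inX 0 k0.
Proof.
move=> /KpE[_ ko] i j; apply: pideal_le (ko i j) _.
by move: i j; apply: ord3P; apply: ord3P.
Qed.

Lemma inZ_K0 k0 : K0 k0 -> inZ 1 k0.
Proof.
move=> /K0E[_ ko] i j; apply: pideal_le (ko i j) _.
by move: i j; apply: ord3P; apply: ord3P.
Qed.

(** For [m] at most 0 every product in the relation between the first and the last column would lie
    in the maximal ideal, while their sum is 1. *)
Lemma inZ_gt0 m g : G g -> inZ m g -> 0 < m.
Proof.
move=> gG H; rewrite ltNge; apply/negP => m0.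
apply: (@pideal_lt1 E v 1) => //.
have c02 : g i0 i0 * conj (g i2 i2) + g i1 i0 * conj (g i1 i2) +
  g i2 i0 * conj (g i0 i2) = 1 := unitary_col i0 i2 gG.
rewrite -c02.
entries H => g00 g01 g02 g10 g11 g12 g20 g21 g22.
have := (up_pconj up g22, up_pconj up g12, up_pconj up g02) => -[[c22 c12] c02'].
by do !apply: pidealD; eapply pidealM; try eassumption; lia.
Qed.

Lemma inX_ge0 m g : G g -> inX m g -> 0 <= m.
Proof. by move=> gG /inXZ/(inZ_gt0 gG); lia. Qed.

(* A vertex K0 g has at most one neighbour closer to the origin. *)
Lemma tree_outX m g k0 : inX m g -> ~ inZ m g -> K0 k0 -> ~ J k0 ->
  ~ inX m (k0 *m g).
Proof.
move=> gX gnZ kK nJ kgX; apply: gnZ.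
have [v20 n20] := K0_notJ kK nJ.
have [_ ko] := proj1 (K0E _ _ _) kK.
(* Outside J the entry [k0 i2 i0] is a unit, so the last row of the product can be solved for the
   first row of [g]. *)
have row0 j : pideal v ((j == i0)%:Z - m) (g i0 j).
  apply/(pideal_unitM _ _ n20 v20).
  have -> : k0 i2 i0 * g i0 j = (k0 *m g) i2 j - k0 i2 i1 * g i1 j - k0 i2 i2 * g i2 j.
    by rewrite mulmx3; ring.
  have H := kgX i2 j; have H1 := gX i1 j; have H2 := gX i2 j; rewrite /= !subr0 in H H1 H2.
  have k1 := ko i2 i1; have k2 := ko i2 i2.
  apply: pidealB; first apply: pidealB => //.
    by apply: pidealM k1 H1 _; lia.
  by apply: pidealM k2 H2 _; lia.
move=> i j; move: i; apply: ord3P; first exact: row0.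
  by have := gX i1 j; rewrite /= subr0.
by have := gX i2 j; rewrite /= subr0.
Qed.

(* A vertex K1 g has at most one neighbour closer to the origin. *)
Lemma tree_outZ m g k0 : G g -> inZ m g -> ~ inX (m - 1) g -> Kp k0 -> ~ J k0 ->
  ~ inZ m (k0 *m g).
Proof.
move=> gG gZ gnX kK nJ kgZ; apply: gnX.
have m0 := inZ_gt0 gG gZ.
have [v02 n02] := Kp_notJ kK nJ.
have [_ ko] := KpE kK.
have row2 j : pideal v ((j == i0)%:Z - m + 1) (g i2 j).
  have -> : g i2 j = (k0 i0 i2)^-1 * ((k0 *m g) i0 j - k0 i0 i0 * g i0 j - k0 i0 i1 * g i1 j).
    by rewrite mulmx3; field.
  have H := kgZ i0 j; have H0 := gZ i0 j; have H1 := gZ i1 j.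
  have k00 := ko i0 i0; have k01 := ko i0 i1; rewrite /= in k00 k01.
  have kV : pideal v 1 (k0 i0 i2)^-1 by right; rewrite dvalV// v02.
  apply: (pidealM kV (n := (j == i0)%:Z - m)); last by lia.
  apply: pidealB; first apply: pidealB => //.
    by apply: pidealM k00 H0 _; lia.
  by apply: pidealM k01 H1 _; lia.
(* The middle row is not reached by a linear equation; the relation satisfied by each column bounds
   its norm. The middle column has norm 1 instead of 0, which does no harm because [m] is
   positive. *)
have row1 j : pideal v ((j == i0)%:Z - m + 1) (g i1 j).
  have cj := unitary_col j j gG; have H0 := gZ i0 j; have H2 := row2 j.
  have H := pidealM H0 (up_pconj up H2) (lexx _).
  case: (eqVneq j i1) => [j1|j1].
    rewrite j1 /= in cj H *.
    apply: (norm_pideal (m := 1 - 2%:Z * m)); last by lia.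
    have -> : g i1 i1 * conj (g i1 i1) = 1 - g i0 i1 * conj (g i2 i1)
        - conj (g i0 i1 * conj (g i2 i1)).
      rewrite rmorphM /= (up_conjK up) -[1]cj.
      by rewrite [in RHS]mulrC; ring.
    apply: pidealB; first apply: pidealB.
    + by apply: pideal_le (pideal1 v) _; lia.
    + by apply: pideal_le H _; lia.
    + by apply: (up_pconj up); apply: pideal_le H _; lia.
  have rj : (j == rev_ord j) = false.
    by move: j j1 {cj H0 H2 H}; apply: ord3P.
  rewrite rj in cj.
  apply: (isotropic_pideal cj H).
  by move: j j1 {cj H0 H2 H rj}; apply: ord3P => //= _; lia.
move=> i j; move: i; apply: ord3P => /=.
- by apply: pideal_le (gZ i0 j) _; lia.
- by apply: pideal_le (row1 j) _; lia.
- by apply: pideal_le (row2 j) _; lia.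
Qed.

Lemma inX_exists (n : nat) (a : 'I_n -> 'M[E]_3) :
  exists m : nat, forall i, inX m%:Z (a i).
Proof.
have ex1 g : exists m : nat, inX m%:Z g.
  exists (\sum_i \sum_j `|v (g i j)|%N).+1 => i j.
  have [->|n0] := eqVneq (g i j) 0; first by left.
  right; rewrite (bigD1 i)//= (bigD1 j)//=.
  by case: (j == i0); case: (i == i0); lia.
have [m mP] := choice (fun i => ex1 (a i)).
exists (\max_i m i)%N => i; apply: inX_le (mP i) _.
by rewrite lez_nat; exact: leq_bigmax.
Qed.

End Tree.

(** * Topology of matrices and compact sets *)

Section Topology.
Implicit Types m n : int.

Definition close n M M' : Prop := forall i j, pideal v n (M i j - M' i j).

Lemma close_refl n M : close n M M.
Proof. by move=> i j; rewrite subrr; left. Qed.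

Lemma close_sym n M M' : close n M M' -> close n M' M.
Proof. by move=> H i j; rewrite -opprB; exact: pidealN. Qed.

Lemma close_trans n M1 M2 M3 : close n M1 M2 -> close n M2 M3 -> close n M1 M3.
Proof. by move=> H H' i j; rewrite -(subrKA (M2 i j)); exact: pidealD. Qed.

Lemma close_le m n M M' : close n M M' -> m <= n -> close m M M'.
Proof. by move=> H mn i j; exact: pideal_le (H i j) mn. Qed.

Lemma entries_bounded M : exists m : nat, forall i j, pideal v (- m%:Z) (M i j).
Proof.
exists (\sum_i \sum_j `|v (M i j)|%N)%N => i j.
have [->|n0] := eqVneq (M i j) 0; first by left.
by right; rewrite (bigD1 i)//= (bigD1 j)//=; lia.
Qed.

Lemma mx_nbhsP (M : 'M[vtop v]_3) (A : set 'M[vtop v]_3) :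
  nbhs M A <-> exists n, forall M' : 'M[vtop v]_3,
    close n (M : 'M[E]_3) (M' : 'M[E]_3) -> A M'.
Proof.
split=> [[P HP PA]|[n nA]].
  have /choice [f fP] : forall ij : 'I_3 * 'I_3, exists n, forall y : vtop v,
      pideal v n ((M ij.1 ij.2 : E) - (y : E)) -> P ij.1 ij.2 y.
    by move=> [i j]; apply/vtop_nbhsP; exact: HP.
  exists (\sum_i \sum_j `|f (i, j)|%N)%N => M' MM'; apply: PA => i j.
  apply: (fP (i, j)); apply: pideal_le (MM' i j) _.
  by rewrite (bigD1 i)//= (bigD1 j)//=; lia.
exists (fun i j => [set y : vtop v | pideal v n ((M i j : E) - (y : E))]).
  by move=> i j; apply/vtop_nbhsP; exists n.
by move=> M' HM'; apply: nA => i j; exact: HM'.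
Qed.

Lemma mx_rel_openP (A B : set 'M[E]_3) : B `<=` A ->
  mx_rel_open v A B <->
  forall b, B b -> exists n, forall a, A a -> close n b a -> B a.
Proof.
move=> BA; split=> [[U Uopen BE] b Bb|H].
  have Ub : U b by move: Bb; rewrite BE => -[].
  have : nbhs (b : 'M[vtop v]_3) U by apply: open_nbhs_nbhs; split.
  move=> /mx_nbhsP[n nU]; exists n => a Aa ba.
  by rewrite BE; split => //; exact: nU.
exists [set x : 'M[vtop v]_3 | exists b n, [/\ B b,
    forall a, A a -> close n b a -> B a & close n b (x : 'M[E]_3)]]; last first.
  rewrite predeqE => b; split=> [Bb|[Ab [b' [n [_ nA nb]]]]]; last exact: nA nb.
  split; first exact: BA.
  by have [n nA] := H b Bb; exists b, n; split => //; exact: close_refl.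
rewrite openE => x [b [n [Bb nA nb]]]; apply/mx_nbhsP; exists n => M' xM'.
by exists b, n; split => //; exact: close_trans nb xM'.
Qed.

Lemma close_mul n m g M M' : (forall i j, pideal v (- m) (g i j)) ->
  close n M M' -> close (n - m) (g *m M) (g *m M').
Proof.
move=> gm MM' i j; rewrite !mulmx3.
have -> : g i i0 * M i0 j + g i i1 * M i1 j + g i i2 * M i2 j -
  (g i i0 * M' i0 j + g i i1 * M' i1 j + g i i2 * M' i2 j) =
  g i i0 * (M i0 j - M' i0 j) + g i i1 * (M i1 j - M' i1 j)
  + g i i2 * (M i2 j - M' i2 j) by ring.
have aux l : pideal v (n - m) (g i l * (M l j - M' l j)).
  by apply: pidealM (gm i l) (MM' l j) _; lia.
by do !apply: pidealD.
Qed.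

Lemma close_mulr n m g M M' : (forall i j, pideal v (- m) (g i j)) ->
  close n M M' -> close (n - m) (M *m g) (M' *m g).
Proof.
move=> gm MM' i j; rewrite !mulmx3.
have -> : M i i0 * g i0 j + M i i1 * g i1 j + M i i2 * g i2 j -
  (M' i i0 * g i0 j + M' i i1 * g i1 j + M' i i2 * g i2 j) =
  (M i i0 - M' i i0) * g i0 j + (M i i1 - M' i i1) * g i1 j
  + (M i i2 - M' i i2) * g i2 j by ring.
have aux l : pideal v (n - m) ((M i l - M' i l) * g l j).
  by apply: pidealM (MM' i l) (gm l j) _; lia.
by do !apply: pidealD.
Qed.

Lemma smooth_vectorP (X : Type) (A : set 'M[E]_3) (r : 'M[E]_3 -> X -> X) (x : X) :
  subgroup A -> (forall g h y, A g -> A h -> r (g *m h) y = r g (r h y)) ->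
  r 1%:M x = x ->
  smooth_vector v A r x <->
  exists n, forall g, A g -> close n 1%:M g -> r g x = x.
Proof.
move=> Ag rM r1; rewrite /smooth_vector mx_rel_openP; last by move=> g [].
split=> [H|[n nr] b [Ab rb]].
  have [|n nA] := H 1%:M; first by split; [exact: subgroup1|].
  by exists n => g gA /(nA g gA)[].
have [m bm] := entries_bounded (invmx b).
exists (n + m%:Z) => a Aa ba; split => //.
have bU := subgroup_unit Ag Ab.
rewrite -[a](mulKVmx bU) rM//; last first.
  by apply: (subgroupM Ag) => //; exact: subgroupV.
rewrite nr//; first by apply: (subgroupM Ag) => //; exact: subgroupV.
by have := close_mul bm ba; rewrite mulVmx// addrK.
Qed.

Lemma exists_dval m : exists2 t : E, t != 0 & v t = m.
Proof.
have vwn (n : nat) : v (w ^+ n) = n%:Z.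
  elim: n => [|n IH]; first by rewrite expr0 dval1.
  by rewrite exprS dvalM ?expf_neq0 ?(up_w0 up)// IH (up_vw up); lia.
have wn0 (n : nat) : w ^+ n != 0 by rewrite expf_neq0// (up_w0 up).
case: m => n; first by exists (w ^+ n).
by exists (w ^+ n.+1)^-1; rewrite ?invr_eq0// dvalV// vwn; lia.
Qed.

Let ultra_cover (T : Type) (F : set_system T) (I : finType) (B : set T) (D : I -> set T) :
  UltraFilter F -> F B -> (forall x, B x -> exists i, D i x) -> exists i, F (D i).
Proof.
move=> FU FB BD; have FP : ProperFilter F by exact: ultra_proper.
apply: contrapT => /forallNP nD.
have FD : F (\bigcap_i ~` D i).
  have : forall i, F (~` D i) by move=> i; case: (in_ultra_setVsetC (D i) FU) => // /nD.
  move=> /filter_forall H; have FF : Filter F by apply: filter_filter.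
  by apply: (filterS _ H) => x Hx i _; exact: Hx.
have [x [Bx Dx]] := filter_ex (filterI FB FD).
by have [i Di] := BD x Bx; by apply: (Dx i).
Qed.

(** A ball belonging to the ultrafilter splits into finitely many balls of the next radius, one of
    which belongs to it again; the centres converge by completeness, and the limit inherits the
    unitary relations. *)
Lemma bounded_compact (m : nat) :
  mx_compact v [set g | G g /\ forall i j, pideal v (- m%:Z) (g i j)].
Proof.
rewrite /mx_compact compact_ultra => F FU FS.
have FP : ProperFilter F by exact: ultra_proper.
have ball (n : nat) : exists A : 'M[E]_3, F [set g | close (n%:Z - m%:Z) (g : 'M[E]_3) A].
  elim: n => [|n [A FA]].
    exists 0; apply: filterS FS => g [_ gm] i j.
    by rewrite mxE subr0 sub0r; exact: gm.
  have [t t0 vt] := exists_dval (n%:Z - m%:Z).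
  pose code (g : 'M[E]_3) : 'M[k * k]_3 := \matrix_(i, j) rE (t^-1 * (g i j - A i j)).
  have [g _|c Fc] := ultra_cover (D := fun c => [set g | code g = c]) FU FA.
    by exists (code g).
  exists (\matrix_(i, j) (A i j + t * lE (c i j))).
  apply: filterS (filterI FA Fc) => g [gA gc] i j; rewrite mxE.
  have io : pideal v 0 (t^-1 * (g i j - A i j)).
    apply: (pidealM (m := - (n%:Z - m%:Z)) _ (gA i j)); last by lia.
    by right; rewrite dvalV// vt.
  have c1 : pideal v 1 (t^-1 * (g i j - A i j) - lE (c i j)).
    apply/(up_rE up) => //; first exact: up_lEo up _.
    by rewrite (up_lEK up) -gc mxE.
  have -> : (g : 'M[E]_3) i j - (A i j + t * lE (c i j)) =
     t * (t^-1 * (g i j - A i j) - lE (c i j)).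
    by rewrite mulrBr mulVKf// opprD addrA.
  have tm : pideal v (n%:Z - m%:Z) t by right; rewrite vt.
  by apply: pidealM tm c1 _; lia.
have [A FA] := choice ball.
have /choice [L HL] : forall ij : 'I_3 * 'I_3, exists l, forall n : nat,
    pideal v n%:Z (l - A (n + m)%N ij.1 ij.2).
  move=> [i j]; apply: (up_complete up) => n /=.
  have [g [gA gA']] := filter_ex (filterI (FA (n + m)%N) (FA (n.+1 + m)%N)).
  rewrite -(subrKA ((g : 'M[E]_3) i j)); apply: pidealD.
    by rewrite -opprB; apply: pidealN; apply: pideal_le (gA' i j) _; lia.
  by apply: pideal_le (gA i j) _; lia.
pose l : 'M[E]_3 := \matrix_(i, j) L (i, j).
have Fl (n : nat) : F [set g | close n%:Z l (g : 'M[E]_3)].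
  apply: filterS (FA (n + m)%N) => g gA i j; rewrite mxE.
  rewrite -(subrKA (A (n + m)%N i j)); apply: pidealD; first exact: (HL (i, j)).
  by rewrite -opprB; apply: pidealN; apply: pideal_le (gA i j) _; lia.
have lb i j : pideal v (- m%:Z) (l i j).
  have [g [[_ gm] lg]] := filter_ex (filterI FS (Fl 0%N)).
  rewrite -(subrK ((g : 'M[E]_3) i j) (l i j)); apply: pidealD => //.
  by apply: pideal_le (lg i j) _; lia.
exists (l : 'M[vtop v]_3); split; last first.
  move=> U /mx_nbhsP[n nU]; apply: filterS (Fl `|n|%N) => g lg.
  by apply: nU; apply: close_le lg _; lia.
split => //; apply/unitaryE; apply/mx3P => i j.
apply/eqP; rewrite -subr_eq0; apply/eqP; apply: pideal_all => n.
have [g [[gG gm] lg]] := filter_ex (filterI FS (Fl (n + m)%N)).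
move/unitaryE/matrixP/(_ i j): gG => <-.
rewrite ![(_ *m beta E *m _) i j]mulmx3 !mulmxbeta !rev3 !mxE.
have aux a b : pideal v n%:Z (l a i * conj (l b j) - (g : 'M[E]_3) a i * conj ((g : 'M[E]_3) b j)).
  have -> : l a i * conj (l b j) - (g : 'M[E]_3) a i * conj ((g : 'M[E]_3) b j) =
    (l a i - (g : 'M[E]_3) a i) * conj (l b j)
    + (g : 'M[E]_3) a i * conj (l b j - (g : 'M[E]_3) b j) by rewrite rmorphB /=; ring.
  apply: pidealD.
    by apply: pidealM (lg a i) (up_pconj up (lb b j)) _; lia.
  by apply: pidealM (gm a i) (up_pconj up (lg b j)) _; lia.
have := pidealD (pidealD (aux i2 i0) (aux i1 i1)) (aux i0 i2).
rewrite ![l _ _]mxE; congr (pideal v _ _); ring.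
Qed.

Lemma close_Kp x : G x -> exists n, forall g, G g -> close n x g -> Kp (g *m invmx x).
Proof.
move=> xG; have [m xm] := entries_bounded (invmx x).
exists (1 + m%:Z) => g gG xg.
have gxG : G (g *m invmx x).
  by apply: unitary_mul => //; apply: unitary_invmx => //; exact: up_conjK up.
have xU : x \in unitmx by case: xG.
split => // i j; have := close_sym (close_mulr xm xg) i j.
rewrite mulmxV// addrK => H.
have -> : (g *m invmx x) i j = ((g *m invmx x) i j - 1%:M i j) + 1%:M i j by rewrite subrK.
apply: pi2D; last exact: gr1.
by apply: (pideal_pi2 H); move: i j {H}; apply: ord3P; apply: ord3P.
Qed.

(** Otherwise the complements of finite unions of cosets generate a filter; an ultrafilter
    containing it converges to some x in [S], but the coset of x is a neighbourhood of x that has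
    been removed. *)
Lemma compact_cosets (S : set 'M[E]_3) : S `<=` G -> mx_compact v S ->
  exists l : seq 'M[E]_3, (forall a, a \in l -> G a) /\
    forall g, S g -> exists2 a, a \in l & Kp (g *m invmx a).
Proof.
move=> SG; rewrite /mx_compact compact_ultra => Sc; apply: contrapT => nl.
pose rest (l : seq 'M[E]_3) : set 'M[vtop v]_3 :=
  [set g | S g /\ forall a, a \in l -> ~ Kp ((g : 'M[E]_3) *m invmx a)].
pose F0 : set_system 'M[vtop v]_3 :=
  [set A | exists l : seq 'M[E]_3, (forall a, a \in l -> G a) /\ rest l `<=` A].
have F0P : ProperFilter F0.
  apply: Build_ProperFilter_ex.
    move=> A [l [lG lA]]; apply: contrapT => nA; apply: nl; exists l; split => // g Sg.
    apply: contrapT => ng; apply: nA; exists g; apply: lA; split => // a al Ka.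
    by apply: ng; exists a.
  split; first by exists [::].
    move=> A B [l [lG lA]] [l' [lG' lB]]; exists (l ++ l'); split.
      by move=> a; rewrite mem_cat => /orP[/lG|/lG'].
    move=> g [Sg gl]; split; [apply: lA|apply: lB]; split => // a al;
      by apply: gl; rewrite mem_cat al ?orbT.
  by move=> A B AB [l [lG lA]]; exists l; split => //; exact: subset_trans lA AB.
have [F [FU F0F]] := ultraFilterLemma F0P.
have FP : ProperFilter F by exact: ultra_proper.
have FS : F S by apply: F0F; exists [::]; split => // g [].
have [x [Sx Fx]] := Sc F FU FS.
have [n nK] := close_Kp (SG _ Sx).
have Fb : F [set g | close n (x : 'M[E]_3) (g : 'M[E]_3)] by apply: Fx; apply/mx_nbhsP; exists n.
have Fr : F (rest [:: (x : 'M[E]_3)]).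
  by apply: F0F; exists [:: (x : 'M[E]_3)]; split => // a; rewrite inE => /eqP ->; exact: SG.
have [g [xg [Sg gx]]] := filter_ex (filterI Fb Fr).
by apply: (gx x); [exact: mem_head|apply: nK => //; exact: SG].
Qed.

End Topology.

Let KM g h : Kp g -> Kp h -> Kp (g *m h). Proof. exact: subgroupM Kg. Qed.
Let KV g : Kp g -> Kp (invmx g). Proof. exact: subgroupV Kg. Qed.
Let K0M g h : K0 g -> K0 h -> K0 (g *m h). Proof. exact: subgroupM K0g. Qed.
Let K0V g : K0 g -> K0 (invmx g). Proof. exact: subgroupV K0g. Qed.
Let JM g h : J g -> J h -> J (g *m h). Proof. exact: subgroupM Jg. Qed.
Let JV g : J g -> J (invmx g). Proof. exact: subgroupV Jg. Qed.
Let GM g h : G g -> G h -> G (g *m h). Proof. exact: unitary_mul. Qed.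
Let GV g : G g -> G (invmx g). Proof. exact: unitary_invmx. Qed.
Let GU g : G g -> g \in unitmx. Proof. by case. Qed.
Let KG g : Kp g -> G g. Proof. by case. Qed.
Let K0G g : K0 g -> G g. Proof. by case. Qed.
Let JK g : J g -> Kp g. Proof. by case. Qed.
Let JK0 g : J g -> K0 g. Proof. by case. Qed.
Let J1K g : J1 g -> Kp g. Proof. by case=> -[]. Qed.
Let uKp a : Kp (uK a). Proof. by case: (uK_J1 a) => -[]. Qed.
Let sK : Kp s. Proof. exact: s_Kp. Qed.
Let bK0 : K0 bt. Proof. exact: beta_K0. Qed.
Let bG : G bt. Proof. exact: beta_unitary. Qed.
Let bV : invmx bt = bt. Proof. exact: invmx_eq (beta_beta E). Qed.

(** * Factorizations in J and K1 *)

Section Gauss.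

Definition diag3 (a b c : E) : 'M[E]_3 :=
  mx3 0 [:: [:: a; 0; 0]; [:: 0; b; 0]; [:: 0; 0; c]].

Lemma is_diag_diag3 a b c : is_diag_mx (diag3 a b c).
Proof.
apply/is_diag_mxP => i j; rewrite mxE; move: i j.
by apply: ord3P; apply: ord3P.
Qed.

Lemma diag3_unitary a b c : a * conj c = 1 -> b * conj b = 1 -> G (diag3 a b c).
Proof.
move=> ac bb; have ca : c * conj a = 1 by rewrite -(conjK c) -rmorphM mulrC ac rmorph1.
apply/unitaryE; apply/mx3P => i j.
rewrite mulmx3 !mulmxbeta !rev3 betaE !mxE; move: i j.
by apply: ord3P; apply: ord3P; rewrite /= ?rmorph0 ?simp01.
Qed.

Lemma det_upper (t : 'M[E]_3) : t i1 i0 = 0 -> t i2 i0 = 0 -> t i2 i1 = 0 ->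
  \det t = t i0 i0 * t i1 i1 * t i2 i2.
Proof.
move=> t10 t20 t21; rewrite -det_tr det_trig.
  by rewrite !big_ord_recl big_ord0 mulr1 mulrA !mxE; congr (_ * _ * _);
    congr (t _ _); exact: val_inj.
apply/is_trig_mxP => i j; rewrite mxE; move: i j.
by apply: ord3P; apply: ord3P.
Qed.

Lemma det_low (c : E) : \det (low c) = 1.
Proof.
by rewrite -det_tr det_upper ?mxE//= !mulr1.
Qed.

Lemma det_beta_sq : \det bt * \det bt = 1.
Proof. by rewrite -det_mulmx beta_beta det1. Qed.

Lemma det_upp b c : \det (upp b c) = 1.
Proof. by rewrite det_upper ?mxE//= !mulr1. Qed.

Lemma det_s : \det s = \det bt.
Proof.
have -> : \det bt = \det s * \det (alpha w) by rewrite -det_mulmx -s_alpha.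
by rewrite (det_upper (t := alpha w)) ?mxE//= mulr1 mulVf ?mulr1 ?(up_w0 up).
Qed.

Lemma det_norm_one g : G g -> norm_one conj (\det g).
Proof.
move=> /unitaryE /(congr1 determinant); rewrite !det_mulmx det_tr det_map_mx.
have b0 : \det bt != 0 by apply: contra_eq_neq det_beta_sq => ->; rewrite mul0r eq_sym oner_eq0.
rewrite mulrAC => /(congr1 (fun x => x / \det bt)); rewrite divff// mulfK//.
Qed.

(* The diagonal factor is exactly unitary and has the determinant of j: there is
   nothing to lift from the residue field. *)
Lemma J_gauss j : J j -> exists l h u,
  [/\ J1 l, J h /\ is_diag_mx h, J1 u, j = l *m (h *m u) & \det j = \det h].
Proof.
move=> jJ; have [jG jo] := proj1 (JE _) jJ.
have [[va a0] _] := J_unit jJ.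
have ca0 : conj (j i0 i0) != 0 by rewrite fmorph_eq0.
pose x := j i1 i0 / j i0 i0; pose z := j i2 i0 / j i0 i0.
have aV : pideal v 0 (j i0 i0)^-1 by right; rewrite dvalV// va.
have xo : pideal v 1 x by apply: pidealM (jo i1 i0) aV _.
have zo : pideal v 1 z by apply: pidealM (jo i2 i0) aV _.
have xa : x * j i0 i0 = j i1 i0 by rewrite divfK.
have za : z * j i0 i0 = j i2 i0 by rewrite divfK.
have zx : z + conj z + x * conj x = 0.
  have := unitary_col i0 i0 jG; rewrite rev3 -xa -za !rmorphM/= => H.
  apply: (mulIf (mulf_neq0 a0 ca0)); rewrite mul0r -[RHS]H; ring.
(* Chosen so that the [bt]-conjugate of [upp b z] has first column (1, x, z), the first column of
   [j] divided by its top entry. *)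
pose b := - conj x.
have bb : z + conj z + b * conj b = 0.
  by rewrite /b rmorphN conjK mulrNN [conj x * x]mulrC.
have uG := upp_unitary bb.
set n := upp b z in uG.
pose l := bt *m n *m bt.
have lij i i' : l i i' = n (rev_ord i) (rev_ord i') by rewrite /l beta_conj.
have lG : G l by apply: GM => //; exact: GM.
have lJ : J l.
  apply/JE; split=> // i i'; rewrite lij mxE; move: i i'.
  apply: ord3P; apply: ord3P; rewrite ?rev3 /= ?rmorphN ?conjK ?opprK;
    try exact: pideal1; try (by left); try exact: xo; try exact: zo.
  by rewrite /b; apply: pidealN; exact: (up_pconj up).
have l1 : J1 l.
  split => // i; rewrite lij mxE; move: i.
  by apply: ord3P; rewrite ?rev3 /= subrr; left.
pose t := invmx l *m j.
have tJ : J t by apply: JM => //; exact: JV.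
have tG : G t by case: tJ => /KG.
have tE i i' : t i i' = (invmx n *m (bt *m j)) (rev_ord i) i'.
  have bU := GU bG; have nU := GU uG.
  rewrite /t /l (invmxM _ bU) ?(invmxM bU nU) ?bV ?unitmx_mul ?bU// -!mulmxA.
  by rewrite mulbeta.
have t10 : t i1 i0 = 0.
  rewrite tE rev3; have [_ -> _] := uppV_mul (bt *m j) i0 bb.
  by rewrite !mulbeta !rev3 /b rmorphN conjK mulNr xa subrr.
have t20 : t i2 i0 = 0.
  rewrite tE rev3; have [-> _ _] := uppV_mul (bt *m j) i0 bb.
  rewrite !mulbeta !rev3 /b -xa -za.
  have -> : 0 = (z + conj z + x * conj x) * j i0 i0 by rewrite zx mul0r.
  by ring.
have c02 := unitary_col i0 i2 tG.
rewrite t10 t20 !rev3 eqxx /= !mul0r !addr0 in c02.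
have t00 : t i0 i0 != 0 by apply: contra_eq_neq c02 => ->; rewrite mul0r eq_sym oner_eq0.
have t21 : t i2 i1 = 0.
  have := unitary_col i0 i1 tG; rewrite t10 t20 !rev3 /= !mul0r !addr0 => /eqP.
  by rewrite mulf_eq0 (negPf t00) fmorph_eq0 => /eqP.
have c11 := unitary_col i1 i1 tG.
rewrite t21 !rev3 rmorph0 mulr0 mul0r add0r addr0 eqxx /= in c11.
pose h := diag3 (t i0 i0) (t i1 i1) (t i2 i2).
have hG : G h by exact: diag3_unitary.
have hE : forall i, h i i = t i i by apply: ord3P; rewrite mxE.
have hJ : J h.
  apply/JE; split => // i i'.
  have [->|ii'] := eqVneq i i'; first by rewrite ltnn hE; exact: J_oii tJ.
  by left; have /is_diag_mxP := is_diag_diag3 (t i0 i0) (t i1 i1) (t i2 i2); exact.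
exists l, h, (invmx h *m t); split => //.
- by split => //; exact: is_diag_diag3.
- by apply: J1_quot => // i; rewrite hE subrr; left.
- by rewrite mulKVmx ?GU// /t mulKVmx ?GU.
have -> : \det j = \det l * \det t by rewrite -det_mulmx mulKVmx// GU.
have -> : \det l = 1 by rewrite !det_mulmx det_upp mulr1 det_beta_sq.
by rewrite mul1r (det_upper t10 t20 t21) [RHS]det_upper ?mxE.
Qed.

Lemma exists_odd_unit : exists t, [/\ t != 0, v t = 0 & conj t = - t].
Proof.
have nt : ~ pideal v 1 (tz 1).
  rewrite -(subr0 (tz 1)) -(up_tz0 up) => /(up_tz_inj up)/eqP.
  by rewrite oner_eq0.
have t0 : tz 1 != 0 by apply/eqP => t0; apply: nt; rewrite t0; left.
exists (tz 1); split => //; last exact: (up_conj_tz up).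
by apply: dval_eq0 nt => //; exact: (up_tzo up).
Qed.

(* This relation determines the value at s of a character of K1 that factors
   through the determinant on the diagonal matrices. *)
Lemma s_relation : exists l l' h, [/\ J1 l /\ J1 l', J h /\ is_diag_mx h, \det h = \det s &
  s *m l *m s = l' *m (h *m s) *m l'].
Proof.
have [t [t0 vt ct]] := exists_odd_unit.
have w00 := up_w0 up.
have J1low c : c + conj c = 0 -> pideal v 1 c -> J1 (low c).
  move=> cc c1; split; last by apply: ord3P; rewrite mxE /= subrr; left.
  apply/JE; split; first exact: low_unitary.
  move=> i j; rewrite mxE; move: i j; apply: ord3P; apply: ord3P => /=;
    by [exact: pideal1|left|].
have w1 : pideal v 1 w := wo (lexx _).
have to : pideal v 0 t by right; rewrite vt.
have tVo : pideal v 0 t^-1 by right; rewrite dvalV// vt.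
(* The identity of SL(2) that writes a unipotent matrix as a monomial matrix between two opposite
   unipotents holds inside the unitary group when [conj t = - t]. *)
pose h := diag3 t 1 (- t^-1).
have hG : G h.
  apply: diag3_unitary; last by rewrite rmorph1 mulr1.
  by rewrite rmorphN fmorphV ct invrN opprK divff.
have hJ : J h.
  apply/JE; split => // i j; rewrite mxE; move: i j.
  apply: ord3P; apply: ord3P => /=; try (by left); try exact: pideal1.
    by right; rewrite vt.
  by apply: pidealN; right; rewrite dvalV// vt.
have rel : s *m low (w * t) *m s = low (w / t) *m (h *m s) *m low (w / t).
  apply/mx3P => i j; rewrite mul_s_s mulmx3 !(mulmx3 (low _) (h *m s)) !(mulmx3 h s) !betaK1E !mxE; move: i j.
  by apply: ord3P; apply: ord3P => /=; field; rewrite ?w00 ?t0.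
exists (low (w * t)), (low (w / t)), h; split => //.
- split; apply: J1low.
  + by rewrite rmorphM/= (up_conjw up) ct mulrN subrr.
  + by apply: pidealM w1 to _.
  + by rewrite rmorphM fmorphV/= (up_conjw up) ct invrN mulrN subrr.
  + by apply: pidealM w1 tVo _.
- by split => //; exact: is_diag_diag3.
have s0 : \det s != 0.
  by rewrite det_s; apply: contra_eq_neq det_beta_sq => ->; rewrite mul0r eq_sym oner_eq0.
have := congr1 determinant rel; rewrite (det_mulmx (s *m _) s) (det_mulmx s) (det_mulmx _ (low (w / t))) (det_mulmx (low (w / t)) (h *m s)) (det_mulmx h s).
rewrite !det_low mulr1 mul1r mulr1.
by move=> H; apply/esym/(mulIf s0); exact: H.
Qed.

End Gauss.

Lemma beta_notJ : ~ J bt.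
Proof.
move=> /JE[_ /(_ i2 i0)]; rewrite betaE !rev3 eqxx => H.
exact: pideal_lt1 H.
Qed.

Lemma J_def g : J g <-> Kp g /\ K0 g.
Proof. by split=> [[]|[]]. Qed.

(** The vertex of [bt *m z] is farther out than that of [z], and the way back from it is unique at
    each of its two steps: leaving J at either step would push [bt *m y] or [y] beyond the distance
    it has. *)
Lemma beta_step m y z k0 : inX m y -> inX m z -> ~ inZ m z -> G z -> Kp k0 ->
  bt *m y = k0 *m (bt *m z) ->
  exists2 j, J j & [/\ J k0, y = j *m z & bt *m j = k0 *m bt].
Proof.
move=> ym zm nz zG kK yz.
have bzZ : inZ (m + 1) (bt *m z) by apply: (inZ_mul bK0); exact: inXZ.
have bzX : ~ inX m (bt *m z) by exact: (tree_outX zm nz bK0 beta_notJ).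
have kJ : J k0.
  apply: contrapT => nJ.
  have : ~ inZ (m + 1) (k0 *m (bt *m z)).
    apply: tree_outZ => //; first exact: GM.
    by rewrite addrK.
  by apply; rewrite -yz; apply: (inZ_mul bK0); exact: inXZ.
have yE : y = (bt *m k0 *m bt) *m z.
  by rewrite -!mulmxA -yz mulmxA beta_beta mul1mx.
have jK0 : K0 (bt *m k0 *m bt) by apply: K0M => //; apply: K0M => //; exact: JK0.
exists (bt *m k0 *m bt).
  apply: contrapT => nJ.
  by have := tree_outX zm nz jK0 nJ; rewrite -yE.
by split=> //; rewrite !mulmxA beta_beta mul1mx.
Qed.

(** * The weight *)

Section Weight.

Context (p : nat) (C : closedFieldType) (pk : p \in [pchar k]) (pC : p \in [pchar C]).
Context (V : lmodType C) (sigma : 'M[E]_3 -> {linear V -> V}).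
Hypothesis irr : irreducible_rep Kp sigma.
Hypothesis smooth : smooth_rep v Kp sigma.

Local Notation KK := (cong conj v gr_id).

Let KKn m : normal_subgroup (KK m) Kp.
Proof. by apply: cong_normal => //; exact: gr_id_sym. Qed.

Lemma sigma1 x : sigma 1%:M x = x.
Proof. by case: irr => -[]. Qed.

Lemma sigmaM g h x : Kp g -> Kp h -> sigma (g *m h) x = sigma g (sigma h x).
Proof. by case: irr => -[_ H] _ _; exact: H. Qed.

Lemma sigma_quot g h x : Kp g -> Kp h -> sigma (invmx g *m h) x = x ->
  sigma g x = sigma h x.
Proof.
move=> gK hK E1; have gU := subgroup_unit Kg gK.
rewrite -(mulKVmx gU h) sigmaM ?E1//.
by apply: (subgroupM Kg) => //; exact: subgroupV.
Qed.

Lemma iter_sigma g n x : Kp g -> iter n (sigma g) x = sigma (iter n (mulmx g) 1%:M) x.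
Proof.
move=> gK; elim: n => [|n IH]; first by rewrite sigma1.
rewrite !iterS IH sigmaM//; elim: (n) => [|m]; first exact: subgroup1.
by rewrite iterS; exact: subgroupM.
Qed.

Lemma iter_subgroup (A : set 'M[E]_3) g n : subgroup A -> A g -> A (iter n (mulmx g) 1%:M).
Proof.
move=> As Ag; elim: n => [|n IH]; first exact: subgroup1.
by rewrite iterS; exact: subgroupM.
Qed.

Lemma normal_fixed (N : set 'M[E]_3) x : N `<=` Kp ->
  (forall g n, Kp g -> N n -> N (g *m n *m invmx g)) -> (forall n, N n -> sigma n x = x) -> x != 0 ->
  forall n y, N n -> sigma n y = y.
Proof.
move=> NK Nn xN x0 n y nN.
apply: (@irreducible_all _ _ _ _ _ [set z | forall n, N n -> sigma n z = z] irr _ _ x xN x0 y n nN).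
- by move=> a u z uN zN m mN; rewrite linearP uN// zN.
- move=> g z gK zN m mN; have gU := subgroup_unit Kg gK.
  have gK' := subgroupV Kg gK; have mK := NK _ mN.
  have mN' := Nn _ _ gK' mN; rewrite invmxK in mN'.
  rewrite -sigmaM//.
  have -> : m *m g = g *m (invmx g *m m *m g) by rewrite !mulmxA mulmxV// mul1mx.
  by rewrite (sigmaM _ gK (NK _ mN')) zN.
Qed.

Lemma deep_trivial : exists n : nat, forall g x, KK n g -> sigma g x = x.
Proof.
have [_ [x x0] _] := irr.
have [n nx] := proj1 (@smooth_vectorP V Kp (fun g => sigma g) x Kg sigmaM (sigma1 x)) (smooth x).
(* Levels are doubled, and the grading shifts an entry by at most 2. *)
pose N := (2 * `|n| + 2)%N; exists N => g y.
have [_ KKp KKc] := KKn N.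
apply: (normal_fixed KKp KKc (x := x)) => // h hN.
apply: nx; first exact: cong_par hN.
case: hN => _ hN; apply: close_sym => i j.
have := hN i j; rewrite !mxE => H; apply: (pi2_to_pideal H).
by move: i j {H}; apply: ord3P; apply: ord3P; rewrite /gr_id /N /=; lia.
Qed.

Lemma KK_quot m g h : Kp g -> G h -> gr v gr_id m%:Z (h - g) -> KK m (invmx g *m h).
Proof.
move=> gK hG gh; have [gG _] := gK; have gU := subgroup_unit Kg gK.
have [gG' gK'] := subgroupV Kg gK.
split; first exact: unitary_mul.
have -> : invmx g *m h - 1%:M = invmx g *m (h - g) by rewrite mulmxBr mulVmx.
by rewrite -[m%:Z]add0r; exact: grM.
Qed.

Lemma KK_comm m g h x : (0 < m)%N -> KK m g -> KK m h ->
  (forall n x, KK m.+1 n -> sigma n x = x) -> sigma g (sigma h x) = sigma h (sigma g x).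
Proof.
move=> m0 gm hm triv; have [gK hK] := (cong_par gm, cong_par hm).
rewrite -!sigmaM//; apply/esym/sigma_quot.
- exact: subgroupM.
- exact: subgroupM.
apply: triv; apply: KK_quot; first exact: subgroupM.
  by apply: unitary_mul; [case: gm|case: hm].
have -> : g *m h - h *m g = (g - 1%:M) *m (h - 1%:M) - (h - 1%:M) *m (g - 1%:M).
  rewrite !mulmxBl !mulmxBr !mulmx1 !mul1mx.
  by move: (g *m h) (h *m g) => a b; apply/matrixP => i j; rewrite !mxE; ring.
apply: (gr_le (n := m%:Z + m%:Z)); last by lia.
by apply: grB; apply: grM; [case: gm|case: hm|case: hm|case: gm].
Qed.

(** In (1 + X)^n = 1 + n X + ... the omitted terms have level at least 2m, and for n = p the
    coefficient of X lies in the maximal ideal. *)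
Lemma KK_pow m g : (0 < m)%N -> KK m g -> KK m.+1 (iter p (mulmx g) 1%:M).
Proof.
move=> m0 gm; have [gG gX] := gm.
have KKs : subgroup (KK m) by case: (KKn m).
have H n : gr v gr_id m.+1%:Z (iter n (mulmx g) 1%:M - 1%:M - (g - 1%:M) *+ n).
  elim: n => [|n IH]; first by rewrite /= subrr mulr0n subr0 => i j; rewrite mxE; left.
  rewrite iterS; set gn := iter n (mulmx g) 1%:M in IH *.
  have -> : g *m gn - 1%:M - (g - 1%:M) *+ n.+1 =
    (gn - 1%:M - (g - 1%:M) *+ n) + (g - 1%:M) *m (gn - 1%:M).
    rewrite mulrS mulmxBl mulmxBr mulmx1 mul1mx; move: (g *m gn) ((g - 1%:M) *+ n).
    by move=> a b; apply/matrixP => i j; rewrite !mxE; ring.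
  apply: grD => //; apply: (gr_le (n := m%:Z + m%:Z)); last by lia.
  apply: grM => //; by case: (iter_subgroup n KKs gm).
split; first by apply: iter_subgroup gG; exact: unitary_subgroup.
have -> : iter p (mulmx g) 1%:M - 1%:M =
  (iter p (mulmx g) 1%:M - 1%:M - (g - 1%:M) *+ p) + (g - 1%:M) *+ p by rewrite subrK.
apply: grD => // i j; rewrite mulmxnE -mulr_natl.
have p1 : pi2 v 2 (p%:R : E) := pideal_pi2 (up_char up pk) (lexx _).
by apply: pi2_le (pi2M p1 (gX i j)) _; lia.
Qed.

(** Modulo level m + 1 the group [KK m] acts through finitely many commuting operators of exponent
    p. They have a common eigenvector, whose eigenvalues are p-th roots of unity in characteristic
    p, hence 1; a normal subgroup that fixes a nonzero vector of an irreducible representation acts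
    trivially. *)
Lemma KK_step m : (0 < m)%N -> (forall g x, KK m.+1 g -> sigma g x = x) ->
  forall g x, KK m g -> sigma g x = x.
Proof.
move=> m0 triv; have KKs : subgroup (KK m) by case: (KKn m).
(* [t (i, j)] generates the ideal allowed for the entry (i, j) at level m, so [code] records the
   leading coefficients of g - 1, in a finite set. *)
have /choice [t tP] : forall ij : 'I_3 * 'I_3, exists t : E, t != 0 /\
    v t = ((m%:Z + gr_id ij.1 - gr_id ij.2 + 1) %/ 2)%Z.
  by move=> ij; have [t t0 vt] := exists_dval ((m%:Z + gr_id ij.1 - gr_id ij.2 + 1) %/ 2)%Z; exists t.
pose code g : 'M[k * k]_3 := \matrix_(i, j) rE ((t (i, j))^-1 * (g - 1%:M) i j).
have codeP g h x : KK m g -> KK m h -> code g = code h -> sigma g x = sigma h x.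
  move=> gm hm gh; apply: sigma_quot; [exact: cong_par gm|exact: cong_par hm|].
  apply: triv; apply: KK_quot; [exact: cong_par gm|by case: hm|].
  move=> i j; have /matrixP/(_ i j) := gh; rewrite !mxE.
  have [t0 vt] := tP (i, j); rewrite /= in vt.
  have o f : KK m f -> pideal v 0 ((t (i, j))^-1 * (f i j - (i == j)%:R)).
    move=> [_ fm]; have := fm i j; rewrite !mxE => H.
    have H' : pideal v (v (t (i, j))) (f i j - (i == j)%:R).
      by apply: (pi2_to_pideal H); rewrite vt; lia.
    apply: (pidealM (m := - v (t (i, j))) _ H'); last by lia.
    by right; rewrite dvalV.
  move=> /(up_rE up (o _ gm) (o _ hm)) H.
  have -> : h i j - g i j = - (t (i, j) * ((t (i, j))^-1 * (g i j - (i == j)%:R)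
      - (t (i, j))^-1 * (h i j - (i == j)%:R))).
    by rewrite -mulrBr mulVKf//; ring.
  apply: pi2N; have tv : pideal v (v (t (i, j))) (t (i, j)) by right.
  by apply: (pideal_pi2 (pidealM tv H (lexx _))); rewrite vt; lia.
(* A code that does not occur is represented by 1, so that the operators are indexed by a finite
   type. *)
have /choice [r rP] : forall c, exists g, KK m g /\ ((exists2 h, KK m h & code h = c) -> code g = c).
  move=> c; have [[h hm hc]|nh] := pselect (exists2 h, KK m h & code h = c).
    by exists h; split.
  by exists 1%:M; split => //; exact: subgroup1.
have rK c : Kp (r c) by case: (rP c) => /cong_par.
have [_ [x0 x00] _] := irr.
have [||c d x _|c|y [_ y0 yr]] := commuting_eigenvector (Y := setT) (f := fun c => sigma (r c)) _ _ _ _ I x00 => //.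
- by apply: (KK_comm _ m0 (proj1 (rP c)) (proj1 (rP d))) => n y; apply: triv.
- exists p; first by apply: prime_gt0; exact: pcharf_prime pC.
  move=> x _; rewrite iter_sigma//; apply: triv.
  exact: (KK_pow m0 (proj1 (rP c))).
have [_ KKp KKc] := KKn m.
move=> g x gm; apply: (normal_fixed KKp KKc (x := y)) => // h hm.
have [rm rc] := rP (code h).
rewrite (codeP h (r (code h)) y hm rm); last by rewrite rc//; exists h.
have [c] := yr (code h); apply: (pchar_fixed pC) => //.
by rewrite iter_sigma//; apply: triv; exact: KK_pow.
Qed.

Lemma KK_trivial g x : KK 1 g -> sigma g x = x.
Proof.
have [n] := deep_trivial; case: n => [|n] triv g1.
  by apply: triv; exact: cong_le g1.
elim: n triv g x g1 => // n IH triv; apply: IH; exact: KK_step.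
Qed.

Lemma J1_low j : J1 j -> exists a, KK 1 (invmx (uK a) *m j).
Proof.
move=> jJ; have [a /(J_sJs)] := ro_coset rank_one_K (proj1 jJ).
have J1s := J1_subgroup; have uJ := uK_J1 a => H; exists a.
have jJ1 := subgroupM J1s (subgroupV J1s uJ) jJ.
by apply: J1_congK => //; apply: H; case: jJ1.
Qed.

(** J1 is the product of the [uK a] and of the kernel of reduction: its image in the reductive
    quotient is the group of trace-zero residues, isomorphic to k. *)
Lemma sigma_J1 j : J1 j -> exists a, forall x, sigma j x = sigma (uK a) x.
Proof.
move=> jJ; have [a Ha] := J1_low jJ; exists a => x.
by apply: esym; apply: (sigma_quot (uKp a) (J1K jJ)); exact: KK_trivial.
Qed.

Lemma sigma_uKD a b x : sigma (uK (a + b)) x = sigma (uK a) (sigma (uK b) x).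
Proof.
have J1s := J1_subgroup; have uJ a' := uK_J1 a'.
rewrite -sigmaM//; apply: sigma_quot => //; first exact: subgroupM Kg (uKp a) (uKp b).
apply: KK_trivial; apply: J1_congK.
  exact: subgroupM J1s (subgroupV J1s (uJ _)) (subgroupM J1s (uJ a) (uJ b)).
rewrite lowV_mul /uK low_mul !mxE /= mulr1 -mulrDr -mulrBr.
apply: (pidealM (wo (lexx 1)) (n := 1)) => //.
by rewrite -opprB; apply: pidealN; exact: (up_tzD up a b).
Qed.

Lemma sigma_uK0 x : sigma (uK 0) x = x.
Proof. by rewrite (ro_u0 (rank_one_K)) sigma1. Qed.

Lemma iter_sigma_uK a n x : iter n (sigma (uK a)) x = sigma (uK (a *+ n)) x.
Proof.
elim: n => [|n IH]; first by rewrite mulr0n sigma_uK0.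
by rewrite iterS IH mulrS sigma_uKD.
Qed.

Lemma iter_sigma_uK_p a x : iter p (sigma (uK a)) x = x.
Proof. by rewrite iter_sigma_uK mulrn_pchar// sigma_uK0. Qed.

Lemma exists_J1_fixed : exists2 x, x != 0 & forall j, J1 j -> sigma j x = x.
Proof.
have [_ [x0 x00] _] := irr.
have [||a b x _|a|y [_ y0 yr]] := commuting_eigenvector (Y := setT)
  (f := fun a => sigma (uK a)) _ _ _ _ I x00 => //.
- by rewrite -!sigma_uKD addrC.
- exists p; first by apply: prime_gt0; exact: pcharf_prime pC.
  by move=> x _; exact: iter_sigma_uK_p.
exists y => // j /sigma_J1[a ->]; have [c] := yr a.
by apply: (pchar_fixed pC) => //; exact: iter_sigma_uK_p.
Qed.

(** On the vectors fixed by J1 the group J acts through its reduced diagonal, a finite commutative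
    group; the finite order of each operator comes from the pigeonhole principle among its
    powers. *)
Lemma exists_J_eigen : exists y, [/\ y != 0, forall j, J1 j -> sigma j y = y &
  forall j, J j -> exists c, sigma j y = c *: y].
Proof.
have [x0 x00 x0J] := exists_J1_fixed.
pose Y : set V := [set x | forall j, J1 j -> sigma j x = x].
pose T := (k * k * (k * k) * (k * k))%type.
pose code (g : 'M[E]_3) : T := (rE (g i0 i0), rE (g i1 i1), rE (g i2 i2)).
have codeJ g h : J g -> J h -> code g = code h -> J1 (invmx g *m h).
  move=> gJ hJ [E0 E1 E2]; apply: J1_quot => // i.
  apply/(up_rE up); [exact: (J_oii i gJ)|exact: (J_oii i hJ)|].
  by move: i; apply: ord3P.
have Yeq g h x : J g -> J h -> Y x -> J1 (invmx g *m h) -> sigma g x = sigma h x.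
  by move=> gJ hJ Yx gh; apply: sigma_quot; [exact: JK|exact: JK|exact: Yx].
have /choice [r rP] : forall c, exists g, J g /\ ((exists2 h, J h & code h = c) -> code g = c).
  move=> c; have [[h hm hc]|nh] := pselect (exists2 h, J h & code h = c).
    by exists h; split.
  by exists 1%:M; split => //; exact: subgroup1 Jg.
have rJ c : J (r c) by case: (rP c).
have [||c d x Yx|c|y [Yy y0 yr]] := commuting_eigenvector (Y := Y)
  (f := fun c => sigma (r c)) _ _ _ _ x0J x00.
- by move=> a u z uN zN m mN; rewrite linearP uN// zN.
- move=> c x Yx j jJ; have gU := subgroup_unit Jg (rJ c).
  have [_ _ /(_ _ _ (subgroupV Jg (rJ c)) jJ)] := J1_normal; rewrite invmxK => j'J.
  have [[jK rK] j'K] := (J1K jJ, JK (rJ c), J1K j'J).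
  rewrite -sigmaM//.
  have -> : j *m r c = r c *m (invmx (r c) *m j *m r c) by rewrite !mulmxA mulmxV// mul1mx.
  by rewrite sigmaM// Yx.
- have [cK dK] := (JK (rJ c), JK (rJ d)); rewrite -!sigmaM//.
  apply: Yeq => //; [exact: subgroupM|exact: subgroupM|].
  apply: J1_quot; [exact: subgroupM|exact: subgroupM|move=> i].
  have e1 := J_diagM i (rJ c) (rJ d); have e2 := J_diagM i (rJ d) (rJ c).
  have -> : (r c *m r d) i i - (r d *m r c) i i =
    ((r c *m r d) i i - r c i i * r d i i) - ((r d *m r c) i i - r d i i * r c i i) by ring.
  exact: pidealB.
- set g := r c; have gJ : J g by exact: rJ.
  have gnJ n : J (iter n (mulmx g) 1%:M) by exact: iter_subgroup.
  have [i [j [ij cij]]] : exists i j : nat, (i < j)%N /\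
      code (iter i (mulmx g) 1%:M) = code (iter j (mulmx g) 1%:M).
    apply: contrapT => nij.
    have inj : injective (fun i : 'I_(#|{: T}|.+1) => code (iter i (mulmx g) 1%:M)).
      move=> i j cij; apply: contrapT => /eqP; rewrite neq_ltn => /orP[] lt; apply: nij.
        by exists i, j.
      by exists j, i.
    by have := leq_card _ inj; rewrite card_ord ltnn.
  exists (j - i)%N; first by rewrite subn_gt0.
  move=> x Yx; have := Yeq _ _ x (gnJ i) (gnJ j) Yx (codeJ _ _ (gnJ i) (gnJ j) cij).
  have gK := JK gJ; have gU := subgroup_unit Jg gJ.
  rewrite -!iter_sigma// -{1}(subnKC (ltnW ij)) iterD => E1.
  have sinj : injective (sigma g).
    move=> a b ab; rewrite -[a]sigma1 -[b]sigma1 -(mulVmx gU).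
    by rewrite !sigmaM ?ab//; exact: subgroupV.
  apply/esym; move: E1; move: (j - i)%N => d.
  by elim: (i) => [//|n IH]; rewrite !iterS => /sinj.
exists y; split => // j jJ; have [_ rc] := rP (code j).
have [c cE] := yr (code j); exists c; rewrite -cE.
apply: Yeq => //; apply: codeJ => //; rewrite rc//; by exists j.
Qed.

(** * The weight as a cyclic module over J1 *)

Hypothesis card_k : #|k| = p.
Context (w0 : V).
Hypothesis w00 : w0 != 0.
Hypothesis w0J1 : forall j, J1 j -> sigma j w0 = w0.
Hypothesis w0J : forall j, J j -> exists c, sigma j w0 = c *: w0.

(** J1 reduces to lower unipotent matrices, so [w0] is fixed by these and its reflection [y0] by the
    upper ones; [j_sigma] takes its values in the line of [y0]. *)
Definition y0 : V := sigma s w0.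

Lemma sigma_s_y0 : sigma s y0 = w0.
Proof. by rewrite /y0 -sigmaM// s_s sigma1. Qed.

Lemma y0_neq0 : y0 != 0.
Proof. by apply: contraNneq w00 => E0; rewrite -sigma_s_y0 E0 linear0. Qed.

(** Were [w0] outside the span, [ro_notin_span] would keep it out of the submodule generated by the
    nonzero sum of the [sigma (uK a) y0], against irreducibility. Once [w0] is inside, the Bruhat
    decomposition makes the span stable under K1. *)
Lemma uK_span x : exists b : k -> C, x = \sum_a b a *: sigma (uK a) y0.
Proof.
pose Y : set V := [set x | exists b : k -> C, x = \sum_a b a *: sigma (uK a) y0].
have Ylin a u z : Y u -> Y z -> Y (a *: u + z).
  move=> [b ->] [c ->]; exists (fun i => a * b i + c i).
  rewrite scaler_sumr -big_split; apply: eq_bigr => i _.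
  by rewrite scalerDl scalerA.
have Y0 : Y 0 by exists (fun=> 0); rewrite big1// => i _; rewrite scale0r.
pose Z : {pred V} := [pred z | `[< Y z >]].
have ZE z : z \in Z <-> Y z by split=> [/asboolP|?]; [|apply/asboolP].
have Zsub : submod_closed Z.
  by split; [exact/ZE|move=> a u z /ZE Yu /ZE Yz; apply/ZE; exact: Ylin].
have Yu a : Y (sigma (uK a) y0).
  exists (fun i => (i == a)%:R); rewrite (bigD1 a)//= eqxx scale1r big1 ?addr0//.
  by move=> i /negPf ->; rewrite scale0r.
have ro := rank_one_K.
have sl (g : 'M[E]_3) a (x' z : V) : sigma g (a *: x' + z) = a *: sigma g x' + sigma g z.
  by rewrite linearP.
have cardC : #|k|%:R = 0 :> C by rewrite card_k (pcharf0 pC).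
have w0u r : sigma (uK r) w0 = w0 by apply: w0J1; exact: uK_J1.
have w0N n : KK 1 n -> sigma n w0 = w0 by move=> /KK_trivial ->.
have uZ r : sigma (uK r *m s) w0 \in Z by apply/ZE; rewrite sigmaM.
have w0Y : Y w0.
  apply: contrapT => nY; have w0Z : w0 \notin Z by apply/negP => /ZE.
  set e := ro_e (fun g x => sigma g x) s uK w0.
  have e0 : e != 0.
    exact: (ro_e_neq0 ro sl sigmaM (sigma1 _) w0J w0N w0u Zsub w0Z uZ).
  pose W : set V := [set z | exists l : seq (C * 'M[E]_3),
    (forall ck, ck \in l -> Kp ck.2) /\ z = \sum_(ck <- l) ck.1 *: sigma ck.2 e].
  have [l [lK w0E]] : W w0.
    apply: (irreducible_all (Y := W) irr _ _ _ e0).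
    - move=> a u z [l [lK ->]] [l' [lK' ->]].
      exists ([seq (a * ck.1, ck.2) | ck <- l] ++ l'); split.
        by move=> ck; rewrite mem_cat => /orP[/mapP[c cl ->]/=|/lK'//]; exact: lK.
      rewrite big_cat big_map scaler_sumr; congr (_ + _).
      by apply: eq_bigr => ck _; rewrite scalerA.
    - move=> g z gK [l [lK ->]]; exists [seq (ck.1, g *m ck.2) | ck <- l]; split.
        by move=> _ /mapP[c cl ->]/=; apply: KM => //; exact: lK.
      rewrite linear_sum big_map /= [LHS]big_seq [RHS]big_seq; apply: eq_bigr => ck cl.
      by rewrite linearZ sigmaM//; exact: lK.
    - exists [:: (1, 1%:M)]; split; last by rewrite big_seq1 scale1r sigma1.
      by move=> ck; rewrite inE => /eqP ->; exact: subgroup1 Kg.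
  exact: (ro_notin_span ro sl sigmaM cardC (sigma1 _) w0J w0N w0u Zsub w0Z uZ lK w0E).
have YK g : Kp g -> Y (sigma g w0).
  move=> gK; have [gJ|nJ] := pselect (J g).
    have [c ->] := w0J gJ; rewrite -[c *: w0]addr0; exact: Ylin.
  have [r [i [iJ ->]]] := ro_bruhat ro gK nJ.
  have [c cE] := w0J iJ.
  rewrite (sigmaM _ (KM (uKp r) sK) (JK iJ)) cE linearZ /= -[_ *: _]addr0; apply: Ylin => //.
  by rewrite sigmaM.
apply: (irreducible_all irr Ylin _ w0Y w00) => g _ gK [b ->].
rewrite linear_sum; elim/big_rec: _ => // a z _ Yz.
rewrite linearZ; apply: Ylin => //.
have -> : sigma g (sigma (uK a) y0) = sigma (g *m uK a *m s) w0.
  by rewrite (sigmaM _ (KM gK (uKp a)) sK) (sigmaM _ gK (uKp a)).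
exact: YK (KM (KM gK (uKp a)) sK).
Qed.

Let n1 := uK 1.
(** As J1 acts through the powers of [sigma n1], the kernel of [D] is the space of J1-invariants and
    its image is the kernel of the projection to the J1-coinvariants. *)
Definition D : {linear V -> V} := (sigma n1 \- idfun)%R.

Lemma DE x : D x = sigma n1 x - x. Proof. by []. Qed.

Lemma iter_D x : iter p D x = 0.
Proof.
have := iter_sub1_pchar (f := sigma n1) pC (iter_sigma_uK_p 1 x).
by [].
Qed.

Definition imD : set V := [set x | exists z, x = D z].

Lemma imD_lin a x y : imD x -> imD y -> imD (a *: x + y).
Proof. by move=> [x' ->] [y' ->]; exists (a *: x' + y'); rewrite linearP. Qed.

Lemma sigma_uK_imD a x : imD (sigma (uK a) x - x).
Proof.
have [n ->] := natr_surj pk card_k a.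
rewrite -iter_sigma_uK.
elim: n => [|n [z IH]]; first by rewrite /= subrr; exists 0; rewrite linear0.
rewrite iterS -(subrKA (sigma n1 x)) -linearB IH addrC.
exists (x + sigma n1 z); rewrite linearD !DE linearB.
by congr (_ + _).
Qed.

Lemma sigma_J1_imD j x : J1 j -> imD (sigma j x - x).
Proof.
by move=> /(sigma_J1)[a ->]; exact: sigma_uK_imD.
Qed.

(** All the [sigma (uK a) y0] agree with [y0] modulo the image of [D]. Together with [iter_D] this
    makes the weight a cyclic nilpotent module. *)
Lemma D_gen x : exists a z, x = a *: y0 + D z.
Proof.
have [b ->] := uK_span x.
elim/big_rec: _ => [|i _ _ [a [z ->]]]; first by exists 0, 0; rewrite scale0r linear0 addr0.
have [t tE] := sigma_uK_imD i y0.
exists (b i + a), (b i *: t + z).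
rewrite linearP -tE scalerBr scalerDl [RHS]addrACA; congr (_ + _).
by rewrite addrCA subrr addr0.
Qed.

Lemma J1_fixed_line x : (forall j, J1 j -> sigma j x = x) -> exists a, x = a *: w0.
Proof.
move=> xJ; apply: (nilpotent_cyclic_ker iter_D D_gen _ _ w00).
- by rewrite DE w0J1 ?subrr//; exact: uK_J1.
- by rewrite DE xJ ?subrr//; exact: uK_J1.
Qed.

Lemma y0_imD a : imD (a *: y0) -> a = 0.
Proof.
move=> [z az]; apply/eqP; apply: contraT => a0.
case: (nilpotent_cyclic_gen iter_D D_gen y0_neq0 (z := a^-1 *: z)).
have -> : D (a^-1 *: z) = a^-1 *: D z by rewrite linearZ.
by rewrite -az scalerA mulVf// scale1r.
Qed.

(* The coefficient of y0 in the decomposition of V as the sum of the line of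
   y0 and of the kernel of the projection to the coinvariants. *)
Definition lam (x : V) : C := xget 0 [set a | imD (x - a *: y0)].

Lemma lamP x : imD (x - lam x *: y0).
Proof.
apply: (@xgetPex _ 0 [set a | imD (x - a *: y0)]).
by have [a [z xE]] := D_gen x; exists a, z; rewrite xE addrAC subrr add0r.
Qed.

Let imDB x y : imD x -> imD y -> imD (x - y).
Proof. by move=> xD yD; rewrite -scaleN1r addrC; exact: imD_lin. Qed.

Lemma lam_uniq x a : imD (x - a *: y0) -> lam x = a.
Proof.
move=> xa; apply/eqP; rewrite -subr_eq0; apply/eqP; apply: y0_imD.
rewrite scalerBl; have -> : lam x *: y0 - a *: y0 = (x - a *: y0) - (x - lam x *: y0).
  by rewrite opprB [RHS]addrC addrA subrK.
by apply: imDB => //; exact: lamP.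
Qed.

Lemma lam_linear a x y : lam (a *: x + y) = a * lam x + lam y.
Proof.
apply: lam_uniq; rewrite scalerDl opprD addrACA -scalerA -scalerBr.
by apply: imD_lin; exact: lamP.
Qed.

Lemma lam_y0 : lam y0 = 1.
Proof. by apply: lam_uniq; rewrite scale1r subrr; exists 0; rewrite linear0. Qed.

Lemma lam_imD x : imD x -> lam x = 0.
Proof. by move=> xD; apply: lam_uniq; rewrite scale0r subr0. Qed.

Lemma lam0 : lam 0 = 0.
Proof. by apply: lam_imD; exists 0; rewrite linear0. Qed.

Lemma lamZ a x : lam (a *: x) = a * lam x.
Proof. by rewrite -[a *: x]addr0 lam_linear lam0 addr0. Qed.

Lemma lamD x y : lam (x + y) = lam x + lam y.
Proof. by rewrite -[x]scale1r lam_linear mul1r scale1r. Qed.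

Lemma lam_J1 j x : J1 j -> lam (sigma j x) = lam x.
Proof.
move=> jJ; apply/eqP; rewrite -subr_eq0 -[- lam x]mulN1r -lamZ -lamD scaleN1r.
by rewrite lam_imD//; exact: sigma_J1_imD.
Qed.

Lemma s_notJ : ~ J s.
Proof.
move=> /JE[_ /(_ i0 i2)]; rewrite betaK1E mxE /= => H.
apply: (@pideal_lt1 E v 1) => //.
by rewrite -(mulfV (up_w0 up)); apply: pidealM (wo (lexx 1)) H _.
Qed.

(** The vectors [x] such that [lam (sigma g x)] vanishes for all g outside J are stable under [D],
    because right multiplication by [uK 1] preserves the complement of J. Nilpotency leads to a
    nonzero one killed by [D], a multiple of [w0], which [s] carries to a multiple of [y0]. *)
Lemma lam_nonzero x : x != 0 -> exists g, [/\ Kp g, ~ J g & lam (sigma g x) != 0].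
Proof.
move=> x0; apply: contrapT => nx.
have {}nx g : Kp g -> ~ J g -> lam (sigma g x) = 0.
  by move=> gK gJ; apply/eqP; apply: contraT => l0; case: nx; exists g.
have : iter p D x = 0 by exact: iter_D.
elim: (p) x x0 nx => [|n IH] x x0 nx; first by move=> /= E0; rewrite E0 eqxx in x0.
rewrite iterSr; have [Dx|Dx] := eqVneq (D x) 0.
  have [a xE] : exists a, x = a *: w0.
    apply: (nilpotent_cyclic_ker iter_D D_gen _ _ w00) => //.
    by rewrite DE w0J1 ?subrr//; exact: uK_J1.
  have := nx s sK s_notJ; rewrite xE linearZ lamZ -/y0 lam_y0 mulr1 => a0.
  by move: x0; rewrite xE a0 scale0r eqxx.
apply: IH => // g gK gJ; rewrite DE linearB -(sigmaM _ gK (uKp 1)).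
have -> : - sigma g x = (-1) *: sigma g x by rewrite scaleN1r.
have ngu : ~ J (g *m uK 1).
  move=> gJ'; apply: gJ; have uJ := proj1 (uK_J1 1).
  have uU := subgroup_unit Jg uJ.
  by rewrite -(mulmxK uU g); apply: (subgroupM Jg) => //; exact: (subgroupV Jg).
by rewrite lamD lamZ (nx _ (KM gK (uKp 1)) ngu) (nx _ gK gJ) mulr0 addr0.
Qed.

(** * The pro-p core and the Hecke kernel *)

Local Notation core := (pro_p_core v p Kp).
Local Notation I1 := (Iw1 conj v p Kp).
Local Notation I1' := (Iw1' conj v p Kp).

Lemma pro_p_core1 : core 1%:M.
Proof.
have s1 : subgroup [set 1%:M : 'M[E]_3].
  split => //.
  - by move=> g ->; exact: unitmx1.
  - by move=> g h -> ->; rewrite /= mulmx1.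
  - by move=> g ->; rewrite /= invmx1.
exists [set 1%:M]; split => //.
  split => //; first by move=> g ->; exact: subgroup1 Kg.
  by move=> g n gK ->; rewrite /= mulmx1 mulmxV//; exact: subgroup_unit Kg gK.
split => //; first exact: compact_set1.
by move=> N _ _; exists 0%N; rewrite expn0 /lcosets image_set1; exact: card_set1.
Qed.

Lemma pro_p_core_sub : core `<=` Kp.
Proof. by move=> g [P [[_ PK _] _ Pg]]; exact: PK. Qed.

Lemma pro_p_core_conj g n : Kp g -> core n -> core (g *m n *m invmx g).
Proof.
move=> gK [P [[Ps PK Pn] Pp Pn']]; exists P; split => //; exact: Pn.
Qed.

Lemma upper_J1 a : Kp a -> upper_unip G a -> J1 (s *m a *m s).
Proof.
move=> aK [_ /is_trig_mxP tr a1].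
have sas : Kp (s *m a *m s) by apply: KM => //; exact: KM.
have a20 : a i2 i0 = 0 by have := tr i0 i2 isT; rewrite mxE.
split; first by apply: J_Kp => //; rewrite mul_s_s mxE /= a20 !mulr0; left.
by apply: ord3P; rewrite mul_s_s mxE /= a1 subrr; left.
Qed.

Lemma lower_J1 a : Kp a -> lower_unip G a -> J1 a.
Proof.
move=> aK [_ /is_trig_mxP tr a1]; split; last by move=> i; rewrite a1 subrr; left.
by apply: J_Kp => //; rewrite tr//; left.
Qed.

Lemma uK_lower a : lower_unip G (uK a).
Proof.
split; first by case: (uK_J1 a) => -[[]].
  apply/is_trig_mxP => i j; rewrite mxE; move: i j.
  by apply: ord3P; apply: ord3P.
by apply: ord3P; rewrite mxE.
Qed.

Lemma uK_upper a : upper_unip G (s *m uK a *m s).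
Proof.
have sG := s_unitary; have [[[uG _] _] _] := uK_J1 a.
split; first by apply: unitary_mul => //; exact: unitary_mul.
  apply/is_trig_mxP => i j; rewrite mxE mul_s_s !mxE; move: i j.
  by apply: ord3P; apply: ord3P; rewrite //= ?mulr0.
by apply: ord3P; rewrite mul_s_s !mxE.
Qed.

Let preim_unip (A : set 'M[E]_3) a : Kp a -> A a -> preim_image Kp core A a.
Proof.
move=> aK Aa; split => //; exists a; first by split.
by rewrite mulVmx; [exact: pro_p_core1|exact: subgroup_unit Kg aK].
Qed.

Lemma Iw1_line x : invariants I1 sigma x -> exists a, x = a *: y0.
Proof.
move=> xI; have [|a xE] := J1_fixed_line (x := sigma s x).
  move=> j /(sigma_J1)[a ->].
  have Ku : Kp (s *m uK a *m s) by apply: KM => //; exact: KM.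
  have := xI _ (preim_unip Ku (uK_upper a)).
  rewrite (sigmaM _ (KM sK (uKp a)) sK) (sigmaM _ sK (uKp a)) => /(congr1 (sigma s)).
  by rewrite -(sigmaM _ sK sK) s_s sigma1.
exists a; rewrite /y0 -linearZ -xE -(sigmaM _ sK sK) s_s sigma1//.
Qed.

(** The vectors fixed by a normal subgroup form a subrepresentation. The dichotomy stands in for a
    determination of the pro-p core: in the second case [j_sigma], and hence [phi], vanishes. *)
Lemma core_trivial_or : (forall g x, core g -> sigma g x = x) \/
  (forall x, invariants core sigma x -> x = 0).
Proof.
have [[x [xC x0]]|nx] := pselect (exists x, invariants core sigma x /\ x != 0).
  left=> g y gC.
  exact: (normal_fixed pro_p_core_sub pro_p_core_conj xC x0).
right=> x xC; apply/eqP; apply: contraT => x0; case: nx; by exists x.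
Qed.

Lemma Iw1_y0 : (forall g x, core g -> sigma g x = x) -> invariants I1 sigma y0.
Proof.
move=> triv g [gK [a [Ua aK] aC]].
have aU := subgroup_unit Kg aK.
rewrite -(mulKVmx aU g) (sigmaM _ aK (pro_p_core_sub aC)) (triv _ _ aC).
have sas := upper_J1 aK Ua.
rewrite -[y0]/(sigma s w0) -(sigmaM _ aK sK).
have -> : a *m s = s *m (s *m a *m s) by rewrite 2!mulmxA s_s mul1mx.
by rewrite (sigmaM _ sK (J1K sas)) w0J1.
Qed.

Lemma coinv_ker_imD : (forall g x, core g -> sigma g x = x) ->
  coinv_ker I1' sigma = imD.
Proof.
move=> triv; rewrite predeqE => x; split=> [xI|[z ->] W Wsub WI].
  suff : x \in [pred z | `[< imD z >]] by move=> /asboolP.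
  apply: xI.
    split; first by apply/asboolP; exists 0; rewrite linear0.
    move=> a u z /asboolP uD /asboolP zD; apply/asboolP.
    exact: imD_lin.
  move=> g y [gK [a [Ua aK] aC]]; apply/asboolP.
  have aU := subgroup_unit Kg aK.
  rewrite -(mulKVmx aU g) (sigmaM _ aK (pro_p_core_sub aC)) (triv _ _ aC).
  exact: (sigma_J1_imD _ (lower_J1 aK Ua)).
by rewrite DE; apply: WI; exact: (preim_unip (uKp 1) (uK_lower 1)).
Qed.

Lemma j_sigmaE : (forall g x, core g -> sigma g x = x) ->
  forall x, j_sigma conj v p Kp sigma x = lam x *: y0.
Proof.
move=> triv x; apply: xget_subset1.
  split; last by rewrite (coinv_ker_imD triv); exact: lamP.
  by move=> g gI; rewrite linearZ (Iw1_y0 triv gI).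
move=> y z [yI]; rewrite (coinv_ker_imD triv) => yD [zI zD].
have [a yE] := Iw1_line yI; have [b zE] := Iw1_line zI.
move: yD zD; rewrite {}yE {}zE.
move=> /lam_uniq <-.
by move=> /lam_uniq <-.
Qed.

Lemma j_sigma0 : (forall x, invariants core sigma x -> x = 0) ->
  forall x, j_sigma conj v p Kp sigma x = 0.
Proof.
move=> triv x; rewrite /j_sigma; case: xgetP => // y _ [yI _].
apply: triv => g gC; apply: yI; split; first exact: pro_p_core_sub.
exists 1%:M; last by rewrite invmx1 mul1mx.
split; last exact: subgroup1 Kg.
by split; [exact: unitary_1|apply/is_trig_mxP => i j ij; rewrite !mxE; case: eqP => // ji; move: ij; rewrite ji ltnn|move=> i; rewrite mxE eqxx].
Qed.

Lemma alpha_unitary : G (alpha w).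
Proof.
have -> : alpha w = s *m beta E by rewrite s_alpha mulmxA s_s mul1mx.
by apply: unitary_mul; [exact: s_unitary|exact: beta_unitary].
Qed.

Local Notation ph := (phi conj v w p Kp sigma).

(** The zero case gathers two situations: [core] has no nonzero fixed vector, or no function
    satisfies [phi_spec] and [xget] returns its default value. *)
Theorem phi_cases : (forall g x, ph g x = 0) \/
  [/\ forall g h x, Kp g -> Kp h -> ph (g *m alpha w *m h) x = lam (sigma h x) *: sigma g y0,
      forall g, ~ double_coset Kp (alpha w) g -> ph g = (fun=> 0) &
      invariants I1 sigma y0].
Proof.
have [[f fspec]|nf] := pselect (exists f, phi_spec conj v w p Kp sigma f); last first.
  left=> g x; rewrite /phi; case: xgetP => // f _ fspec.
  by case: nf; exists f.
have [d1 d2 d3] : phi_spec conj v w p Kp sigma ph by apply: xgetPex; exists f.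
have aG := alpha_unitary.
have [triv|triv] := core_trivial_or; [right|left].
  split => //; last exact: Iw1_y0.
  by move=> g h x gK hK; rewrite d2// d3 (j_sigmaE triv) linearZ.
move=> g x; have [[g1 g1K [g2 g2K <-]]|/d1 -> //] := pselect (double_coset Kp (alpha w) g).
by rewrite d2// d3 (j_sigma0 triv) linear0.
Qed.

(** * The compact induction *)

Local Notation Ind := (cInd conj v Kp sigma).
Local Notation rt := (@rtrans E V).
Local Notation T := (hecke_T conj v w p Kp sigma).

(* The function usually denoted by [a, x]. *)
Definition dl (a : 'M[E]_3) (x : V) : 'M[E]_3 -> V :=
  fun g => if `[< Kp (g *m invmx a) >] then sigma (g *m invmx a) x else 0.

Lemma dl_in k0 a x : Kp k0 -> G a -> dl a x (k0 *m a) = sigma k0 x.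
Proof.
move=> kK aG; have aU := GU aG.
by rewrite /dl mulmxK//; case: asboolP.
Qed.

Lemma dl_out a x g : ~ Kp (g *m invmx a) -> dl a x g = 0.
Proof. by rewrite /dl; case: asboolP. Qed.

Lemma dl_neq0 a x g : dl a x g != 0 -> Kp (g *m invmx a).
Proof. by rewrite /dl; case: asboolP => // _; rewrite eqxx. Qed.

Lemma dl_self a x : G a -> dl a x a = x.
Proof.
move=> aG; rewrite -{2}[a]mul1mx dl_in ?sigma1//; exact: subgroup1 Kg.
Qed.

Lemma dlP c a x y : dl a (c *: x + y) = c *: dl a x + dl a y.
Proof.
apply: funext => g; rewrite -[RHS]/(c *: dl a x g + dl a y g) /dl.
by case: asboolP => _; rewrite ?linearP// scaler0 addr0.
Qed.

Lemma dlD a x y : dl a (x + y) = dl a x + dl a y.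
Proof. by rewrite -[x]scale1r dlP !scale1r. Qed.

Lemma dl0 a : dl a 0 = 0.
Proof.
apply: funext => g; rewrite /dl; by case: asboolP => _; rewrite ?linear0.
Qed.

Lemma dlZ c a x : dl a (c *: x) = c *: dl a x.
Proof. by rewrite -[c *: x]addr0 dlP dl0 addr0. Qed.

Lemma dl_rtrans h a x : G h -> G a -> rtrans h (dl a x) = dl (a *m invmx h) x.
Proof.
move=> hG aG; apply: funext => g; rewrite /rtrans /dl.
rewrite invmxM ?invmxK ?unitmx_inv ?GU// -?mulmxA //.
Qed.

Lemma dl_same a b x : G a -> G b -> Kp (b *m invmx a) ->
  dl b x = dl a (sigma (invmx (b *m invmx a)) x).
Proof.
move=> aG bG' ba; have [aU bU] := (GU aG, GU bG').
have baV : invmx (b *m invmx a) = a *m invmx b.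
  by rewrite invmxM ?unitmx_inv// invmxK.
have kV : Kp (a *m invmx b) by rewrite -baV; exact: subgroupV.
apply: funext => g; rewrite /dl baV.
case: asboolP => gb.
  have ga : Kp (g *m invmx a).
    by have := KM gb ba; rewrite mulmxA mulmxKV.
  case: asboolP => // _; rewrite -sigmaM// mulmxA mulmxKV//.
by case: asboolP => // ga; case: gb; have := KM ga kV; rewrite mulmxA mulmxKV.
Qed.

Lemma rtransM g h (f : 'M[E]_3 -> V) : rtrans (g *m h) f = rtrans g (rtrans h f).
Proof. by apply: funext => x; rewrite /rtrans mulmxA. Qed.

Lemma rtrans1 (f : 'M[E]_3 -> V) : rtrans 1%:M f = f.
Proof. by apply: funext => x; rewrite /rtrans mulmx1. Qed.

Lemma rtrans_lin g c (f f' : 'M[E]_3 -> V) :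
  rtrans g (c *: f + f') = c *: rtrans g f + rtrans g f'.
Proof. by []. Qed.

Lemma smoothP (f : 'M[E]_3 -> V) : smooth_vector v G (@rtrans E V) f <->
  exists n, forall g, G g -> close n 1%:M g -> rtrans g f = f.
Proof.
apply: (@smooth_vectorP _ G (@rtrans E V) f Gg _ (rtrans1 f)).
by move=> g h y _ _; exact: rtransM.
Qed.

Lemma dl_cInd a x : G a -> Ind (dl a x).
Proof.
move=> aG; have aU := GU aG; split.
- move=> g ng; apply: dl_out => gK; apply: ng.
  by rewrite -(mulmxKV aU g); apply: GM => //; exact: KG.
- move=> k0 g kK gG; rewrite /dl -mulmxA.
  case: asboolP => [kg|nkg]; case: asboolP => [ga|nga] //.
  + by rewrite sigmaM.
  + case: nga; have := KM (subgroupV Kg kK) kg; rewrite mulKmx//.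
    exact: subgroup_unit Kg kK.
  + by case: nkg; apply: KM.
  + by rewrite linear0.
- apply/smoothP.
  have [m0 Hm0] := close_Kp (subgroup1 Gg).
  have [m1 Hm1] := proj1 (@smooth_vectorP V Kp (fun g => sigma g) x Kg
    sigmaM (sigma1 x)) (smooth x).
  have [na Ha] := entries_bounded a; have [nb Hb] := entries_bounded (invmx a).
  exists (Num.max m0 m1 + na%:Z + nb%:Z) => g gG g1.
  have c1 : close (Num.max m0 m1) 1%:M (a *m g *m invmx a).
    have := close_mulr Hb (close_mul Ha g1); rewrite mulmx1 mulmxV//.
    by move=> H; apply: close_le H _; lia.
  have gaG : G (a *m g *m invmx a) by apply: GM; [exact: GM|exact: GV].
  have kap : Kp (a *m g *m invmx a).
    have := Hm0 _ gaG; rewrite invmx1 mulmx1; apply.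
    by apply: close_le c1 _; rewrite le_max lexx.
  have kx : sigma (a *m g *m invmx a) x = x.
    by apply: Hm1 => //; apply: close_le c1 _; rewrite le_max lexx orbT.
  apply: funext => y; rewrite /rtrans /dl.
  have yE : y *m g *m invmx a = (y *m invmx a) *m (a *m g *m invmx a).
    by rewrite !mulmxA mulmxKV.
  rewrite yE; case: asboolP => [yga|nyga]; case: asboolP => [ya|nya] //.
  + by rewrite sigmaM// kx.
  + case: nya; have := KM yga (subgroupV Kg kap); rewrite mulmxK//.
    exact: subgroup_unit Kg kap.
  + by case: nyga; apply: KM.
- have [na Ha] := entries_bounded a.
  exists [set g | G g /\ forall i j, pideal v (- (na + 1)%N%:Z) (g i j)].
    by split; [move=> g []|exact: bounded_compact _].
  move=> g ng; apply: dl_out => gK; apply: ng; rewrite -(mulmxKV aU g).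
  split; first by apply: GM => //; exact: KG.
  have [_ ko] := KpE gK.
  move=> i j; rewrite mulmx3.
  have aux l : pideal v (- (na + 1)%N%:Z) ((g *m invmx a) i l * a l j).
    by apply: pidealM (ko i l) (Ha l j) _; case: (i == i0); case: (l == i2); lia.
  by do !apply: pidealD.
Qed.

Lemma cInd_lin c f f' : Ind f -> Ind f' -> Ind (c *: f + f').
Proof.
have E0 (h : 'M[E]_3) : (c *: f + f') h = c *: f h + f' h by [].
move=> [f0 fK fs [S [SG Sc] fS]] [f0' fK' fs' [S' [SG' Sc'] fS']]; split.
- by move=> g ng; rewrite E0 f0// f0'// scaler0 addr0.
- by move=> k0 g kK gG; rewrite !E0 fK// fK'// linearP.
- move/smoothP: fs => [n Hn]; move/smoothP: fs' => [n' Hn']; apply/smoothP.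
  exists (Num.max n n') => g gG g1; rewrite rtrans_lin Hn ?Hn'//.
    by apply: close_le g1 _; rewrite le_max lexx orbT.
  by apply: close_le g1 _; rewrite le_max lexx.
- exists (S `|` S').
    split; first by move=> g [/SG|/SG'].
    exact: compactU Sc Sc'.
  move=> g nSS; rewrite E0 fS ?fS' ?scaler0 ?addr0//.
    by move=> ?; apply: nSS; right.
  by move=> ?; apply: nSS; left.
Qed.

Lemma cInd0 : Ind 0.
Proof. by rewrite -(dl0 1%:M); apply: dl_cInd; exact: subgroup1 Gg. Qed.

Lemma cInd_sum (n : nat) (f : 'I_n -> 'M[E]_3 -> V) :
  (forall i, Ind (f i)) -> Ind (\sum_i f i).
Proof.
move=> fI; elim/big_rec: _ => [|i g _ gI]; first exact: cInd0.
by rewrite -[f i]scale1r; exact: cInd_lin.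
Qed.

Lemma cInd_dl f : Ind f -> exists n (a : 'I_n -> 'M[E]_3) (x : 'I_n -> V),
  (forall i, G (a i)) /\ f = \sum_i dl (a i) (x i).
Proof.
move=> fI; have [_ _ _ [S [SG Sc] fS]] := fI.
have [l [lG lS]] := compact_cosets SG Sc.
have {}lS g : f g != 0 -> exists2 a, a \in l & Kp (g *m invmx a).
  by move=> fg; apply: lS; apply: contrapT => /fS fg0; rewrite fg0 eqxx in fg.
elim: l f fI lG lS {S SG Sc fS} => [|b l IH] f fI lG lS.
  exists 0%N, (fun=> 1%:M), (fun=> 0); split; first by case.
  rewrite big_ord0; apply: funext => g; apply/eqP; apply: contraT => /lS[a].
  by rewrite in_nil.
have bG' := lG b (mem_head _ _); have bU := GU bG'.
have [||| n [a [x [aG fE]]]] := IH (- 1 *: dl b (f b) + f).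
- by apply: cInd_lin => //; exact: dl_cInd.
- by move=> a al; apply: lG; rewrite inE al orbT.
- move=> g; rewrite -[(_ + _) g]/(- 1 *: dl b (f b) g + f g) scaleN1r addrC subr_eq0.
  have [_ fK _ _] := fI.
  have [gb|ngb] := pselect (Kp (g *m invmx b)).
    by rewrite -(mulmxKV bU g) dl_in// fK// eqxx.
  rewrite dl_out// => /lS[a]; rewrite inE => /predU1P[-> //|al Ka].
  by exists a.
exists n.+1, (fun i => oapp a b (unlift ord0 i)), (fun i => oapp x (f b) (unlift ord0 i)).
split; first by move=> i; case: unliftP => [j _|_] //=.
rewrite big_ord_recl unlift_none /=.
under eq_bigr do rewrite liftK /=.
by rewrite -fE scaleN1r addrA subrr add0r.
Qed.

Lemma dl_reduced (n0 : nat) (a0 : 'I_n0 -> 'M[E]_3) (x0 : 'I_n0 -> V) :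
  (forall i, G (a0 i)) -> exists n (a : 'I_n -> 'M[E]_3) (x : 'I_n -> V),
  [/\ forall i, G (a i), forall i, x i != 0,
      forall i j, Kp (a i *m invmx (a j)) -> i = j &
      \sum_i dl (a0 i) (x0 i) = \sum_i dl (a i) (x i)].
Proof.
move=> a0G.
pose same a b := [/\ G a, G b & Kp (a *m invmx b)].
have [|||n [a [x [aG xn inj ->]]]] :=
    reduced_sum (F := dl) (P := fun a _ => G a) (same := same) _ _ _ (n0 := n0) (a0 := a0) (x0 := x0) a0G.
- by move=> a x x'; exact: dlD.
- by [].
- move=> a b x [aG bG' ab] _; exists (sigma (invmx (a *m invmx b)) x) => //.
  exact: dl_same.
by exists n, a, x; split => // i j ij; apply: inj; split.
Qed.

Let sV : invmx s = s. Proof. exact: invmx_eq s_s. Qed.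
Let uKJ (a : k) : J (uK a). Proof. by case: (uK_J1 a). Qed.
Let uKU (a : k) : uK a \in unitmx. Proof. exact: subgroup_unit Jg (uKJ a). Qed.
Let uJ1 r : J1 (uN r). Proof. exact: uN_J1. Qed.
Let uJ r : J (uN r). Proof. by case: (uJ1 r). Qed.
Let uU r : uN r \in unitmx. Proof. exact: subgroup_unit Jg (uJ r). Qed.

(** * The functions e0 and e1 at the vertex K0 *)

Definition e0 : 'M[E]_3 -> V := dl 1%:M w0.
Definition e1 : 'M[E]_3 -> V := ro_e rt bt uN e0.

Lemma e1E : e1 = \sum_r dl (bt *m invmx (uN r)) w0.
Proof.
apply: eq_bigr => r _; rewrite dl_rtrans ?mul1mx.
- by rewrite invmxM ?bV//; exact: GU bG.
- by apply: GM => //; exact: KG (JK (uJ r)).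
- exact: subgroup1 Gg.
Qed.

Lemma rtrans_dl1 k0 x : Kp k0 -> rt k0 (dl 1%:M x) = dl 1%:M (sigma k0 x).
Proof.
move=> kK; have G1 : G 1%:M by exact: subgroup1 Gg.
rewrite dl_rtrans ?mul1mx//; last exact: KG.
rewrite (dl_same (a := 1%:M)) ?invmx1 ?mulmx1 ?invmxK//.
- exact: GV (KG kK).
- exact: KV.
Qed.

Lemma e0_J j : J j -> exists c, rt j e0 = c *: e0.
Proof.
move=> jJ; have [c cE] := w0J jJ; exists c.
by rewrite rtrans_dl1 ?cE ?dlZ//; exact: JK.
Qed.

Lemma e0_J1 j : J1 j -> rt j e0 = e0.
Proof. by move=> jJ; rewrite rtrans_dl1 ?w0J1//; case: jJ => /JK. Qed.

Lemma e0_1 : e0 1%:M = w0.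
Proof. by apply: dl_self; exact: subgroup1 Gg. Qed.

(** Evaluation at 1 separates [e0] from its translates along the big cell, which live on other
    cosets of K1; this is the subspace required by [ro_notin_span]. *)
Let Z : {pred 'M[E]_3 -> V} := [pred f : 'M[E]_3 -> V | f 1%:M == 0].

Let Zsub : submod_closed Z.
Proof.
split; first by rewrite inE.
move=> c f f' /eqP f0 /eqP f0'; rewrite inE.
by rewrite -[(_ + _) 1%:M]/(c *: f 1%:M + f' 1%:M) f0 f0' scaler0 addr0.
Qed.

Let e0Z : e0 \notin Z. Proof. by rewrite inE e0_1. Qed.

Let ubZ r : rt (uN r *m bt) e0 \in Z.
Proof.
rewrite inE /rtrans mul1mx /e0 dl_out// invmx1 mulmx1 => H.
apply: beta_notJ; split => //.
by have := KM (KV (JK (uJ r))) H; rewrite mulKmx.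
Qed.

Let cardR : #|{: k * k * k}|%:R = 0 :> C.
Proof. by rewrite !card_prod card_k natrM (pcharf0 pC) mulr0. Qed.

Let ro := rank_one_K0.
Let rtl g c (f f' : 'M[E]_3 -> V) : rt g (c *: f + f') = c *: rt g f + rt g f'.
Proof. exact: rtrans_lin. Qed.
Let rtM g h (f : 'M[E]_3 -> V) : K0 g -> K0 h -> rt (g *m h) f = rt g (rt h f).
Proof. by move=> _ _; exact: rtransM. Qed.
Let e0N n : cong conj v gr_0 2 n -> rt n e0 = e0.
Proof. by move=> /congK0_J1/e0_J1. Qed.
Let e0u r : rt (uN r) e0 = e0. Proof. exact: e0_J1. Qed.

Lemma e1_J1 r : rt (uN r) e1 = e1.
Proof. exact: (ro_e_u ro rtl rtM e0N). Qed.

Lemma e1_eigen j c : J j -> J (bt *m j *m bt) -> rt (bt *m j *m bt) e0 = c *: e0 ->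
  rt j e1 = c *: e1.
Proof.
move=> jJ bjJ jc.
by apply: (ro_e_eigen ro rtl rtM e0N jJ jJ (r := (0, 0, 0)) (r' := (0, 0, 0))) => //;
  rewrite (ro_u0 ro) mulmx1 mul1mx.
Qed.

Lemma e1_span (l : seq (C * 'M[E]_3)) : (forall ck, ck \in l -> K0 ck.2) ->
  e0 <> \sum_(ck <- l) ck.1 *: rt ck.2 e1.
Proof.
apply: (ro_notin_span ro rtl rtM cardR (rtrans1 e0) e0_J e0N e0u Zsub e0Z ubZ).
Qed.

Lemma e1_Ind : Ind e1.
Proof.
rewrite e1E; elim/big_rec: _ => [|r f _ fI]; first exact: cInd0.
rewrite -[dl _ _]scale1r; apply: cInd_lin => //.
apply: dl_cInd.
by apply: GM => //; apply: GV; exact: KG (JK (uJ r)).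
Qed.

Lemma e0_Ind : Ind e0.
Proof. by apply: dl_cInd; exact: subgroup1 Gg. Qed.

Lemma e1_support g : e1 g != 0 ->
  exists k0 r, Kp k0 /\ g = k0 *m (bt *m invmx (uN r)).
Proof.
rewrite e1E fct_sumE => g0.
have [r rg] : exists r, dl (bt *m invmx (uN r)) w0 g != 0.
  apply: contrapT => nr; case/eqP: g0; apply: big1 => r _.
  by apply/eqP; apply: contraT => r0; case: nr; exists r.
have aU : bt *m invmx (uN r) \in unitmx by rewrite unitmx_mul unitmx_inv uU (GU bG).
by exists (g *m invmx (bt *m invmx (uN r))), r; rewrite mulmxKV//; split => //; exact: dl_neq0 rg.
Qed.

Lemma e1_K k0 : Kp k0 -> e1 k0 = 0.
Proof.
move=> kK; apply/eqP; apply: contraT => /e1_support[k1 [r [k1K kE]]].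
case: beta_notJ; split => //.
have : Kp (k1 *m (bt *m invmx (uN r)) *m uN r) by rewrite -kE; apply: KM => //; exact: JK.
rewrite -!mulmxA mulVmx// mulmx1 => /(KM (KV k1K)).
by rewrite mulKmx//; exact: GU (KG k1K).
Qed.

Lemma e1_beta : e1 bt = w0.
Proof.
rewrite e1E fct_sumE (bigD1 (0, 0, 0))//= (ro_u0 ro) invmx1 mulmx1.
rewrite dl_self// big1 ?addr0// => r r0.
apply: dl_out => H; move/eqP: r0; apply; apply/esym.
apply: (ro_inj ro); rewrite (ro_u0 ro) invmx1 mul1mx.
have E1 : invmx (bt *m invmx (uN r)) = uN r *m bt.
  by rewrite invmxM ?unitmx_inv// ?invmxK ?bV//; exact: GU bG.
move: H; rewrite E1 mulmxA => H; split => //.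
by apply: K0M => //; apply: K0M => //; exact: JK0.
Qed.

Lemma e1_neq0 : e1 != 0.
Proof.
by apply: contraNneq w00 => e10; rewrite -e1_beta e10.
Qed.

(** Inside K0 each coset of K1 in the support of [e1] shrinks to a coset of J, and J acts on [w0] by
    scalars. Hence a function of the K0-span that lives on one edge is a multiple of a translate of
    [e0]. *)
Lemma e1_K0_line k0 : K0 k0 -> exists c, e1 k0 = c *: w0.
Proof.
move=> kK; have [->|e10] := eqVneq (e1 k0) 0; first by exists 0; rewrite scale0r.
have [k1 [r [k1K kE]]] := e1_support e10.
have k1J : J k1.
  split => //.
  have aK0 : K0 (bt *m invmx (uN r)) by apply: K0M => //; apply: K0V; exact: JK0.
  by rewrite -(mulmxK (subgroup_unit K0g aK0) k1) -kE; apply: K0M => //; exact: K0V.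
have [_ eK _ _] := e1_Ind.
rewrite kE eK//; last by apply: GM => //; apply: GV; exact: KG (JK (uJ r)).
have -> : e1 (bt *m invmx (uN r)) = e1 bt.
  by rewrite -{1}(e1_J1 r) /rtrans mulmxKV.
by rewrite e1_beta; exact: w0J.
Qed.

(** * Functions supported on K1 avoid the submodule *)

Section Proper.

Context (eta : 'M[E]_3 -> V).
Hypothesis etaI : Ind eta.
Hypothesis eta_supp : forall g, eta g != 0 -> exists k0 k1, [/\ Kp k0, K0 k1 & g = k0 *m k1].

Lemma tspan_support psi g : tspan K0 eta psi -> psi g != 0 ->
  exists k0 k1, [/\ Kp k0, K0 k1 & g = k0 *m k1].
Proof.
move=> pW; apply: (tspan_val pW (P := fun g => exists k0 k1, [/\ Kp k0, K0 k1 & g = k0 *m k1])).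
move=> h hK /eta_supp[k0 [k1 [kK k1K E1]]].
have hU := subgroup_unit K0g hK.
exists k0, (k1 *m invmx h); split => //; first by apply: K0M => //; exact: K0V.
by rewrite mulmxA -E1 mulmxK.
Qed.

Lemma tspan_Kp psi k0 g : tspan K0 eta psi -> Kp k0 -> G g -> psi (k0 *m g) = sigma k0 (psi g).
Proof.
move=> [l lK ->] kK gG; rewrite !fct_sumE linear_sum big_seq [RHS]big_seq.
apply: eq_bigr => ck /lK ckK.
have [_ eK _ _] := etaI.
rewrite -[LHS]/(ck.1 *: eta (k0 *m g *m ck.2)) -mulmxA eK//.
  by rewrite -[RHS]/(sigma k0 (ck.1 *: eta (g *m ck.2))) linearZ.
by apply: GM => //; exact: K0G.
Qed.

(* The K0-span of [eta] contains no function whose restriction to K0 vanishes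
   outside a single coset of J. *)
Hypothesis eta_spread : forall psi k0, tspan K0 eta psi -> K0 k0 -> psi k0 != 0 ->
  exists k1, [/\ K0 k1, ~ J (k1 *m invmx k0) & psi k1 != 0].

(** The terms are grouped by vertices K0 g and a farthest one is considered. By [eta_spread] its
    function is nonzero at a K1-vertex one step further out. No other term reaches that vertex,
    whose only neighbour closer to the origin is the chosen one, and [dl 1%:M x] vanishes there. *)
Lemma dl1_notin_tspan x : x != 0 -> ~ tspan G eta (dl 1%:M x).
Proof.
move=> x0 [l lG dlE].
pose P0 (a : 'M[E]_3) psi := G a /\ tspan K0 eta psi.
pose same (a b : 'M[E]_3) := [/\ G a, G b & K0 (invmx b *m a)].
have := reduced_sum (F := rt) (P := P0) (same := same) _ _ _
  (n0 := size l) (a0 := fun i => (tnth (in_tuple l) i).2)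
  (x0 := fun i => (tnth (in_tuple l) i).1 *: eta).
case.
- by [].
- move=> a f f' [aG fW] [_ fW']; split => //; exact: tspanD.
- move=> a b f [aG bG' ab] [_ fW]; exists (rt (invmx b *m a) f).
    split => //; apply: tspan_rtrans fW => h; exact: K0M.
  by rewrite -rtransM mulKVmx//; exact: GU.
- move=> i; split; first by apply: lG; exact: mem_tnth.
  by apply: tspanZ; apply: tspan_mem; exact: subgroup1 K0g.
move=> n [a [psi [aP psi0 inj sE]]].
have {dlE sE}E1 : dl 1%:M x = \sum_i rt (a i) (psi i).
  by rewrite -sE dlE [LHS]big_tnth.
have aG i : G (a i) := proj1 (aP i); have psiW i := proj2 (aP i).
have aVG i : G (invmx (a i)) := GV (aG i).
have [m0 Hm0] := inX_exists (fun i => invmx (a i)).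
have exM : exists m, `[< forall i, inZ (m : nat)%:Z (invmx (a i)) >].
  by exists m0.+1; apply/asboolP => i; have := inXZ (Hm0 i); have -> : m0%:Z + 1 = m0.+1%:Z by lia.
have [m /asboolP mZ mmin] := ex_minnP exM.
have n0 : (0 < n)%N.
  case: n a psi E1 {aP psi0 inj aG psiW aVG m0 Hm0 exM m mZ mmin} => // a psi E1.
  move: x0; rewrite -(dl_self (a := 1%:M) x (subgroup1 Gg)) E1 big_ord0.
  by rewrite eqxx.
have m1 : 0 < m%:Z by apply: (inZ_gt0 (aVG (Ordinal n0)) (mZ _)).
have [i iZ] : exists i, ~ inZ (m%:Z - 1) (invmx (a i)).
  apply: contrapT => ni; suff : (m <= m.-1)%N by lia.
  apply: mmin; apply/asboolP => i; apply: contrapT => iZ; apply: ni; exists i.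
  by move=> H; apply: iZ; have -> : m.-1%:Z = m%:Z - 1 by lia.
have [k0 [kK kX kn]] : exists k0, [/\ K0 k0, ~ inX (m%:Z - 1) (k0 *m invmx (a i)) & psi i k0 != 0].
  have [k0 kK kn] : exists2 k0, K0 k0 & psi i k0 != 0.
    have [g gn] : exists g, psi i g != 0.
      apply: contrapT => ng; case/eqP: (psi0 i); apply: funext => g.
      by apply/eqP; apply: contraT => gn; case: ng; exists g.
    have [k1 [k2 [k1K k2K gE]]] := tspan_support (psiW i) gn.
    exists k2 => //; apply: contraNneq gn => k2n.
    by rewrite gE (tspan_Kp (psiW i) k1K (K0G k2K)) k2n linear0.
  (* If the edge found leads inwards, [eta_spread] supplies a second one, which leads outwards. *)
  have [kX|kX] := pselect (inX (m%:Z - 1) (k0 *m invmx (a i))); last by exists k0.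
  have [k1 [k1K kJ k1n]] := eta_spread (psiW i) kK kn.
  exists k1; split => //.
  have kU := subgroup_unit K0g kK.
  have nZ : ~ inZ (m%:Z - 1) (k0 *m invmx (a i)).
    by move=> /(inZ_mul (K0V kK)); rewrite mulKmx.
  have := tree_outX kX nZ (K0M k1K (K0V kK)) kJ.
  by rewrite mulmxA mulmxKV.
have kiZ : inZ m%:Z (k0 *m invmx (a i)) := inZ_mul kK (mZ i).
have := congr1 (fun f => f (k0 *m invmx (a i))) E1.
rewrite dl_out; last first.
  rewrite invmx1 mulmx1 => /inX_Kp H; apply: kX; apply: inX_le H _; lia.
rewrite fct_sumE (bigD1 i)//= {1}/rtrans mulmxKV ?GU// big1 ?addr0.
  by move/esym/eqP; rewrite (negPf kn).
move=> j ji; apply/eqP; apply: contraT => /(tspan_support (psiW j))[k1 [k2 [k1K k2K kE]]].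
have k1U := subgroup_unit Kg k1K.
have k2E : invmx k1 *m (k0 *m invmx (a i)) = k2 *m invmx (a j).
  by rewrite -(mulmxK (GU (aG j)) (k0 *m invmx (a i))) kE -mulmxA mulKmx.
have k1J : J k1.
  apply: contrapT => nJ.
  have nJV : ~ J (invmx k1) by move=> /JV; rewrite invmxK.
  have := tree_outZ (GM (K0G kK) (aVG i)) kiZ kX (KV k1K) nJV.
  by rewrite k2E; apply; exact: inZ_mul k2K (mZ j).
case/eqP: ji; apply: inj; split => //.
have -> : invmx (a i) *m a j = invmx k0 *m (k1 *m k2).
  by rewrite -kE mulmxA mulKmx//; exact: subgroup_unit K0g kK.
by apply: K0M; [exact: K0V|apply: K0M => //; exact: JK0].
Qed.

End Proper.

Lemma hecke_T0 : (forall g x, ph g x = 0) -> forall f, T f = 0.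
Proof.
move=> ph0 f; apply: funext => g; rewrite /hecke_T fsbig1// => X _; exact: ph0.
Qed.

(** * The Hecke operator *)

Section Kernel.
Hypothesis phR1 : forall g h x, Kp g -> Kp h ->
  ph (g *m alpha w *m h) x = lam (sigma h x) *: sigma g y0.
Hypothesis phR2 : forall g, ~ double_coset Kp (alpha w) g -> ph g = (fun=> 0).

Lemma ph_lin g c x z : ph g (c *: x + z) = c *: ph g x + ph g z.
Proof.
have [[a aK [b bK <-]]|/phR2 ->] := pselect (double_coset Kp (alpha w) g).
  by rewrite !phR1// linearP lam_linear scalerDl scalerA.
by rewrite scaler0 addr0.
Qed.

Lemma ph0 g : ph g 0 = 0.
Proof.
have := ph_lin g 1 0 0; rewrite !scale1r addr0 => /eqP.
by rewrite -subr_eq0 opprD addNKr oppr_eq0 => /eqP.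
Qed.

Lemma ph_sum g (n : nat) (x : 'I_n -> V) : ph g (\sum_i x i) = \sum_i ph g (x i).
Proof.
elim/big_rec2: _ => [|i z1 z2 _ <-]; first exact: ph0.
by have := ph_lin g 1 (x i) z2; rewrite !scale1r.
Qed.

Lemma ph_K g k0 x : Kp k0 -> ph (g *m k0) x = ph g (sigma k0 x).
Proof.
move=> kK; have kU := subgroup_unit Kg kK.
have [[a aK [b bK <-]]|ng] := pselect (double_coset Kp (alpha w) g).
  by rewrite -mulmxA !phR1 ?sigmaM//; exact: KM.
rewrite !phR2// => -[a aK [b bK E1]]; apply: ng.
exists a => //; exists (b *m invmx k0); first by apply: KM => //; exact: KV.
by rewrite mulmxA E1 mulmxK.
Qed.

Lemma double_coset_unitary g : double_coset Kp (alpha w) g -> G g.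
Proof.
move=> [a aK [b bK <-]]; apply: GM; last exact: KG.
by apply: GM; [exact: KG|exact: alpha_unitary].
Qed.

Lemma lcoset_eq g h : G g -> Kp h -> lcoset (g *m h) Kp = lcoset g Kp.
Proof.
move=> gG hK; have hU := subgroup_unit Kg hK.
rewrite predeqE => x; split=> -[a aK <-].
  by exists (h *m a); [exact: KM|rewrite mulmxA].
exists (invmx h *m a); first by apply: KM => //; exact: KV.
by rewrite mulmxA mulmxK.
Qed.

(** Only the cosets of the g a^-1 contribute, which makes the sum finite; [ph_K] makes the term of a
    coset independent of the representative chosen by [xget]. *)
Lemma hecke_T_sum (n : nat) (a : 'I_n -> 'M[E]_3) (x : 'I_n -> V) g :
  (forall i, G (a i)) ->
  T (\sum_i dl (a i) (x i)) g = \sum_i ph (g *m invmx (a i)) (x i).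
Proof.
move=> aG.
have [gG|ng] := pselect (G g); last first.
  rewrite [RHS]big1; last first.
    move=> i _; rewrite phR2// => /double_coset_unitary dG; apply: ng.
    by rewrite -(mulmxKV (GU (aG i)) g); exact: GM.
  rewrite /hecke_T fsbig1// => X [b bG' <-].
  have : lcoset b Kp (xget 1%:M (lcoset b Kp)).
    by apply: xgetPex; exists (b *m 1%:M); exists 1%:M => //; exact: subgroup1 Kg.
  move: (xget _ _) => z [c cK zE].
  rewrite fct_sumE big1 ?ph0// => i _; apply: dl_out => K1; apply: ng.
  have zG : G z by rewrite -zE; apply: GM => //; exact: KG.
  rewrite -(mulKVmx (GU zG) g) -(mulmxKV (GU (aG i)) (invmx z *m g)).
  by apply: GM => //; apply: GM => //; exact: KG.
pose D : set (set 'M[E]_3) := range (fun i => lcoset (g *m invmx (a i)) Kp).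
have Dfin : finite_set D by apply: finite_image; exact: finite_finset.
have gaG i : G (g *m invmx (a i)) by apply: GM => //; exact: GV.
have DG : D `<=` lcosets G Kp by move=> _ [i _ <-]; exists (g *m invmx (a i)).
have term i b : G b ->
    let z := xget 1%:M (lcoset b Kp) in
    ph z (dl (a i) (x i) (invmx z *m g)) =
    (if `[< lcoset b Kp = lcoset (g *m invmx (a i)) Kp >] then
       ph (g *m invmx (a i)) (x i) else 0).
  move=> bG' z; have [c cK zE] : lcoset b Kp z.
    by apply: xgetPex; exists (b *m 1%:M); exists 1%:M => //; exact: subgroup1 Kg.
  have zG : G z by rewrite -zE; apply: GM => //; exact: KG.
  have bz : lcoset b Kp = lcoset z Kp by rewrite -zE lcoset_eq.
  have zU := GU zG; have aU := GU (aG i).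
  case: asboolP => [E1|ne].
    have [d dK zE'] : lcoset (g *m invmx (a i)) Kp z by rewrite -E1; exists c.
    have dU := subgroup_unit Kg dK.
    have gE : invmx z *m g = invmx d *m a i.
      apply: (can_inj (mulKmx zU)); rewrite mulKVmx// -{1}zE'.
      by rewrite -!mulmxA mulKVmx// mulVmx// mulmx1.
    rewrite gE dl_in//; last exact: KV.
    rewrite -zE' ph_K// -sigmaM//; last exact: KV.
    by rewrite mulmxV// sigma1.
  rewrite dl_out ?ph0// => K1; apply: ne.
  rewrite bz.
  have -> : g *m invmx (a i) = z *m (invmx z *m g *m invmx (a i)).
    by rewrite -mulmxA mulKVmx.
  by rewrite lcoset_eq.
rewrite /hecke_T -(@fsbig_widen _ _ _ _ D)//=; last first.
  move=> X [[b bG' <-] nD] /=; rewrite fct_sumE ph_sum big1// => i _.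
  rewrite (term i b bG'); case: asboolP => // E1.
  by case: nD; exists i.
under eq_fsbigr.
  move=> X _; rewrite fct_sumE ph_sum. over.
rewrite fsbig_finite//= exchange_big/=; apply: eq_bigr => i _.
rewrite -fsbig_finite//=.
rewrite -(@fsbig_widen _ _ _ _ [set lcoset (g *m invmx (a i)) Kp])/=.
- by rewrite fsbig_set1 term//; case: asboolP.
- by move=> _ ->; exists i.
- by move=> X [[j _ <-] ne] /=; rewrite term//; case: asboolP.
Qed.

(** * The operator T moves supports outwards *)

Section HeckeImage.
(** As [bt = s *m alpha w] with [s] in K1, [alpha w] and [bt] have the same double coset. In this
    form T visibly joins K1-vertices with a common K0-neighbour, and [w0] takes the place of
    [y0]. *)
Lemma ph_beta g h x : Kp g -> Kp h -> ph (g *m bt *m h) x = lam (sigma h x) *: sigma g w0.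
Proof.
move=> gK hK; have gsK := KM gK sK.
by rewrite s_alpha mulmxA phR1// sigmaM// sigma_s_y0.
Qed.

Lemma ph_support g x : ph g x != 0 -> exists k0 k1, [/\ Kp k0, Kp k1 & g = k0 *m bt *m k1].
Proof.
have [[a aK [b bK <-]] _|/phR2 ->] := pselect (double_coset Kp (alpha w) g); last by rewrite eqxx.
exists (a *m s), b; split => //; first by apply: KM => //; exact: s_Kp.
by rewrite s_alpha (mulmxA (a *m s)) -(mulmxA a s) s_s mulmx1.
Qed.

Context (eta : 'M[E]_3 -> V).
Hypothesis eta0 : eta != 0.
Hypothesis eta_supp : forall g, eta g != 0 -> exists k0 k1, [/\ Kp k0, K0 k1 & g = k0 *m k1].

(** In a reduced expression of [f] a farthest vertex [a i] is considered. Each outward direction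
    with nonzero [lam] gives a nonzero value of T f two steps further, where neither [f] nor another
    term contributes. As [eta] lives on the neighbours of K0, this forces [m = 0] and makes every
    such direction point to K0; but [lam_nonzero], applied twice, gives two distinct directions. The
    term [t *: f] treats T and T + 1 together. *)
Lemma eta_notin_image f t : Ind f -> eta <> T f + t *: f.
Proof.
move=> fI etaE.
have [n0 [a0 [x0 [a0G fE0]]]] := cInd_dl fI.
have [n [a [x [aG xn inj fE]]]] := dl_reduced x0 a0G.
rewrite {}fE in fE0; move: fE0 => fE {n0 a0 x0 a0G fI}.
have TE g : T f g = \sum_i ph (g *m invmx (a i)) (x i).
  by rewrite fE hecke_T_sum.
have [m0 Hm0] := inX_exists a.
have exM : exists m, `[< forall i, inX (m : nat)%:Z (a i) >].
  by exists m0; apply/asboolP.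
have [m /asboolP mX mmin] := ex_minnP exM.
have n_gt0 : (0 < n)%N.
  case: n a x fE TE {aG xn inj m0 Hm0 exM m mX mmin} => // a x fE TE.
  case/eqP: eta0; apply: funext => g; rewrite etaE -[LHS]/(T f g + t *: f g).
  by rewrite TE fE fct_sumE !big_ord0 scaler0 addr0.
have [i iX] : exists i, ~ inX (m%:Z - 1) (a i).
  have [m_eq0|m_gt0] := eqVneq m 0%N.
    exists (Ordinal n_gt0) => H.
    by have := inX_ge0 (aG (Ordinal n_gt0)) H; rewrite m_eq0.
  apply: contrapT => ni; suff : (m <= m.-1)%N by lia.
  apply: mmin; apply/asboolP => i; apply: contrapT => iZ; apply: ni; exists i.
  by move=> H; apply: iZ; have -> : m.-1%:Z = m%:Z - 1 by lia.
pose good k0 := Kp k0 /\ lam (sigma k0 (x i)) != 0.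
have goodX k0 : good k0 -> inX m (k0 *m a i) /\ ~ inX (m%:Z - 1) (k0 *m a i).
  move=> [kK _]; split; first exact: inX_mul kK (mX i).
  by move=> /(inX_mul (KV kK)); rewrite mulKmx//; exact: subgroup_unit Kg kK.
have eta_good k0 : good k0 -> ~ inZ m (k0 *m a i) -> eta (bt *m (k0 *m a i)) != 0.
  move=> kg nZ; have [kX nX] := goodX _ kg; have [kK kl] := kg.
  have kaG : G (k0 *m a i) by apply: GM => //; exact: KG.
  have bX : ~ inX m (bt *m (k0 *m a i)).
    exact: (tree_outX kX nZ bK0 beta_notJ).
  rewrite etaE -[(_ + _) _]/(T f (bt *m (k0 *m a i)) + t *: f (bt *m (k0 *m a i))).
  have -> : f (bt *m (k0 *m a i)) = 0.
    rewrite fE fct_sumE; apply: big1 => j _; apply/eqP; apply: contraT => /dl_neq0 H.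
    by case: bX; have := inX_mul H (mX j); rewrite mulmxKV//; exact: GU.
  rewrite scaler0 addr0 TE (bigD1 i)//= big1 ?addr0.
    rewrite mulmxA mulmxK ?GU// -{1}[bt]mul1mx ph_beta//; last exact: subgroup1 Kg.
    by rewrite sigma1 scaler_eq0 negb_or kl.
  move=> j ji; apply/eqP; apply: contraT => /ph_support[k1 [k2 [k1K k2K kE]]].
  case/eqP: ji; apply: inj.
  have k1U := subgroup_unit Kg k1K.
  have bE : bt *m (k2 *m a j) = invmx k1 *m (bt *m (k0 *m a i)).
    apply: (can_inj (mulKmx k1U)); rewrite mulKVmx//.
    by rewrite -(mulmxKV (GU (aG j)) (bt *m (k0 *m a i))) kE !mulmxA.
  have [j1 j1J [_ jE _]] := beta_step (inX_mul k2K (mX j)) kX nZ kaG (KV k1K) bE.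
  have -> : a j *m invmx (a i) = invmx k2 *m (j1 *m k0).
    rewrite -(mulKmx (subgroup_unit Kg k2K) (a j)) jE !mulmxA mulmxK//; exact: GU.
  by apply: KM; [exact: KV|apply: KM => //; exact: JK].
have [g1 [g1K _ g1l]] := lam_nonzero (xn i).
have x1 : sigma g1 (x i) != 0.
  apply: contraNneq g1l => ->; have /eqP := lam_linear 1 0 0.
  by rewrite scaler0 addr0 mul1r eq_sym -subr_eq0 addrK.
have [g2 [g2K g2J g2l]] := lam_nonzero x1.
have good1 : good g1 by [].
have good2 : good (g2 *m g1) by split; [exact: KM|rewrite sigmaM].
have inK0 k0 : m = 0%N -> good k0 -> K0 (k0 *m a i).
  move=> m_eq0 kg; have [kK _] := kg; have [kX nX] := goodX _ kg.
  have kaG : G (k0 *m a i) by apply: GM => //; exact: KG.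
  have nZ : ~ inZ m (k0 *m a i) by move=> /(inZ_gt0 kaG); rewrite m_eq0.
  have [k1 [k2 [k1K k2K kE]]] := eta_supp (eta_good _ kg nZ).
  have k1U := subgroup_unit Kg k1K.
  have bX : ~ inX m (bt *m (k0 *m a i)).
    exact: (tree_outX kX nZ bK0 beta_notJ).
  have bZ : inZ 1 (bt *m (k0 *m a i)).
    by apply: (inZ_mul bK0); have := inXZ kX; rewrite m_eq0.
  have k1J : J k1.
    apply: contrapT => nJ; have nJV : ~ J (invmx k1) by move=> /JV; rewrite invmxK.
    have := tree_outZ (GM bG kaG) bZ _ (KV k1K) nJV; rewrite kE mulKmx//.
    by apply; [rewrite -kE subrr; move: bX; rewrite m_eq0|exact: inZ_K0 k2K].
  have -> : k0 *m a i = bt *m (k1 *m k2) by rewrite -kE mulmxA beta_beta mul1mx.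
  by apply: K0M => //; apply: K0M => //; exact: JK0.
have m_eq0 : m = 0%N.
  have [k0 kg nZ] : exists2 k0, good k0 & ~ inZ m (k0 *m a i).
    have [H1|] := pselect (inZ m (g1 *m a i)); last by exists g1.
    have [_ nX] := goodX _ good1.
    exists (g2 *m g1) => //; rewrite -mulmxA; apply: (tree_outZ _ H1 nX g2K g2J).
    by apply: GM => //; exact: KG.
  have [kX nX] := goodX _ kg.
  have [k1 [k2 [k1K k2K kE]]] := eta_supp (eta_good _ kg nZ).
  have bX : ~ inX m (bt *m (k0 *m a i)).
    exact: (tree_outX kX nZ bK0 beta_notJ).
  apply/eqP; rewrite -leqn0 leqNgt; apply/negP => m_gt0; apply: bX.
  rewrite kE; apply: (inX_mul k1K); apply: (inX_le (inZX (inZ_K0 k2K))); lia.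
have H1 := inK0 _ m_eq0 good1; have H2 := inK0 _ m_eq0 good2.
apply: g2J; split => //.
have -> : g2 = (g2 *m g1 *m a i) *m invmx (g1 *m a i).
  rewrite -(mulmxA g2) mulmxK//; exact: subgroup_unit K0g H1.
by apply: K0M => //; exact: K0V.
Qed.

End HeckeImage.

(** * The operator T in terms of translates of e1 *)

Lemma e1_supp g : e1 g != 0 -> exists k0 k1, [/\ Kp k0, K0 k1 & g = k0 *m k1].
Proof.
move=> /(e1_support)[k0 [r [kK ->]]]; exists k0, (bt *m invmx (uN r)); split => //.
by apply: K0M => //; apply: K0V; exact: JK0.
Qed.

(** If [psi] vanished on K0 outside the coset of [k0], its translate would be supported on K1 with
    value [psi k0] at 1, a nonzero multiple of [w0]; so [e0] would lie in the K0-span of [e1]. *)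
Lemma e1_spread psi k0 : tspan K0 e1 psi -> K0 k0 -> psi k0 != 0 ->
  exists k1, [/\ K0 k1, ~ J (k1 *m invmx k0) & psi k1 != 0].
Proof.
move=> pW kK kn; apply: contrapT => nk.
have kU := subgroup_unit K0g kK.
have p'W : tspan K0 e1 (rt k0 psi) by apply: tspan_rtrans pW => h; exact: K0M.
have eI := e1_Ind.
have G1 : G 1%:M := subgroup1 Gg.
have pE : rt k0 psi = dl 1%:M (psi k0).
  have inKp g : Kp g -> rt k0 psi g = dl 1%:M (psi k0) g.
    move=> gK; rewrite -[g]mulmx1 dl_in// (tspan_Kp eI p'W)//.
    by rewrite /rtrans mul1mx.
  apply: funext => g; have [gK|gK] := pselect (Kp g); first exact: inKp.
  rewrite dl_out ?invmx1 ?mulmx1//; apply/eqP; apply: contraT => g0.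
  have [k1 [k2 [k1K k2K gE]]] := tspan_support e1_supp p'W g0.
  case: nk; exists (k2 *m k0); split; first exact: K0M.
    rewrite mulmxK// => jJ; apply: gK; rewrite gE; apply: KM => //; exact: JK.
  apply: contraNneq g0 => E1; rewrite gE (tspan_Kp eI p'W)//; last exact: K0G.
  by rewrite /rtrans E1 linear0.
have [c cE] : exists c, psi k0 = c *: w0.
  have [l lK ->] := pW; rewrite fct_sumE big_seq.
  elim/big_rec: _ => [|ck x /lK ckK [c ->]]; first by exists 0; rewrite scale0r.
  have [d dE] := e1_K0_line (K0M kK ckK).
  exists (ck.1 * d + c); rewrite -[X in X + _]/(ck.1 *: e1 (k0 *m ck.2)) dE.
  by rewrite scalerDl scalerA.
have c0 : c != 0 by apply: contraNneq kn => E1; rewrite cE E1 scale0r.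
have [l lK lE'] : tspan K0 e1 e0.
  have -> : e0 = c^-1 *: rt k0 psi by rewrite pE cE dlZ scalerA mulVf// scale1r.
  exact: tspanZ.
exact: (e1_span lK lE').
Qed.

(** Both scalars are the eigenvalue on [w0] of the [bt]-conjugate of [l]; for [lam] this results
    from evaluating [phi] at [bt *m l] in two ways. The equality makes
    [lam (sigma g x) *: rt (invmx g) e1] depend only on the edge J g. *)
Lemma lam_e1_J j : J j -> exists2 c, forall x, lam (sigma j x) = c * lam x & rt j e1 = c *: e1.
Proof.
move=> jJ; have [r rJ] := ro_coset rank_one_K0 jJ.
set l := invmx (uN r) *m j in rJ; have lJ : J l by apply: JM => //; exact: JV.
have jE : j = uN r *m l by rewrite /l mulKVmx.
have [c cE] := w0J rJ; exists c.
  move=> x; rewrite jE sigmaM; [|exact: JK|exact: JK].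
  rewrite lam_J1//.
  have K1 : Kp 1%:M := subgroup1 Kg.
  have := ph_beta x K1 (JK lJ); rewrite mul1mx sigma1.
  have -> : bt *m l = bt *m l *m bt *m bt *m 1%:M.
    by rewrite mulmx1 -(mulmxA _ bt bt) beta_beta mulmx1.
  rewrite ph_beta//; last exact: JK.
  rewrite sigma1 cE scalerA mulrC => /eqP.
  by rewrite -subr_eq0 -scalerBl scaler_eq0 (negPf w00) orbF subr_eq0 => /eqP ->.
rewrite jE rtransM (e1_eigen lJ rJ (c := c)).
  by rewrite -{2}(e1_J1 r); apply: funext.
by rewrite (rtrans_dl1 _ (JK rJ)) cE dlZ.
Qed.

(** Representatives of the q + 1 edges J g at the vertex K1; [None] is the edge towards K0. *)
Definition kap (b : option k) : 'M[E]_3 := if b is Some a then s *m invmx (uK a) else 1%:M.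

Lemma kap_Kp b : Kp (kap b).
Proof.
case: b => [a|]; last exact: subgroup1 Kg.
by apply: KM; [exact: s_Kp|apply: KV; exact: JK].
Qed.
Let kapU b : kap b \in unitmx. Proof. exact: subgroup_unit Kg (kap_Kp b). Qed.

Lemma kap_cover g : Kp g -> exists b j, J j /\ g = j *m kap b.
Proof.
move=> gK; have [gJ|gJ] := pselect (J g).
  by exists None, g; rewrite mulmx1.
have gJ' : ~ J (invmx g) by move=> /JV; rewrite invmxK.
have [a [i [iJ gE]]] := ro_bruhat rank_one_K (KV gK) gJ'.
have iU := subgroup_unit Jg iJ; have sU : s \in unitmx by case: s_unitary.
exists (Some a), (invmx i); split; first exact: JV.
have usU : uK a *m s \in unitmx by rewrite unitmx_mul uKU.
by rewrite -[g]invmxK gE (invmxM usU iU) (invmxM (uKU a) sU) sV.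
Qed.

Lemma kap_inj b b' : J (kap b *m invmx (kap b')) -> b = b'.
Proof.
have E1 (a : k) : invmx (kap (Some a)) = uK a *m s.
  by rewrite invmxM ?unitmx_inv ?invmxK ?sV//; case: s_unitary.
case: b b' => [a|] [a'|] //; rewrite ?E1 /kap ?invmx1 ?mulmx1 ?mul1mx.
- rewrite mulmxA -(mulmxA s) => H.
  by rewrite (ro_inj rank_one_K H).
- by move=> H; case: s_notJ; have := JM H (uKJ a); rewrite mulmxKV.
- by move=> H; case: s_notJ; have := JM (JV (uKJ a')) H; rewrite mulKmx.
Qed.

(** The left-hand side is T applied to [dl 1%:M x]. At a point of the double coset exactly one edge
    contributes, by [beta_step] and [kap_inj]. *)
Lemma hecke_dl1 x :
  (fun g => ph g x) = \sum_b lam (sigma (kap b) x) *: rt (invmx (kap b)) e1.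
Proof.
have eI := e1_Ind; have [_ eK _ _] := eI.
apply: funext => g; rewrite fct_sumE.
have [[k0 [k1 [k0K k1K ->]]]|ng] :=
  pselect (exists k0 k1, [/\ Kp k0, Kp k1 & g = k0 *m bt *m k1]); last first.
  rewrite (_ : ph g x = 0); last first.
    by apply/eqP; apply: contraT => /ph_support.
  rewrite big1// => b _; apply/eqP; apply: contraT => bn; case: ng.
  have /(e1_support)[k2 [r [k2K gE]]] : e1 (g *m invmx (kap b)) != 0.
    by apply: contraNneq bn => E1; rewrite -[_ g]/(_ *: e1 (g *m _)) E1 scaler0.
  exists k2, (invmx (uN r) *m kap b); split => //.
    by apply: KM (kap_Kp b); apply: KV; exact: JK.
  by rewrite -(mulmxKV (kapU b) g) gE !mulmxA.
have [b [j [jJ kE]]] := kap_cover k1K.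
rewrite ph_beta// kE (sigmaM _ (JK jJ) (kap_Kp b)).
have [c cE ec] := lam_e1_J jJ.
rewrite cE (bigD1 b)//= big1 ?addr0.
  rewrite -[RHS]/(_ *: e1 _) !mulmxA mulmxK//.
  rewrite -(mulmxA k0 bt j) eK//; last by apply: GM => //; exact: KG (JK jJ).
  rewrite -[e1 (bt *m j)]/(rt j e1 bt) ec -[(c *: e1) bt]/(c *: e1 bt).
  by rewrite e1_beta linearZ scalerA mulrC.
move=> b' bb'; apply/eqP; apply: contraT => bn.
set g' := k0 *m bt *m (j *m kap b).
have /(e1_support)[k2 [r [k2K gE]]] : e1 (g' *m invmx (kap b')) != 0.
  by apply: contraNneq bn => E1; rewrite -[_ g']/(_ *: e1 (g' *m _)) E1 scaler0.
have k2U := subgroup_unit Kg k2K.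
have zK : Kp (j *m kap b) by apply: KM (kap_Kp b); exact: JK.
have yK : Kp (invmx (uN r) *m kap b') by apply: KM (kap_Kp b'); apply: KV; exact: JK.
have nZ : ~ inZ 0 (j *m kap b) by move=> /(inZ_gt0 (KG zK)).
have yzE : bt *m (invmx (uN r) *m kap b') = invmx k2 *m k0 *m (bt *m (j *m kap b)).
  apply: (can_inj (mulKmx k2U)); rewrite -[in RHS]mulmxA mulKVmx//.
  by rewrite [RHS]mulmxA -/g' -[RHS](mulmxKV (kapU b')) gE !mulmxA.
have [j' j'J [_ jE _]] := beta_step (inX_Kp yK) (inX_Kp zK) nZ (KG zK) (KM (KV k2K) k0K) yzE.
case/eqP: bb'; apply: kap_inj.
have -> : kap b' = uN r *m (j' *m (j *m kap b)) by rewrite -jE mulKVmx.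
rewrite !mulmxA mulmxK//; apply: JM => //; exact: JM.
Qed.

Lemma hecke_in_tspan eta t : (forall x, tspan G eta ((fun g => ph g x) + t *: dl 1%:M x)) ->
  forall f, Ind f -> tspan G eta (T f + t *: f).
Proof.
move=> H f fI; have [n [a [x [aG ->]]]] := cInd_dl fI.
have -> : T (\sum_i dl (a i) (x i)) + t *: \sum_i dl (a i) (x i) =
    \sum_i rt (invmx (a i)) ((fun g => ph g (x i)) + t *: dl 1%:M (x i)).
  apply: funext => g.
  rewrite -[LHS]/(T (\sum_i dl (a i) (x i)) g + t *: (\sum_i dl (a i) (x i)) g).
  rewrite hecke_T_sum//.
  rewrite !fct_sumE scaler_sumr -big_split/=; apply: eq_bigr => i _.
  by rewrite -[RHS]/(_ + t *: dl 1%:M (x i) (g *m invmx (a i))) {2}/dl invmx1 mulmx1.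
by apply: tspan_sum => i; apply: tspan_rtrans (H _) => h hG; apply: GM => //; exact: GV.
Qed.

Lemma hecke_dl1_tspan x : tspan G e1 (fun g => ph g x).
Proof.
rewrite hecke_dl1; apply: tspan_sum => b; apply: tspanZ; apply: tspan_rtrans.
  by move=> h hG; apply: GM => //; apply: GV; exact: KG (kap_Kp b).
by apply: tspan_mem; exact: subgroup1 Gg.
Qed.

(** * One-dimensional weights *)

Hypothesis dV : dim1 V.

Definition theta (g : 'M[E]_3) : C := lam (sigma g y0).

Lemma dim1_line (x y : V) : x != 0 -> exists a, y = a *: x.
Proof.
move=> x0; have [e en eV] := dV; have [b bE] := eV x; have [c ->] := eV y.
have b0 : b != 0 by apply: contraNneq x0 => b0; rewrite bE b0 scale0r.
by exists (c / b); rewrite bE scalerA divfK.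
Qed.

Lemma thetaE g x : sigma g x = theta g *: x.
Proof.
have yn := y0_neq0.
have [a aE] := dim1_line (sigma g y0) yn; have [b ->] := dim1_line x yn.
by rewrite linearZ_LR /theta aE lamZ lam_y0 mulr1 !scalerA mulrC.
Qed.

Lemma thetaM g h : Kp g -> Kp h -> theta (g *m h) = theta g * theta h.
Proof. by move=> gK hK; rewrite -[LHS]/(lam (sigma (g *m h) y0)) sigmaM// thetaE lamZ. Qed.

Lemma theta1 : theta 1%:M = 1.
Proof. by rewrite /theta sigma1 lam_y0. Qed.

Lemma thetaV g : Kp g -> theta (invmx g) * theta g = 1.
Proof.
move=> gK; rewrite -thetaM ?mulVmx ?theta1//; [exact: GU (KG gK)|exact: KV].
Qed.

Lemma theta_J1 j : J1 j -> theta j = 1.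
Proof.
move=> /w0J1; rewrite thetaE => /eqP; rewrite -{2}[w0]scale1r -subr_eq0 -scalerBl.
by rewrite scaler_eq0 (negPf w00) orbF subr_eq0 => /eqP.
Qed.

Lemma theta_s : theta s * theta s = 1.
Proof. by rewrite -thetaM// s_s theta1. Qed.

Lemma lam_w0 : lam w0 = theta s.
Proof. by rewrite /theta sigma_s_y0. Qed.

Hypothesis y0I : invariants (Iw1 conj v p Kp) sigma y0.

Lemma chi_sigmaE g : chi_sigma conj v p Kp sigma g = theta g.
Proof.
apply: xget_subset1; first by move=> x _; exact: thetaE.
have uniq c : (forall x, invariants (Iw1 conj v p Kp) sigma x -> sigma g x = c *: x) ->
    c = theta g.
  by move=> /(_ _ y0I) E1; rewrite /theta E1 lamZ lam_y0 mulr1.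
by move=> a b /uniq -> /uniq ->.
Qed.

Lemma H0_diag h : Kp h -> is_diag_mx h -> H0 conj v p Kp h.
Proof.
move=> hK hd; have hG := KG hK; split; first by split.
split => //; exists h.
  split => //; exists h; first by split.
  exists 1%:M; last by rewrite mulmx1.
  split; [exact: unitary_1|apply/is_trig_mxP => i j ij|by move=> i; rewrite mxE eqxx].
  by rewrite !mxE; case: eqP ij => // ->; rewrite ltnn.
by rewrite mulVmx ?GU//; exact: pro_p_core1.
Qed.

(** The twist is conjugation by an element of K1, which a character of K1 does not see. So for such
    weights the last branch of [T_sigma] means that the character factors through the
    determinant. *)
Lemma dim1_chi_s_invariant : chi_s_invariant conj v p Kp s sigma.
Proof.
move=> h [_ [hK _]]; rewrite !chi_sigmaE (invmx_eq (s_s)).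
by rewrite (thetaM (KM sK hK) sK) (thetaM sK hK) mulrAC theta_s mul1r.
Qed.

Hypothesis chi_det : chi_factors_det conj v p Kp sigma.

(** The formula passes from diagonal matrices to J by [J_gauss], as J1 acts trivially on the line,
    and then to [s] by [s_relation], which yields 1 = theta h theta s. *)
Lemma theta_det : exists2 c, norm_one_char conj v c &
  (forall j, J j -> theta j = c (\det j)) /\ theta s = c (\det bt).
Proof.
have [c cN cE] := chi_det; exists c => //.
have diagE h : J h -> is_diag_mx h -> theta h = c (\det h).
  by move=> hJ hd; rewrite -chi_sigmaE cE//; apply: H0_diag => //; exact: JK.
split=> [j jJ|].
  have [l [h [u [l1 [hJ hd] u1 jE dE]]]] := J_gauss jJ.
  have [lK hK uK'] := And3 (J1K l1) (JK hJ) (J1K u1).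
  rewrite dE -diagE// jE (thetaM lK (KM hK uK')) (thetaM hK uK').
  by rewrite (theta_J1 l1) (theta_J1 u1) mul1r mulr1.
have [l [l' [h [[l1 l'1] [hJ hd] dh rel]]]] := s_relation.
have [lK l'K hK] := And3 (J1K l1) (J1K l'1) (JK hJ).
have := congr1 theta rel.
rewrite (thetaM (KM sK lK) sK) (thetaM sK lK) (thetaM (KM l'K (KM hK sK)) l'K).
rewrite (thetaM l'K (KM hK sK)) (thetaM hK sK) (theta_J1 l1) (theta_J1 l'1).
rewrite !mul1r !mulr1 theta_s diagE// dh det_s => E1.
by rewrite -[LHS]mul1r E1 -mulrA theta_s mulr1.
Qed.

Definition etaD := e0 + theta s *: e1.

Let etaE g : etaD g = e0 g + theta s *: e1 g. Proof. by []. Qed.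
Let det_c (c : E -> C) g h : norm_one_char conj v c -> G g -> G h ->
  c (\det (g *m h)) = c (\det g) * c (\det h).
Proof.
move=> [_ cM _] gG hG; rewrite det_mulmx cM//; exact: det_norm_one.
Qed.

Lemma etaD_Ind : Ind etaD.
Proof.
rewrite /etaD addrC; apply: cInd_lin; [exact: e1_Ind|exact: e0_Ind].
Qed.

Lemma etaD_neq0 : etaD != 0.
Proof.
apply: contraNneq w00 => E1; have := etaE 1%:M.
have K1 : Kp 1%:M := subgroup1 Kg.
by rewrite E1 e0_1 (e1_K K1) scaler0 addr0 => <-.
Qed.

Lemma etaD_supp g : etaD g != 0 -> exists k0 k1, [/\ Kp k0, K0 k1 & g = k0 *m k1].
Proof.
rewrite etaE; have [->|/e1_supp//] := eqVneq (e1 g) 0.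
rewrite scaler0 addr0 => /dl_neq0; rewrite invmx1 mulmx1 => gK.
by exists g, 1%:M; rewrite mulmx1; split => //; exact: subgroup1 K0g.
Qed.

(** On K0 the two summands live on complementary parts, J and the big cell; [theta s] is the
    coefficient for which they fit together into c o det. *)
Lemma etaD_det : exists2 c, norm_one_char conj v c &
  theta s = c (\det bt) /\ forall k0, K0 k0 -> etaD k0 = c (\det k0) *: w0.
Proof.
have [c cN [cJ cb]] := theta_det; exists c => //; split => // k0 k0K; rewrite etaE.
have [kJ|kJ] := pselect (J k0).
  have kK := JK kJ.
  have -> : e0 k0 = sigma k0 w0 by rewrite -[e0]/(dl 1%:M w0) -{1}[k0]mulmx1 dl_in//; exact: subgroup1 Gg.
  by rewrite (e1_K kK) scaler0 addr0 thetaE cJ.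
rewrite [e0 k0]dl_out ?add0r; last first.
  by rewrite invmx1 mulmx1 => kK; apply: kJ; apply/J_def.
have nJ : ~ J (invmx k0) by move=> /JV; rewrite invmxK.
have [r [i [iJ kE]]] := ro_bruhat rank_one_K0 (K0V k0K) nJ.
have iU := subgroup_unit Jg iJ; have bU := GU bG.
have ubU : uN r *m bt \in unitmx by rewrite unitmx_mul uU.
have kE' : k0 = invmx i *m (bt *m invmx (uN r)).
  by rewrite -[k0]invmxK kE (invmxM ubU iU) (invmxM (uU r) bU) bV.
have uG : G (uN r) := KG (JK (uJ r)).
have iG : G (invmx i) := GV (KG (JK iJ)).
have buG : G (bt *m invmx (uN r)) by apply: GM => //; exact: GV.
have [_ eK _ _] := e1_Ind.
rewrite kE' (eK _ _ (JK (JV iJ)) buG).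
have -> : e1 (bt *m invmx (uN r)) = w0.
  rewrite -[RHS]e1_beta.
  by rewrite -{1}(e1_J1 r) /rtrans mulmxKV.
rewrite thetaE scalerA (det_c cN iG buG) (det_c cN bG (GV uG)) -cb -!cJ//; try exact: JV.
have -> : theta (invmx (uN r)) = 1.
  by have := thetaV (JK (uJ r)); rewrite (theta_J1 (uJ1 r)) mulr1.
by rewrite mulr1 mulrC.
Qed.

(** Left translation by [bt] multiplies the restriction to K0 of each function of the span by the
    nonzero scalar [theta s], so a nonzero value on one edge is matched by one on another. *)
Lemma etaD_spread psi k0 : tspan K0 etaD psi -> K0 k0 -> psi k0 != 0 ->
  exists k1, [/\ K0 k1, ~ J (k1 *m invmx k0) & psi k1 != 0].
Proof.
have [c cN [cb cE]] := etaD_det.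
move=> [l lK ->] kK kn; exists (bt *m k0); split; first exact: K0M.
  by rewrite mulmxK; [exact: beta_notJ|exact: GU (K0G kK)].
have tsn : theta s != 0 by apply: contra_eq_neq theta_s => ->; rewrite mul0r eq_sym oner_eq0.
have step g : K0 g -> etaD (bt *m g) = theta s *: etaD g.
  by move=> gK; rewrite !cE//; [rewrite (det_c cN bG (K0G gK)) -cb scalerA|exact: K0M].
apply: contraNneq kn; rewrite !fct_sumE => E1.
have : theta s *: (\sum_(i <- l) (i.1 *: rt i.2 etaD) k0) = 0.
  rewrite -[RHS]E1 scaler_sumr big_seq [RHS]big_seq; apply: eq_bigr => ck /lK ckK.
  rewrite -[RHS]/(ck.1 *: etaD (bt *m k0 *m ck.2)) -mulmxA step; last exact: K0M.
  by rewrite -[LHS]/(theta s *: (ck.1 *: etaD (k0 *m ck.2))) !scalerA mulrC.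
by move=> /eqP; rewrite scaler_eq0 (negPf tsn) orFb.
Qed.

(** All edges contribute the same multiple of [e0], and p + 1 copies of it amount to one; the parts
    in [e1] add up to [hecke_dl1]. *)
Lemma etaD_hecke x : tspan G etaD ((fun g => ph g x) + 1 *: dl 1%:M x).
Proof.
have [b ->] := dim1_line x w00.
have kapE i : lam (sigma (kap i) (b *: w0)) = b * theta s * theta (kap i).
  by rewrite thetaE !lamZ lam_w0 mulrC.
have -> : (fun g => ph g (b *: w0)) + 1 *: dl 1%:M (b *: w0) =
    \sum_i (b * theta (kap i)) *: rt (invmx (kap i)) etaD.
  rewrite hecke_dl1.
  have e0K i : theta (kap i) *: rt (invmx (kap i)) e0 = e0.
    have iK := kap_Kp (i : option k).
    rewrite (rtrans_dl1 _ (KV iK)) thetaE dlZ scalerA.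
    by rewrite [_ * _]mulrC thetaV// scale1r.
  under [RHS]eq_bigr => i _.
    have -> : (b * theta (kap i)) *: rt (invmx (kap i)) etaD =
        b *: e0 + lam (sigma (kap i) (b *: w0)) *: rt (invmx (kap i)) e1.
      rewrite kapE -[in RHS](e0K i) /etaD [e0 + _]addrC rtrans_lin scalerDr !scalerA addrC.
      by congr (_ + _ *: _); ring.
    over.
  rewrite big_split/= sumr_const card_option card_k mulrSr -scaler_nat.
  by rewrite (pcharf0 pC) scale0r add0r scale1r dlZ addrC.
apply: tspan_sum => i; apply: tspanZ; apply: tspan_rtrans.
  by move=> h hG; apply: GM => //; apply: GV; exact: KG (kap_Kp i).
by apply: tspan_mem; exact: subgroup1 Gg.
Qed.

End Kernel.

(** * The cokernel *)

Lemma cInd_rtrans g f : G g -> Ind f -> Ind (rt g f).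
Proof.
move=> gG /(cInd_dl)[n [a [x [aG ->]]]].
have -> : rt g (\sum_i dl (a i) (x i)) = \sum_i dl (a i *m invmx g) (x i).
  apply: funext => h; rewrite /rtrans !fct_sumE; apply: eq_bigr => i _.
  by rewrite -[dl (a i *m _) _]dl_rtrans.
apply: cInd_sum => i; apply: dl_cInd.
by apply: GM => //; exact: GV.
Qed.

Lemma tspan_cInd eta f : Ind eta -> tspan G eta f -> Ind f.
Proof.
move=> eI [l lG ->]; rewrite big_seq; elim/big_rec: _ => [|ck f' /lG ckG fI].
  exact: cInd0.
by apply: cInd_lin => //; exact: cInd_rtrans.
Qed.

Context (Q : lmodType C) (rho : 'M[E]_3 -> {linear Q -> Q}).
Context (pr : ('M[E]_3 -> V) -> Q).
Hypothesis Qcok : is_coker conj v w p Kp s sigma rho pr.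
Local Notation Ts := (T_sigma conj v w p Kp s sigma).

(** The image of the span of [eta] is nonzero because [eta] is not in the image of [Ts]. It is
    proper: the image of [Ts] lies in the span, so if [pr e0] came from the span, [e0] itself would
    be in it. *)
Lemma coker_reducible eta : Ind eta ->
  (forall g, eta g != 0 -> exists k0 k1, [/\ Kp k0, K0 k1 & g = k0 *m k1]) ->
  (forall psi k0, tspan K0 eta psi -> K0 k0 -> psi k0 != 0 ->
    exists k1, [/\ K0 k1, ~ J (k1 *m invmx k0) & psi k1 != 0]) ->
  (forall f, Ind f -> tspan G eta (Ts f)) ->
  (forall f, Ind f -> eta <> Ts f) -> ~ irreducible_rep G rho.
Proof.
move=> eI esupp espread Tin Tout [_ _ Qirr].
have [prP prS prK prG] := Qcok.
have spI := fun f => @tspan_cInd eta f eI.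
pose W : {pred Q} := [pred q | `[< exists2 f, tspan G eta f & pr f = q >]].
have WP q : reflect (exists2 f, tspan G eta f & pr f = q) (q \in W) by exact: asboolP.
have I0 := cInd0.
have pr0 : pr 0 = 0.
  by have := prP 1 0 0 I0 I0; rewrite !scale1r addr0 => /esym/eqP;
    rewrite -subr_eq0 addrK => /eqP.
have Wsub : submod_closed W.
  split; first by apply/WP; exists 0 => //; exact: tspan0.
  move=> c _ _ /WP[f fW <-] /WP[f' fW' <-]; apply/WP; exists (c *: f + f').
    exact: tspan_lin.
  by rewrite prP//; exact: spI.
have WG g q : G g -> q \in W -> rho g q \in W.
  move=> gG /WP[f fW <-]; apply/WP; exists (rt g f).
    by apply: tspan_rtrans fW => h; exact: GM.
  by rewrite prG//; exact: spI.
have e0I := e0_Ind.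
have [W0|WT] := Qirr W Wsub WG.
  have : pr eta \in W by apply/WP; exists eta => //; apply: tspan_mem; exact: subgroup1 Gg.
  by rewrite W0 inE => /eqP /(prK _ eI)[f fI /(Tout _ fI)].
have /WP[f fW fE] : pr e0 \in W by rewrite WT.
have fI := spI _ fW.
have dI := cInd_lin (- 1) fI e0I.
have [|f' f'I f'E] := proj1 (prK _ dI).
  by rewrite prP// fE scaleN1r addNr.
apply: (dl1_notin_tspan eI esupp espread w00).
rewrite -[dl _ _](addrNK f) addrC; apply: tspanD => //.
by have := Tin _ f'I; rewrite -f'E scaleN1r addrC.
Qed.

Theorem coker_not_irreducible : ~ irreducible_rep G rho.
Proof.
move=> Qirr.
have TE : (forall f, Ts f = hecke_T conj v w p Kp sigma f) \/
    [/\ forall f, Ts f = hecke_T conj v w p Kp sigma f + 1 *: f, dim1 V &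
     ~ (chi_s_invariant conj v p Kp s sigma /\ ~ chi_factors_det conj v p Kp sigma)].
  rewrite /T_sigma; case: asboolP => [dV|_]; last by left.
  case: asboolP => [_|nchi]; first by left.
  by right; split => // f; rewrite scale1r.
have [ph0|[phR1 phR2 y0I]] := phi_cases.
  have T0 := hecke_T0 ph0; have [TsE|[TsE _ _]] := TE.
    apply: (coker_reducible e1_Ind e1_supp e1_spread) Qirr => f fI; rewrite TsE T0.
      exact: tspan0.
    by apply/eqP; exact: e1_neq0.
  (* Here [Ts] is the identity, so the cokernel is zero, whereas an irreducible representation has a
     nonzero vector. *)
  have [_ [q q0] _] := Qirr; have [_ prS prK _] := Qcok.
  have [f fI fE] := prS q; case/eqP: q0; rewrite -fE.
  by apply/(prK _ fI); exists f; rewrite // TsE T0 add0r scale1r.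
have [TsE|[TsE dV nchi]] := TE.
  have T0 f : Ts f = hecke_T conj v w p Kp sigma f + 0 *: f by rewrite TsE scale0r addr0.
  apply: (coker_reducible e1_Ind e1_supp e1_spread) Qirr => f fI; rewrite T0.
    apply: (hecke_in_tspan phR1 phR2) fI => x.
    rewrite scale0r addr0.
    exact: (hecke_dl1_tspan phR1 phR2).
  apply: (eta_notin_image phR1 phR2 _ e1_supp) fI.
  exact: e1_neq0.
have chi_det : chi_factors_det conj v p Kp sigma.
  apply: contrapT => nd; apply: nchi; split => //.
  exact: dim1_chi_s_invariant.
apply: (coker_reducible (eta := etaD)) Qirr.
- exact: etaD_Ind.
- exact: etaD_supp.
- exact: etaD_spread.
- move=> f fI; rewrite TsE.
  apply: (hecke_in_tspan phR1 phR2) fI => x.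
  exact: etaD_hecke.
- move=> f fI; rewrite TsE.
  apply: (eta_notin_image phR1 phR2 _ _) fI.
    exact: etaD_neq0.
  exact: etaD_supp.
Qed.

End Weight.

End UnramifiedU3.

Theorem theorem1p1
  (p : nat) (k : finFieldType) (p_char : p \in [pchar k]) (p_odd : odd p)
  (F : fieldType) (vF : dvaluation F) (red : F -> k)
  (locF : local_field vF red)
  (E : fieldExtType F) (vE : dvaluation E) (dimE : \dim {:E} = 2%N)
  (unrE : unramified vF vE)
  (conj : {lrmorphism E -> E}) (conj_nontriv : exists x, conj x != x)
  (w : E) (w_unif : uniformizer vE w) (w_in_F : w \in 1%VS)
  (C : closedFieldType) (iota : {rmorphism 'F_p -> C})
  (C_alg : integralRange iota)
  (card_k : #|k| = p)
  (V : lmodType C) (sigma : 'M[E]_3 -> {linear V -> V})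
  (sigma_irr : irreducible_rep (K1 conj vE) sigma)
  (sigma_smooth : smooth_rep vE (K1 conj vE) sigma)
  (Q : lmodType C) (rho : 'M[E]_3 -> {linear Q -> Q})
  (pr : ('M[E]_3 -> V) -> Q)
  (Q_coker :
     is_coker conj vE w p (K1 conj vE) (betaK1 w) sigma rho pr) :
  ~ irreducible_rep (unitary conj) rho.

Proof.
have prp : prime p by case/andP: p_char.
have pC : p \in [pchar C] by apply: (rmorph_pchar iota); exact: pchar_Fp.
have [rE [lE [tz up]]] := unram_pair_exists p_char p_odd locF dimE unrE conj_nontriv w_unif w_in_F.
have KE : K1 conj vE = par conj vE gr_id by exact: K1_par.
rewrite KE in sigma_irr sigma_smooth Q_coker.
have [y [y0 yJ1 yJ]] := exists_J_eigen up p_char pC sigma_irr sigma_smooth.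
exact: (coker_not_irreducible up p_char pC sigma_irr sigma_smooth card_k y0 yJ1 yJ Q_coker).
Qed.
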